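(* The \textsc{Frobenius} problem can be solved in time $$O\Big(a_n\log a_n\cdot\log\tfrac{F}{a_n}\Big)=O\Big(a_n\log a_n\cdot\log\tfrac{a_n}{n}\Big),$$ where $F=F(a_0,\dots,a_n)$ is the Frobenius number of the instance.
   Context: \textsc{Frobenius}: given integers $1\le a_0<a_1<\dots<a_n$ with $\gcd(a_0,\dots,a_n)=1$, compute the Frobenius number $F(a_0,\dots,a_n)$, the largest $t\in\mathbb{Z}_{\ge0}$ such that there is no $x\in\mathbb{Z}_{\ge 0}^{n+1}$ with $a_0x_0+\dots+a_nx_n=t$. *)

(* Defs.v *)
From Stdlib Require Import Arith List Lia.
Import ListNotations.

(* An instance is n together with a : nat -> nat, of which only a 0, ..., a n
   are relevant. *)
Definition lin_comb (n : nat) (a x : nat -> nat) : nat :=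
  fold_right (fun i s => a i * x i + s) 0 (seq 0 (S n)).

Definition representable (n : nat) (a : nat -> nat) (t : nat) : Prop :=
  exists x : nat -> nat, lin_comb n a x = t.

Definition is_frobenius_number (n : nat) (a : nat -> nat) (F : nat) : Prop :=
  ~ representable n a F /\ forall t, F < t -> representable n a t.

Definition valid_weights (n : nat) (a : nat -> nat) : Prop :=
  1 <= a 0 /\ forall i, i < n -> a i < a (S i).

Definition gcd_all (n : nat) (a : nat -> nat) : nat :=
  fold_right (fun i g => Nat.gcd (a i) g) 0 (seq 0 (S n)).

(* Registers are indexed by nat; every instruction costs one time unit.
   Operands in instructions are literal register addresses. *)
Inductive instr : Type :=
| IConst (r k : nat)
| IAdd (r s t : nat)
| ISub (r s t : nat)          (* M[r] := M[s] - M[t] (truncated) *)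
| IMul (r s t : nat)
| IDiv (r s t : nat)          (* M[r] := M[s] / M[t]  (0 if M[t] = 0) *)
| IMod (r s t : nat)
| ILoad (r s : nat)
| IStore (r s : nat)
| IJz (r l : nat)
| IJmp (l : nat)
| IHalt.

Definition program := list instr.

Record config := Config { pc : nat; mem : nat -> nat }.

Definition upd (m : nat -> nat) (r v : nat) : nat -> nat :=
  fun x => if Nat.eqb x r then v else m x.

Definition step (P : program) (c : config) : option config :=
  let m := mem c in
  let p := pc c in
  match nth_error P p with
  | None => None
  | Some IHalt => None
  | Some (IConst r k) => Some (Config (S p) (upd m r k))
  | Some (IAdd r s t) => Some (Config (S p) (upd m r (m s + m t)))
  | Some (ISub r s t) => Some (Config (S p) (upd m r (m s - m t)))
  | Some (IMul r s t) => Some (Config (S p) (upd m r (m s * m t)))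
  | Some (IDiv r s t) => Some (Config (S p) (upd m r (m s / m t)))
  | Some (IMod r s t) => Some (Config (S p) (upd m r (m s mod m t)))
  | Some (ILoad r s) => Some (Config (S p) (upd m r (m (m s))))
  | Some (IStore r s) => Some (Config (S p) (upd m (m r) (m s)))
  | Some (IJz r l) => Some (Config (if Nat.eqb (m r) 0 then l else S p) m)
  | Some (IJmp l) => Some (Config l m)
  end.

Fixpoint run (P : program) (k : nat) (c : config) : option config :=
  match k with
  | 0 => Some c
  | S k' => match step P c with
            | Some c' => run P k' c'
            | None => None
            end
  end.

Definition init_config (n : nat) (a : nat -> nat) : config :=
  Config 0 (fun x => match x with
                     | 0 => n
                     | S i => if Nat.leb i n then a i else 0
                     end).

(* P, started on the encoding of (n, a), halts after exactly k steps with
   output out in M[0], and during the whole run every memory cell holds a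
   value <= W (word-size restriction of the word RAM). *)
Definition halts_with (P : program) (n : nat) (a : nat -> nat)
    (k out W : nat) : Prop :=
  (exists c, run P k (init_config n a) = Some c /\ step P c = None
             /\ mem c 0 = out)
  /\ forall j c, j <= k -> run P j (init_config n a) = Some c ->
       forall x, mem c x <= W.

(* Main.v *)
(* Write N = a_n.  For a threshold T let W_T be the set of representable numbers in
   [T - 3N, T].  Since summands are at most N, cutting a representation of t in two
   parts at a suitable summand z shows that W_(T1+T2) is the part of
   W_T1 + ({0} u {a_0, ..., a_n}) + W_T2 lying in [T1 + T2 - 3N, T1 + T2]; a fixed-point
   complex FFT with words of O(log N) bits computes this sumset in O(N log N) steps.  The last N
   numbers up to T are all representable iff F + N <= T.  Doubling T until this
   holds, then a bisection down to precision 2N, takes O(log (F/N)) windows beyond the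
   first log N ones, whose sizes form a geometric series; F is then the largest number
   missing from the last window.

   For the second bound, let S = {0, a_0, ..., a_(n-1)} mod N, a generating set of Z/N
   with n + 1 elements.  Doubling a subset of Z/N containing S (D -> D + D) multiplies its size by
   at least 3/2 or else, by Freiman's theorem, D - D is a subgroup; this subgroup contains
   the generators, so D - D = Z/N and then also D + D = Z/N.  Hence 2k doublings of S with
   2^k (n + 1) > N reach every residue, which gives F < N * 4^k. *)

Require Import Defs.
From Coquelicot Require Coquelicot.
From Stdlib Require Reals Lra Psatz.
From Stdlib Require Import ZArith Classical FunctionalExtensionality Arith List Lia Bool.
Import ListNotations.
Set Bullet Behavior "Strict Subproofs".

(** * A while language and its compilation to the word RAM *)

(** The two bounds are linked: the word size must be fixed independently of F, and the cubic bound F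
    <= 4 N^3, a consequence of the second bound, makes every threshold and every stored window fit
    into words of O(log N) bits. The width 3N and the precision 2N are tied together. A cut at a
    summand can miss its target by up to N, and the deficit of t, at most 3N, can be shared so that
    neither part takes more than 2N. For unequal thresholds this needs one of them to be at least 2N
    and the other at least N, which holds as long as the bisection halves a gap above 2N; once the
    gap is at most 2N, F lies in the window of the upper end. Roots of unity come from half-angle
    formulas with integer square roots, and whether a convolution count vanishes is decided exactly,
    since the error stays below half the spacing of the exact values. Machine subtraction truncates
    at 0, so signed numbers are kept as residues modulo a large D. The program is written in a small
    while language whose semantics counts the steps of the compiled code exactly. *)

Inductive binop := OAdd | OSub | OMul | ODiv | OMod.

Inductive expr :=
| Var (r : nat)
| Num (k : nat)
| Bin (o : binop) (e1 e2 : expr)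
| Ld (e : expr).

Inductive cmd :=
| Asg (r : nat) (e : expr)
| Sto (e1 e2 : expr)
| Seq (c1 c2 : cmd)
| While (e : expr) (c : cmd)
| If (e : expr) (c1 c2 : cmd).

Record state := St { vr : nat -> nat; hp : nat -> nat }.

Definition setv (s : state) r x := St (upd (vr s) r x) (hp s).
(* An alias of [upd], so that [cbn [upd]] evaluates register updates only. *)
Definition hupd := upd.
Definition seth (s : state) a x := St (vr s) (hupd (hp s) a x).

Definition opf (o : binop) : nat -> nat -> nat :=
  match o with
  | OAdd => Nat.add | OSub => Nat.sub | OMul => Nat.mul
  | ODiv => Nat.div | OMod => Nat.modulo
  end.

Definition opi (o : binop) : nat -> nat -> nat -> instr :=
  match o with
  | OAdd => IAdd | OSub => ISub | OMul => IMul | ODiv => IDiv | OMod => IMod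
  end.

Fixpoint eval (s : state) (e : expr) : nat :=
  match e with
  | Var r => vr s r
  | Num k => k
  | Bin o e1 e2 => opf o (eval s e1) (eval s e2)
  | Ld e => hp s (eval s e)
  end.

(* Memory layout of compiled code: cells below 100 hold the variables, cells
   100..127 the temporaries, and heap address [a] is the cell [128 + a]. *)
Fixpoint ce (e : expr) (d : nat) : list instr :=
  match e with
  | Var r => [IConst d 0; IAdd d r d]
  | Num k => [IConst d k]
  | Bin o e1 e2 => ce e1 d ++ ce e2 (S d) ++ [opi o d d (S d)]
  | Ld e => ce e d ++ [IConst (S d) 128; IAdd d d (S d); ILoad d d]
  end.

Definition cost_e (e : expr) : nat := length (ce e 0).

Fixpoint clen (c : cmd) : nat :=
  match c with
  | Asg r e => cost_e e + 2
  | Sto e1 e2 => cost_e e1 + cost_e e2 + 3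
  | Seq c1 c2 => clen c1 + clen c2
  | While e c => cost_e e + clen c + 2
  | If e c1 c2 => cost_e e + clen c1 + clen c2 + 2
  end.

Fixpoint comp (c : cmd) (p : nat) : list instr :=
  match c with
  | Asg r e => ce e 100 ++ [IConst 101 0; IAdd r 100 101]
  | Sto e1 e2 =>
      ce e1 100 ++ ce e2 101 ++ [IConst 102 128; IAdd 100 100 102; IStore 100 101]
  | Seq c1 c2 => comp c1 p ++ comp c2 (p + clen c1)
  | While e c =>
      ce e 100 ++ IJz 100 (p + cost_e e + clen c + 2)
        :: comp c (p + cost_e e + 1) ++ [IJmp p]
  | If e c1 c2 =>
      ce e 100 ++ IJz 100 (p + cost_e e + clen c1 + 2)
        :: comp c1 (p + cost_e e + 1)
        ++ IJmp (p + cost_e e + clen c1 + clen c2 + 2)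
        :: comp c2 (p + cost_e e + clen c1 + 2)
  end.

Fixpoint depth (e : expr) : nat :=
  match e with
  | Var _ | Num _ => 1
  | Bin _ e1 e2 => Nat.max (depth e1) (S (depth e2))
  | Ld e => Nat.max (depth e) 2
  end.

Fixpoint esz (e : expr) : nat :=
  match e with
  | Var _ | Num _ => 1
  | Bin _ e1 e2 => esz e1 + esz e2
  | Ld e => S (esz e)
  end.

Fixpoint wfe (e : expr) : bool :=
  match e with
  | Var r => r <? 100
  | Num k => k <=? 128
  | Bin _ e1 e2 => wfe e1 && wfe e2
  | Ld e => wfe e
  end.

(** Temporaries start at cell 100 or 101 and must stay below 128. [max_size] is the exponent in the
    word bound [V ^ max_size]; sizes are kept strictly below it, so that one factor [V] is left for
    adding the heap offset 128 to a store address. *)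
Definition max_depth := 26.
Definition max_size := 40.

Definition oke (e : expr) : bool :=
  wfe e && (depth e <=? max_depth) && (esz e <? max_size).

Fixpoint okc (c : cmd) : bool :=
  match c with
  | Asg r e => (r <? 100) && oke e
  | Sto e1 e2 => oke e1 && oke e2
  | Seq c1 c2 => okc c1 && okc c2
  | While e c => oke e && okc c
  | If e c1 c2 => oke e && okc c1 && okc c2
  end.

(** Only assigned and stored values are required to be at most [V]; values inside an expression are
    controlled by its size. The last argument is the exact number of machine steps: the extra units
    in loops and conditionals are the test, the jump back and the jump over the else branch. *)
Inductive exec (V : nat) : cmd -> state -> state -> nat -> Prop :=
| exec_asg r e s :
    eval s e <= V -> exec V (Asg r e) s (setv s r (eval s e)) (cost_e e + 2)
| exec_sto e1 e2 s :
    eval s e2 <= V ->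
    exec V (Sto e1 e2) s (seth s (eval s e1) (eval s e2))
      (cost_e e1 + cost_e e2 + 3)
| exec_seq c1 c2 s s1 s2 k1 k2 :
    exec V c1 s s1 k1 -> exec V c2 s1 s2 k2 -> exec V (Seq c1 c2) s s2 (k1 + k2)
| exec_while0 e c s :
    eval s e = 0 -> exec V (While e c) s s (cost_e e + 1)
| exec_while e c s s1 s2 k1 k2 :
    eval s e <> 0 -> exec V c s s1 k1 -> exec V (While e c) s1 s2 k2 ->
    exec V (While e c) s s2 (cost_e e + 1 + (k1 + (1 + k2)))
| exec_if1 e c1 c2 s s1 k :
    eval s e <> 0 -> exec V c1 s s1 k ->
    exec V (If e c1 c2) s s1 (cost_e e + 1 + (k + 1))
| exec_if0 e c1 c2 s s1 k :
    eval s e = 0 -> exec V c2 s s1 k ->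
    exec V (If e c1 c2) s s1 (cost_e e + 1 + k).

Definition bnd (W : nat) (m : nat -> nat) : Prop := forall x, m x <= W.

Inductive steps (P : program) (W : nat) : nat -> config -> config -> Prop :=
| steps_0 c : bnd W (mem c) -> steps P W 0 c c
| steps_S k c c1 c2 :
    bnd W (mem c) -> step P c = Some c1 -> steps P W k c1 c2 ->
    steps P W (S k) c c2.

Lemma steps_trans P W k1 k2 c1 c2 c3 :
  steps P W k1 c1 c2 -> steps P W k2 c2 c3 -> steps P W (k1 + k2) c1 c3.
Proof.
  intros H; induction H; intros; simpl; auto.
  econstructor; eauto.
Qed.

Lemma steps_run P W k c c' :
  steps P W k c c' ->
  run P k c = Some c' /\
  forall j d, j <= k -> run P j c = Some d -> bnd W (mem d).
Proof.
  intros H; induction H as [c Hb|k c c1 c2 Hb Hs H [IH1 IH2]].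
  - split; [reflexivity|]. intros j d Hj Hr.
    replace j with 0 in Hr by lia. injection Hr as <-. exact Hb.
  - split; [simpl; rewrite Hs; exact IH1|].
    intros [|j] d Hj Hr; simpl in Hr.
    + injection Hr as <-. exact Hb.
    + rewrite Hs in Hr. apply (IH2 j); [lia|exact Hr].
Qed.

Definition code_at (P : program) (p : nat) (l : list instr) : Prop :=
  exists pre post, P = pre ++ l ++ post /\ length pre = p.

Lemma code_at_l P p l1 l2 : code_at P p (l1 ++ l2) -> code_at P p l1.
Proof.
  intros (pre & post & -> & Hp). exists pre, (l2 ++ post).
  rewrite <- !app_assoc. auto.
Qed.

Lemma code_at_r P p l1 l2 :
  code_at P p (l1 ++ l2) -> code_at P (p + length l1) l2.
Proof.
  intros (pre & post & -> & Hp). exists (pre ++ l1), post.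
  rewrite !length_app, <- !app_assoc. split; auto; lia.
Qed.

Lemma code_at_nth P p i l : code_at P p (i :: l) -> nth_error P p = Some i.
Proof.
  intros (pre & post & -> & Hp). rewrite nth_error_app2 by lia.
  replace (p - length pre) with 0 by lia. reflexivity.
Qed.

Lemma code_at_tl P p i l : code_at P p (i :: l) -> code_at P (S p) l.
Proof.
  intros H. apply (code_at_r P p [i]) in H. simpl in H.
  now rewrite Nat.add_1_r in H.
Qed.

Definition istep (i : instr) (m : nat -> nat) : option (nat -> nat) :=
  match i with
  | IConst r k => Some (upd m r k)
  | IAdd r s t => Some (upd m r (m s + m t))
  | ISub r s t => Some (upd m r (m s - m t))
  | IMul r s t => Some (upd m r (m s * m t))
  | IDiv r s t => Some (upd m r (m s / m t))
  | IMod r s t => Some (upd m r (m s mod m t))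
  | ILoad r s => Some (upd m r (m (m s)))
  | IStore r s => Some (upd m (m r) (m s))
  | _ => None
  end.

Inductive srun (W : nat) : list instr -> (nat -> nat) -> (nat -> nat) -> Prop :=
| srun_nil m : bnd W m -> srun W [] m m
| srun_cons i l m m1 m2 :
    bnd W m -> istep i m = Some m1 -> srun W l m1 m2 -> srun W (i :: l) m m2.

Lemma srun_app W l1 l2 m1 m2 m3 :
  srun W l1 m1 m2 -> srun W l2 m2 m3 -> srun W (l1 ++ l2) m1 m3.
Proof.
  intros H; induction H; intros; simpl; auto.
  econstructor; eauto.
Qed.

Lemma srun_bnd W l m m' : srun W l m m' -> bnd W m'.
Proof. intros H; induction H; auto. Qed.

Lemma srun_steps P W l m m' :
  srun W l m m' -> forall p, code_at P p l ->
  steps P W (length l) (Config p m) (Config (p + length l) m').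
Proof.
  intros H; induction H as [m Hb|i l m m1 m2 Hb Hi H IH]; intros p Hc; simpl.
  - rewrite Nat.add_0_r. constructor; auto.
  - apply steps_S with (Config (S p) m1); auto.
    + unfold step; cbn [pc mem]. rewrite (code_at_nth _ _ _ _ Hc).
      destruct i; simpl in Hi; inversion Hi; reflexivity.
    + rewrite Nat.add_succ_r, <- Nat.add_succ_l.
      apply IH. eapply code_at_tl; eauto.
Qed.

Lemma upd_eq m r x : upd m r x r = x.
Proof. unfold upd. now rewrite Nat.eqb_refl. Qed.

Lemma upd_neq m r x y : y <> r -> upd m r x y = m y.
Proof. unfold upd. intros H. now rewrite (proj2 (Nat.eqb_neq y r) H). Qed.

Lemma bnd_upd W m r x : bnd W m -> x <= W -> bnd W (upd m r x).
Proof. intros H Hx y. unfold upd. destruct (y =? r); auto. Qed.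

Definition rel (s : state) (m : nat -> nat) : Prop :=
  (forall r, r < 100 -> m r = vr s r) /\ (forall a, m (128 + a) = hp s a).

Definition sbnd (V : nat) (s : state) : Prop :=
  (forall r, r < 100 -> vr s r <= V) /\ (forall a, hp s a <= V).

Lemma ce_length e d : length (ce e d) = cost_e e.
Proof.
  unfold cost_e. revert d.
  enough (H : forall d d', length (ce e d) = length (ce e d')) by auto.
  induction e; intros; simpl; auto.
  - rewrite !length_app, (IHe1 d d'), (IHe2 (S d) (S d')). simpl. destruct o; auto.
  - rewrite !length_app, (IHe d d'). reflexivity.
Qed.

Lemma pow_le_mono V a b : 2 <= V -> a <= b -> V ^ a <= V ^ b.
Proof. intros. apply Nat.pow_le_mono_r; lia. Qed.

Lemma esz_pos e : 1 <= esz e.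
Proof. induction e; simpl; lia. Qed.

(** Multiplication is the worst operation, so sizes add in the exponent; a sum is covered as well,
    because both bounds are at least [V] and hence their product is at least their sum. *)
Lemma eval_bound V s e :
  128 <= V -> sbnd V s -> wfe e = true -> eval s e <= V ^ esz e.
Proof.
  intros HV [Hs1 Hs2]; induction e as [r|k|o e1 IH1 e2 IH2|e IH]; simpl; intros Hw.
  - apply Nat.ltb_lt in Hw. rewrite Nat.mul_1_r. auto.
  - apply Nat.leb_le in Hw. lia.
  - apply andb_true_iff in Hw as [Hw1 Hw2].
    specialize (IH1 Hw1). specialize (IH2 Hw2). rewrite Nat.pow_add_r.
    assert (H1 : V ^ 1 <= V ^ esz e1)
      by (pose proof (esz_pos e1); apply pow_le_mono; lia).
    assert (H2 : V ^ 1 <= V ^ esz e2)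
      by (pose proof (esz_pos e2); apply pow_le_mono; lia).
    rewrite Nat.pow_1_r in H1, H2.
    set (x := eval s e1) in *. set (y := eval s e2) in *.
    set (A := V ^ esz e1) in *. set (B := V ^ esz e2) in *.
    destruct o; simpl; try nia.
    + transitivity x; [|nia]. destruct y; [simpl; lia|].
      apply Nat.Div0.div_le_upper_bound. nia.
    + transitivity x; [|nia]. destruct y; [simpl; lia|].
      apply Nat.Div0.mod_le.
  - specialize (Hs2 (eval s e)). pose proof (Nat.pow_nonzero V (esz e)). nia.
Qed.

Lemma ce_ok V W s :
  128 <= V -> sbnd V s -> V ^ max_size <= W ->
  forall e d m, rel s m -> bnd W m -> wfe e = true -> 100 <= d ->
  d + depth e <= 128 -> esz e < max_size ->
  exists m', srun W (ce e d) m m' /\ m' d = eval s e /\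
    forall x, x < d \/ 128 <= x -> m' x = m x.
Proof.
  intros HV Hs HW e.
  assert (He : forall e, esz e < max_size -> wfe e = true -> V * eval s e <= W).
  { intros e' H1 H2. pose proof (eval_bound V s e' HV Hs H2).
    transitivity (V ^ S (esz e')); [simpl; nia|].
    etransitivity; [|exact HW]. apply pow_le_mono; lia. }
  assert (HVW : V <= W).
  { etransitivity; [|exact HW]. rewrite <- (Nat.pow_1_r V) at 1.
    apply pow_le_mono; unfold max_size; lia. }
  induction e as [r|k|o e1 IH1 e2 IH2|e IH];
    intros d m Hr Hb Hw Hd Hdd Hz; pose proof (He _ Hz Hw) as Hev;
    cbn [wfe depth esz eval ce] in *.
  - apply Nat.ltb_lt in Hw. eexists; split; [|split].
    + econstructor; [auto|reflexivity|].
      econstructor; [apply bnd_upd; auto; lia|reflexivity|].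
      constructor. apply bnd_upd; [apply bnd_upd; auto; lia|].
      rewrite upd_neq, upd_eq by lia. rewrite (proj1 Hr) by auto. nia.
    + rewrite upd_eq. rewrite upd_neq, upd_eq by lia. rewrite (proj1 Hr) by auto. lia.
    + intros x Hx. rewrite !upd_neq by lia. reflexivity.
  - apply Nat.leb_le in Hw. eexists; split; [|split].
    + econstructor; [auto|reflexivity|].
      constructor. apply bnd_upd; auto. nia.
    + apply upd_eq.
    + intros x Hx. rewrite !upd_neq by lia. reflexivity.
  - apply andb_true_iff in Hw as [Hw1 Hw2].
    destruct (IH1 d m) as (m1 & R1 & E1 & F1); auto; try lia.
    destruct (IH2 (S d) m1) as (m2 & R2 & E2 & F2); auto; try lia.
    { destruct Hr as [Hr1 Hr2]; split; intros; rewrite F1; auto; lia. }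
    { eapply srun_bnd; eauto. }
    set (val := opf o (eval s e1) (eval s e2)) in *.
    assert (E : istep (opi o d d (S d)) m2 = Some (upd m2 d val)).
    { unfold val. rewrite <- E2, <- E1, <- (F2 d) by lia. destruct o; reflexivity. }
    exists (upd m2 d val); split; [|split].
    + eapply srun_app; [eauto|]. eapply srun_app; [eauto|].
      econstructor; [eapply srun_bnd; eauto|exact E|].
      constructor. apply bnd_upd; [eapply srun_bnd; eauto|]. nia.
    + apply upd_eq.
    + intros x Hx. rewrite upd_neq, F2, F1 by lia. reflexivity.
  - destruct (IH d m) as (m1 & R1 & E1 & F1); auto; try lia.
    assert (Ha : V * eval s e <= W) by (apply He; auto; lia).
    assert (Hb1 : bnd W m1) by (eapply srun_bnd; eauto).
    assert (Hsum : m1 d + 128 <= W).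
    { rewrite E1. pose proof (eval_bound V s e HV Hs Hw).
      transitivity (V ^ S (esz e)); [|etransitivity; [|exact HW]; apply pow_le_mono; lia].
      pose proof (pow_le_mono V 1 (esz e) ltac:(lia) (esz_pos e)) as Hp.
      rewrite Nat.pow_1_r in Hp. rewrite Nat.pow_succ_r'. nia. }
    assert (Hval : m1 (m1 d + 128) = hp s (eval s e)).
    { rewrite F1 by lia. rewrite E1, Nat.add_comm. apply (proj2 Hr). }
    eexists; split; [|split].
    + eapply srun_app; [eauto|].
      econstructor; [auto|reflexivity|].
      econstructor; [apply bnd_upd; auto; lia|reflexivity|].
      rewrite upd_eq, (upd_neq _ _ _ d) by lia.
      econstructor; [apply bnd_upd; auto; apply bnd_upd; auto; lia|reflexivity|].
      constructor. apply bnd_upd; [apply bnd_upd; auto; apply bnd_upd; auto; lia|].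
      rewrite upd_eq. apply bnd_upd; auto; apply bnd_upd; auto; lia.
    + rewrite !upd_eq. rewrite !upd_neq by lia. exact Hval.
    + intros x Hx. rewrite !upd_neq by lia. auto.
Qed.

Lemma comp_length c p : length (comp c p) = clen c.
Proof.
  revert p; induction c; intros; simpl;
    rewrite ?length_app; simpl; rewrite ?length_app; simpl; rewrite ?ce_length, ?IHc, ?IHc1, ?IHc2; try lia.
Qed.

Lemma rel_upd_tmp s m r x : rel s m -> 100 <= r < 128 -> rel s (upd m r x).
Proof.
  intros [H1 H2] Hr; split; intros; rewrite upd_neq by lia; auto.
Qed.

Lemma rel_setv s m r x : rel s m -> r < 100 -> rel (setv s r x) (upd m r x).
Proof.
  intros [H1 H2] Hr; split; intros; cbn [vr hp setv].
  - unfold upd. destruct (r0 =? r); auto.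
  - rewrite upd_neq by lia. auto.
Qed.

Lemma rel_seth s m a x : rel s m -> rel (seth s a x) (upd m (128 + a) x).
Proof.
  intros [H1 H2]; split; intros; cbn [vr hp seth].
  - rewrite upd_neq by lia. auto.
  - unfold hupd, upd. destruct (Nat.eqb_spec a0 a) as [->|Hn].
    + now rewrite Nat.eqb_refl.
    + rewrite (proj2 (Nat.eqb_neq (128 + a0) (128 + a))) by lia. auto.
Qed.

Lemma sbnd_setv V s r x : sbnd V s -> x <= V -> sbnd V (setv s r x).
Proof.
  intros [H1 H2] Hx; split; intros; simpl; auto.
  unfold upd. destruct (r0 =? r); auto.
Qed.

Lemma sbnd_seth V s a x : sbnd V s -> x <= V -> sbnd V (seth s a x).
Proof.
  intros [H1 H2] Hx; split; intros; simpl; auto.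
  unfold hupd, upd. destruct (a0 =? a); auto.
Qed.

Lemma step_jz P p r l m k :
  code_at P p (IJz r l :: k) ->
  step P (Config p m) = Some (Config (if m r =? 0 then l else S p) m).
Proof. intros H. unfold step; simpl. now rewrite (code_at_nth _ _ _ _ H). Qed.

Lemma step_jmp P p l m k :
  code_at P p (IJmp l :: k) -> step P (Config p m) = Some (Config l m).
Proof. intros H. unfold step; simpl. now rewrite (code_at_nth _ _ _ _ H). Qed.

Lemma rel_frame s m m' d :
  100 <= d -> rel s m -> (forall x, x < d \/ 128 <= x -> m' x = m x) -> rel s m'.
Proof. intros Hd [H1 H2] H; split; intros; rewrite H by lia; auto. Qed.

Lemma test_ok V W s e m P p j :
  128 <= V -> sbnd V s -> V ^ max_size <= W -> rel s m -> bnd W m ->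
  oke e = true -> code_at P p (ce e 100 ++ j) ->
  exists m', steps P W (cost_e e) (Config p m) (Config (p + cost_e e) m') /\
    m' 100 = eval s e /\ rel s m' /\ bnd W m' /\ code_at P (p + cost_e e) j.
Proof.
  intros HV Hs HW Hr Hb Hok Hc.
  unfold oke in Hok. apply andb_true_iff in Hok as [Hok Hz].
  apply andb_true_iff in Hok as [Hw Hd].
  apply Nat.leb_le in Hd. apply Nat.ltb_lt in Hz. unfold max_depth in Hd.
  destruct (ce_ok V W s HV Hs HW e 100 m) as (m' & R & E & F); auto; try lia.
  exists m'. pose proof (srun_steps P W _ _ _ R p (code_at_l _ _ _ _ Hc)) as Hst.
  apply code_at_r in Hc. rewrite ce_length in Hst, Hc.
  repeat split; auto; try (eapply srun_bnd; eauto).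
  all: apply (rel_frame s m m' 100); auto.
Qed.

(** A forward simulation by induction on the execution. It also returns [sbnd V s'], because the
    bound on the values inside the next expression starts from it. *)
Theorem comp_correct V W P :
  128 <= V -> V ^ max_size <= W ->
  forall c s s' k, exec V c s s' k ->
  forall p m, okc c = true -> code_at P p (comp c p) -> sbnd V s -> rel s m ->
  bnd W m ->
  exists m', steps P W k (Config p m) (Config (p + clen c) m') /\
    rel s' m' /\ bnd W m' /\ sbnd V s'.
Proof.
  intros HV HW.
  assert (HVW : V <= W).
  { etransitivity; [|exact HW]. rewrite <- (Nat.pow_1_r V) at 1.
    apply pow_le_mono; unfold max_size; lia. }
  induction 1; intros p m Hok Hc Hs Hr Hb; simpl in Hok, Hc |- *.
  - apply andb_true_iff in Hok as [Hr1 Hok]. apply Nat.ltb_lt in Hr1.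
    destruct (test_ok V W s e m P p _ HV Hs HW Hr Hb Hok Hc)
      as (m1 & S1 & E1 & R1 & B1 & C1).
    exists (upd (upd m1 101 0) r (eval s e)).
    assert (srun W [IConst 101 0; IAdd r 100 101] m1
              (upd (upd m1 101 0) r (eval s e))) as Hsr.
    { econstructor; [auto|reflexivity|].
      econstructor; [apply bnd_upd; auto; lia| |].
      - simpl. rewrite upd_eq, upd_neq, E1, Nat.add_0_r by lia. reflexivity.
      - constructor. apply bnd_upd; [apply bnd_upd; auto; lia|lia]. }
    repeat split.
    + rewrite Nat.add_assoc. eapply steps_trans; [exact S1|].
      exact (srun_steps _ _ _ _ _ Hsr _ C1).
    + apply rel_setv; auto. apply rel_upd_tmp; auto; lia.
    + apply (rel_setv s (upd m1 101 0) r (eval s e)); auto. apply rel_upd_tmp; auto; lia.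
    + exact (srun_bnd _ _ _ _ Hsr).
    + apply sbnd_setv; auto.
    + apply sbnd_setv; auto.
  - apply andb_true_iff in Hok as [Hok1 Hok2].
    destruct (test_ok V W s e1 m P p _ HV Hs HW Hr Hb Hok1 Hc)
      as (m1 & S1 & E1 & R1 & B1 & C1).
    unfold oke in Hok1, Hok2. apply andb_true_iff in Hok2 as [Hok2 Hz].
    apply andb_true_iff in Hok2 as [Hw Hd].
    apply Nat.leb_le in Hd. apply Nat.ltb_lt in Hz. unfold max_depth in Hd.
    destruct (ce_ok V W s HV Hs HW e2 101 m1) as (m2 & Q2 & E2 & F2); auto; try lia.
    assert (R2 : rel s m2) by (apply (rel_frame s m1 m2 101); auto; lia).
    pose proof (srun_bnd _ _ _ _ Q2) as B2.
    apply andb_true_iff in Hok1 as [Hok1 Hz1]. apply andb_true_iff in Hok1 as [Hw1 _].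
    apply Nat.ltb_lt in Hz1.
    assert (Hsum : eval s e1 + 128 <= W).
    { pose proof (eval_bound V s e1 HV Hs Hw1).
      transitivity (V ^ S (esz e1)); [|etransitivity; [|exact HW]; apply pow_le_mono; lia].
      pose proof (pow_le_mono V 1 (esz e1) ltac:(lia) (esz_pos e1)) as Hp.
      rewrite Nat.pow_1_r in Hp. rewrite Nat.pow_succ_r'. nia. }
    set (m4 := upd (upd m2 102 128) 100 (eval s e1 + 128)).
    set (m5 := upd m4 (128 + eval s e1) (eval s e2)).
    assert (B4 : bnd W m4) by (apply bnd_upd; [apply bnd_upd; auto; lia|lia]).
    assert (Hsr : srun W [IConst 102 128; IAdd 100 100 102; IStore 100 101] m2 m5).
    { econstructor; [auto|reflexivity|].
      econstructor; [apply bnd_upd; auto; lia| |].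
      - simpl. rewrite upd_eq, upd_neq, F2, E1 by lia. reflexivity.
      - apply srun_cons with m5; [exact B4| |].
        + change (Some (upd m4 (m4 100) (m4 101)) = Some m5).
          replace (m4 101) with (eval s e2)
            by (unfold m4; rewrite !upd_neq by lia; now rewrite E2).
          replace (m4 100) with (128 + eval s e1)
            by (unfold m4; rewrite upd_eq; lia).
          reflexivity.
        + constructor. apply bnd_upd; auto. lia. }
    exists m5. repeat split.
    + replace (p + (cost_e e1 + cost_e e2 + 3)) with (p + cost_e e1 + cost_e e2 + 3) by lia.
      eapply steps_trans; [eapply steps_trans; [exact S1|]|].
      * pose proof (srun_steps P _ _ _ _ Q2 _ (code_at_l _ _ _ _ C1)) as Hst.
        rewrite ce_length in Hst. exact Hst.
      * apply code_at_r in C1. rewrite ce_length in C1.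
        exact (srun_steps _ _ _ _ _ Hsr _ C1).
    + apply rel_seth. do 2 (apply rel_upd_tmp; [|lia]). auto.
    + apply rel_seth. do 2 (apply rel_upd_tmp; [|lia]). auto.
    + exact (srun_bnd _ _ _ _ Hsr).
    + apply sbnd_seth; auto.
    + apply sbnd_seth; auto.
  - apply andb_true_iff in Hok as [Hok1 Hok2].
    destruct (IHexec1 p m) as (m1 & S1 & R1 & B1 & V1); auto.
    { eapply code_at_l; eauto. }
    destruct (IHexec2 (p + clen c1) m1) as (m2 & S2 & R2 & B2 & V2); auto.
    { apply code_at_r in Hc. now rewrite comp_length in Hc. }
    exists m2; repeat split; auto; try apply R2; try apply V2.
    rewrite Nat.add_assoc. eapply steps_trans; eauto.
  - apply andb_true_iff in Hok as [Hok1 Hok2].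
    destruct (test_ok V W s e m P p _ HV Hs HW Hr Hb Hok1 Hc)
      as (m1 & S1 & E1 & R1 & B1 & C1).
    exists m1; repeat split; auto; try apply R1; try apply Hs.
    eapply steps_trans; [exact S1|].
    eapply steps_S; [auto|eapply step_jz; eauto|].
    rewrite E1, H. simpl. replace (p + (cost_e e + clen c + 2)) with (p + cost_e e + clen c + 2) by lia.
    constructor; auto.
  - pose proof Hc as Hc0. pose proof Hok as Hok0.
    apply andb_true_iff in Hok as [Hok1 Hok2].
    destruct (test_ok V W s e m P p _ HV Hs HW Hr Hb Hok1 Hc)
      as (m1 & S1 & E1 & R1 & B1 & C1).
    pose proof (code_at_tl _ _ _ _ C1) as C2.
    rewrite <- Nat.add_1_r in C2.
    destruct (IHexec1 (p + cost_e e + 1) m1) as (m2 & S2 & R2 & B2 & V2); auto.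
    { eapply code_at_l; eauto. }
    apply code_at_r in C2. rewrite comp_length in C2.
    destruct (IHexec2 p m2) as (m3 & S3 & R3 & B3 & V3); auto.
    exists m3; repeat split; auto; try apply R3; try apply V3.
    rewrite <- (Nat.add_assoc (cost_e e) 1).
    eapply steps_trans; [exact S1|].
    eapply steps_S; [auto|eapply step_jz; eauto|].
    rewrite E1, (proj2 (Nat.eqb_neq _ _) H), <- (Nat.add_1_r (p + cost_e e)).
    eapply steps_trans; [exact S2|].
    eapply steps_S; [auto|eapply step_jmp; eauto|]. exact S3.
  - apply andb_true_iff in Hok as [Hok Hok2]. apply andb_true_iff in Hok as [Hok0 Hok1].
    destruct (test_ok V W s e m P p _ HV Hs HW Hr Hb Hok0 Hc)
      as (m1 & S1 & E1 & R1 & B1 & C1).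
    pose proof (code_at_tl _ _ _ _ C1) as C2.
    rewrite <- Nat.add_1_r in C2.
    destruct (IHexec (p + cost_e e + 1) m1) as (m2 & S2 & R2 & B2 & V2); auto.
    { eapply code_at_l; eauto. }
    apply code_at_r in C2. rewrite comp_length in C2.
    exists m2; repeat split; auto; try apply R2; try apply V2.
    rewrite <- (Nat.add_assoc (cost_e e) 1).
    eapply steps_trans; [exact S1|].
    eapply steps_S; [auto|eapply step_jz; eauto|].
    rewrite E1, (proj2 (Nat.eqb_neq _ _) H), <- (Nat.add_1_r (p + cost_e e)).
    eapply steps_trans; [exact S2|].
    eapply steps_S; [auto|eapply step_jmp; eauto|].
    replace (p + cost_e e + clen c1 + clen c2 + 2)
      with (p + (cost_e e + clen c1 + clen c2 + 2)) by lia.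
    constructor; auto.
  - apply andb_true_iff in Hok as [Hok Hok2]. apply andb_true_iff in Hok as [Hok0 Hok1].
    destruct (test_ok V W s e m P p _ HV Hs HW Hr Hb Hok0 Hc)
      as (m1 & S1 & E1 & R1 & B1 & C1).
    pose proof (code_at_tl _ _ _ _ C1) as C2.
    rewrite <- Nat.add_1_r in C2.
    apply code_at_r in C2. rewrite comp_length in C2.
    apply code_at_tl in C2.
    replace (S (p + cost_e e + 1 + clen c1)) with (p + cost_e e + clen c1 + 2) in C2 by lia.
    destruct (IHexec (p + cost_e e + clen c1 + 2) m1) as (m2 & S2 & R2 & B2 & V2); auto.
    exists m2; repeat split; auto; try apply R2; try apply V2.
    rewrite <- (Nat.add_assoc (cost_e e) 1).
    eapply steps_trans; [exact S1|].
    eapply steps_S; [auto|eapply step_jz; eauto|].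
    rewrite E1, H. simpl.
    replace (p + (cost_e e + clen c1 + clen c2 + 2))
      with (p + cost_e e + clen c1 + 2 + clen c2) by lia.
    exact S2.
Qed.

(** * Weakest preconditions with running times *)

(** Total correctness: a terminating run is exhibited together with its step count, so one proof
    gives termination, the result and the time bound. *)
Definition wp (V : nat) (c : cmd) (s : state) (Q : state -> nat -> Prop) : Prop :=
  exists s' k, exec V c s s' k /\ Q s' k.

Fixpoint wr (c : cmd) (r : nat) : bool :=
  match c with
  | Asg r' _ => r =? r'
  | Sto _ _ => false
  | Seq c1 c2 | If _ c1 c2 => wr c1 r || wr c2 r
  | While _ c => wr c r
  end.

Lemma exec_frame V c s s' k :
  exec V c s s' k -> forall r, wr c r = false -> vr s' r = vr s r.
Proof.
  intros H; induction H; intros r' Hr; cbn [wr] in *; auto.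
  - cbn. unfold upd. now rewrite Hr.
  - apply orb_false_iff in Hr as []. rewrite IHexec2, IHexec1; auto.
  - rewrite IHexec2, IHexec1; auto.
  - apply orb_false_iff in Hr as []. auto.
  - apply orb_false_iff in Hr as []. auto.
Qed.

Lemma wp_asg V r e s (Q : state -> nat -> Prop) :
  eval s e <= V -> Q (setv s r (eval s e)) (cost_e e + 2) -> wp V (Asg r e) s Q.
Proof. intros. eexists _, _; split; [constructor|]; eauto. Qed.

Lemma wp_sto V e1 e2 s (Q : state -> nat -> Prop) :
  eval s e2 <= V ->
  Q (seth s (eval s e1) (eval s e2)) (cost_e e1 + cost_e e2 + 3) ->
  wp V (Sto e1 e2) s Q.
Proof. intros. eexists _, _; split; [constructor|]; eauto. Qed.

Lemma wp_seq V c1 c2 s Q :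
  wp V c1 s (fun s1 k1 => wp V c2 s1 (fun s2 k2 => Q s2 (k1 + k2))) ->
  wp V (Seq c1 c2) s Q.
Proof.
  intros (s1 & k1 & E1 & s2 & k2 & E2 & H).
  eexists _, _; split; [econstructor; eauto|]; eauto.
Qed.

Lemma wp_if V e c1 c2 s (Q : state -> nat -> Prop) :
  (eval s e <> 0 -> wp V c1 s (fun s1 k => Q s1 (cost_e e + 1 + (k + 1)))) ->
  (eval s e = 0 -> wp V c2 s (fun s1 k => Q s1 (cost_e e + 1 + k))) ->
  wp V (If e c1 c2) s Q.
Proof.
  intros H1 H2. destruct (Nat.eq_dec (eval s e) 0) as [E|E].
  - destruct (H2 E) as (s1 & k & X & HQ).
    eexists _, _; split; [eapply exec_if0; eauto|eauto].
  - destruct (H1 E) as (s1 & k & X & HQ).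
    eexists _, _; split; [eapply exec_if1; eauto|eauto].
Qed.

Lemma wp_conseq V c s (Q Q' : state -> nat -> Prop) :
  wp V c s Q' ->
  (forall s' k, (forall r, wr c r = false -> vr s' r = vr s r) -> Q' s' k -> Q s' k) ->
  wp V c s Q.
Proof.
  intros (s' & k & E & H) HQ. exists s', k. split; auto.
  apply HQ; auto. eapply exec_frame; eauto.
Qed.

Fixpoint nsum (n : nat) (t : nat -> nat) : nat :=
  match n with 0 => 0 | S n => nsum n t + t n end.

Lemma nsum_const n b : nsum n (fun _ => b) = n * b.
Proof. induction n; simpl; lia. Qed.

Lemma nsum_S n t : nsum (S n) t = t 0 + nsum n (fun i => t (S i)).
Proof. induction n; simpl in *; lia. Qed.

Lemma wp_loop V e c s (I : nat -> state -> Prop) (t : nat -> nat) n Q :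
  I 0 s ->
  (forall i s1, i < n -> I i s1 ->
     (forall r, wr c r = false -> vr s1 r = vr s r) ->
     eval s1 e <> 0 /\ wp V c s1 (fun s2 k => I (S i) s2 /\ k <= t i)) ->
  (forall s1, I n s1 -> (forall r, wr c r = false -> vr s1 r = vr s r) -> eval s1 e = 0) ->
  (forall s1 k, I n s1 -> (forall r, wr c r = false -> vr s1 r = vr s r) ->
     k <= nsum n t + n * (cost_e e + 2) + cost_e e + 1 -> Q s1 k) ->
  wp V (While e c) s Q.
Proof.
  intros H0 Hb He HQ.
  enough (H : forall j i s1, i + j = n -> I i s1 ->
    (forall r, wr c r = false -> vr s1 r = vr s r) ->
    exists s2 k, exec V (While e c) s1 s2 k /\ I n s2 /\
      (forall r, wr c r = false -> vr s2 r = vr s r) /\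
      k <= nsum j (fun x => t (i + x)) + j * (cost_e e + 2) + cost_e e + 1).
  { destruct (H n 0 s) as (s2 & k & X & I2 & F2 & K); auto.
    exists s2, k; split; auto. }
  induction j as [|j IH]; intros i s1 Hij HI Hf.
  - replace i with n in HI by lia.
    exists s1, (cost_e e + 1). split; [apply exec_while0; auto|].
    split; [exact HI|]. split; [exact Hf|]. simpl; lia.
  - destruct (Hb i s1) as (Hne & s2 & k2 & X2 & I2 & K2); auto; try lia.
    pose proof (exec_frame _ _ _ _ _ X2) as F2.
    destruct (IH (S i) s2) as (s3 & k3 & X3 & I3 & F3 & K3); auto; try lia.
    { intros r Hr. rewrite F2, Hf; auto. }
    exists s3, (cost_e e + 1 + (k2 + (1 + k3))).
    split; [eapply exec_while; eauto|]. split; [exact I3|]. split; [exact F3|].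
    rewrite nsum_S, Nat.add_0_r.
    rewrite (Nat.mul_succ_l j).
    enough (nsum j (fun x => t (i + S x)) = nsum j (fun x => t (S i + x))) by lia.
    clear. induction j; simpl; [|rewrite IHj, Nat.add_succ_r]; reflexivity.
Qed.

Definition For (ri : nat) (e : expr) (body : cmd) : cmd :=
  Seq (Asg ri (Num 0))
      (While (Bin OSub e (Var ri))
             (Seq body (Asg ri (Bin OAdd (Var ri) (Num 1))))).

Lemma cost_bin o e1 e2 : cost_e (Bin o e1 e2) = cost_e e1 + cost_e e2 + 1.
Proof. unfold cost_e at 1. simpl. rewrite !length_app, !ce_length. simpl. lia. Qed.

Definition fr (body : cmd) (ri : nat) (s s1 : state) : Prop :=
  forall r, wr body r = false -> (r =? ri) = false -> vr s1 r = vr s r.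

Lemma wp_for V ri e body n (I : nat -> (nat -> nat) -> Prop) t s
    (Q : state -> nat -> Prop) :
  wr body ri = false -> n <= V ->
  (forall s1 i, i <= n -> fr body ri s s1 -> vr s1 ri = i -> I i (hp s1) -> eval s1 e = n) ->
  I 0 (hp s) ->
  (forall i s1, i < n -> vr s1 ri = i -> fr body ri s s1 -> I i (hp s1) ->
     wp V body s1 (fun s2 k => I (S i) (hp s2) /\ k <= t i)) ->
  (forall s1 k, I n (hp s1) -> fr body ri s s1 -> vr s1 ri = n ->
     k <= nsum n t + n * (cost_e e + 12) + cost_e e + 12 -> Q s1 k) ->
  wp V (For ri e body) s Q.
Proof.
  intros Hri HnV He H0 Hb HQ.
  apply wp_seq, wp_asg; [simpl; lia|].
  set (s0 := setv s ri (eval s (Num 0))).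
  assert (F0 : fr body ri s s0).
  { intros r _ Hr. unfold s0; cbn. unfold upd. now rewrite Hr. }
  assert (Fr : forall s1, (forall r, wr (Seq body (Asg ri (Bin OAdd (Var ri) (Num 1)))) r = false
     -> vr s1 r = vr s0 r) -> fr body ri s s1).
  { intros s1 H r H1 H2. rewrite H; [apply F0; auto|]. cbn. now rewrite H1, H2. }
  apply wp_loop with (I := fun i s1 => vr s1 ri = i /\ I i (hp s1)) (t := fun i => t i + 6) (n := n).
  - split; [apply upd_eq|exact H0].
  - intros i s1 Hi [Hv HI] Hf. pose proof (Fr s1 Hf) as Hf'. split.
    + cbn. rewrite (He s1 i) by (auto; lia). lia.
    + apply wp_seq. eapply wp_conseq; [apply (Hb i); auto|].
      intros s2 k F2 [I2 K2]. cbv beta.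
      assert (E : vr s2 ri = i) by (rewrite F2; auto).
      apply wp_asg; cbn; rewrite E; [lia|].
      split; [split|].
      * rewrite upd_eq. lia.
      * auto.
      * lia.
  - intros s1 [Hv HI] Hf. cbn. rewrite (He s1 n) by auto. lia.
  - intros s1 k [Hv HI] Hf Hk. apply HQ; auto.
    rewrite cost_bin in *. unfold cost_e at 2 4 in Hk. cbn [length ce] in Hk.
    assert (E : nsum n (fun i => t i + 6) = nsum n t + 6 * n).
    { clear. induction n; simpl; lia. }
    rewrite E in Hk. change (cost_e (Num 0)) with 1. nia.
Qed.

(** For loops whose pass [i] writes only its own [k] cells: the body is judged locally, and the
    preservation of the cells written earlier is settled here once. *)
Lemma wp_fill V ri e body n k base (val : nat -> nat) tb s (Q : state -> nat -> Prop) :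
  wr body ri = false -> n <= V ->
  (forall s1, fr body ri s s1 -> eval s1 e = n) ->
  (forall i s1, i < n -> vr s1 ri = i -> fr body ri s s1 ->
     (forall j, j < k * i -> hp s1 (base + j) = val j) ->
     (forall a, a < base \/ base + k * i <= a -> hp s1 a = hp s a) ->
     wp V body s1 (fun s2 t => t <= tb /\
       (forall j, k * i <= j < k * i + k -> hp s2 (base + j) = val j) /\
       (forall a, a < base + k * i \/ base + k * i + k <= a -> hp s2 a = hp s1 a))) ->
  (forall s1 t, fr body ri s s1 ->
     (forall j, j < k * n -> hp s1 (base + j) = val j) ->
     (forall a, a < base \/ base + k * n <= a -> hp s1 a = hp s a) ->
     t <= n * (tb + cost_e e + 12) + cost_e e + 12 -> Q s1 t) ->
  wp V (For ri e body) s Q.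
Proof.
  intros Hri HnV He Hb HQ.
  apply wp_for with (n := n) (t := fun _ => tb)
    (I := fun i h => (forall j, j < k * i -> h (base + j) = val j) /\
       (forall a, a < base \/ base + k * i <= a -> h a = hp s a)); auto.
  - split; intros; [lia|auto].
  - intros i s1 Hi Hv Hf [I1 I2].
    eapply wp_conseq; [apply (Hb i); auto|].
    intros s2 t _ (Ht & J1 & J2). split; [split|auto].
    + intros j Hj. destruct (Nat.lt_ge_cases j (k * i)).
      * rewrite J2 by lia. auto.
      * apply J1. lia.
    + intros a Ha. rewrite J2, I2 by lia. auto.
  - intros s1 t [I1 I2] Hf _ Ht. apply HQ; auto.
    rewrite nsum_const in Ht. nia.
Qed.

(** * The fixed-point Fourier transform *)

Section Fourier.
Import Reals Lra Psatz Coquelicot.Coquelicot.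

(* Fixed-point complex numbers: [(x, y)] stands for [(x + i y) / Q]. *)
Definition cmulz (Q : Z) (x y : Z * Z) : Z * Z :=
  (((fst x * fst y - snd x * snd y) / Q)%Z, ((fst x * snd y + snd x * fst y) / Q)%Z).

Definition caddz (x y : Z * Z) : Z * Z := ((fst x + fst y)%Z, (snd x + snd y)%Z).

(* Half-angle formulas: [halfz Q l] approximates the primitive root of unity of
   order [2 ^ (l + 2)]. *)
Fixpoint halfz (Q : Z) (l : nat) : Z * Z :=
  match l with
  | 0 => (0, Q)%Z
  | S l =>
      let c := Z.sqrt ((Q + fst (halfz Q l)) * (Q / 2)) in
      (c, (snd (halfz Q l) * (Q / 2) / c)%Z)
  end.

Definition rootz (Q : Z) (l : nat) : Z * Z :=
  match l with
  | 0 => (Q, 0)%Z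
  | 1 => (- Q, 0)%Z
  | S (S l) => halfz Q l
  end.

Fixpoint twz (Q : Z) (l k : nat) : Z * Z :=
  match l with
  | 0 => (Q, 0)%Z
  | S l' => if Nat.even k then twz Q l' (k / 2)
            else cmulz Q (twz Q l' (k / 2)) (rootz Q l)
  end.

(* Stockham's self-sorting order: entry [i] after [l + 1] levels is a butterfly of the
   entries [fidx l i] and [fidx l i + 2 ^ (m - 1)] after [l] levels. *)
Definition fidx (l i : nat) : nat := i / 2 ^ S l * 2 ^ l + i mod 2 ^ l.

Fixpoint fftz (Q : Z) (m : nat) (X : nat -> Z * Z) (l : nat) : nat -> Z * Z :=
  match l with
  | 0 => X
  | S l => fun i =>
      caddz (fftz Q m X l (fidx l i))
        (cmulz Q (twz Q m (i mod 2 ^ S l * 2 ^ (m - S l)))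
                 (fftz Q m X l (fidx l i + 2 ^ (m - 1))))
  end.

Definition dftz (Q : Z) (m : nat) (X : nat -> Z * Z) : nat -> Z * Z := fftz Q m X m.

Definition inz (Q : Z) (f : nat -> nat) (i : nat) : Z * Z := (Q * Z.of_nat (f i), 0)%Z.

Definition prodz (Q : Z) (m : nat) (f g h : nat -> nat) (i : nat) : Z * Z :=
  cmulz Q (cmulz Q (dftz Q m (inz Q f) i) (dftz Q m (inz Q g) i)) (dftz Q m (inz Q h) i).

(* The inverse transform is the forward one read at [- u]; it is not normalised, so the
   result is [Q * 2 ^ m] times the triple convolution, up to rounding. *)
Definition convz (Q : Z) (m : nat) (f g h : nat -> nat) (u : nat) : Z :=
  fst (dftz Q m (prodz Q m f g h) ((2 ^ m - u) mod 2 ^ m)).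

(** * Exact roots of unity *)

Open Scope R_scope.

(** Cosine and sine of pi / 2^(l+1), from cos(x/2) = sqrt((1 + cos x)/2) and sin(x/2) = sin x / (2
    cos(x/2)). The recursion runs parallel to [halfz], so the two can be compared step by step. *)
Fixpoint halfr (l : nat) : R * R :=
  match l with
  | 0%nat => (0, 1)
  | S l => let c := sqrt ((1 + fst (halfr l)) / 2) in (c, snd (halfr l) / (2 * c))
  end.

(** This is exp(2 pi i / 2^l); the first two cases are separate because the half-angle recursion
    starts at the root i of order 4. *)
Definition om (l : nat) : C :=
  match l with
  | 0%nat => RtoC 1
  | 1%nat => RtoC (-1)
  | S (S l) => halfr l
  end.

Lemma halfr_spec l :
  0 <= fst (halfr l) /\ 0 <= snd (halfr l) /\
  fst (halfr l) * fst (halfr l) + snd (halfr l) * snd (halfr l) = 1.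
Proof.
  induction l as [|l (Hc & Hs & H)]; simpl.
  - lra.
  - set (c := fst (halfr l)) in *. set (s := snd (halfr l)) in *.
    assert (H1 : sqrt ((1 + c) / 2) * sqrt ((1 + c) / 2) = (1 + c) / 2)
      by (apply sqrt_sqrt; lra).
    assert (H2 : 0 < sqrt ((1 + c) / 2)) by (apply sqrt_lt_R0; lra).
    set (c' := sqrt ((1 + c) / 2)) in *. repeat split.
    + lra.
    + apply Rmult_le_pos; auto. apply Rlt_le, Rinv_0_lt_compat. lra.
    + replace (s / (2 * c') * (s / (2 * c'))) with (s * s / (4 * (c' * c'))) by (field; lra).
      rewrite H1. replace (s * s) with ((1 - c) * (1 + c)) by (ring_simplify; nra).
      field. lra.
Qed.

Lemma om_sqr l : (om (S l) * om (S l) = om l)%C.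
Proof.
  destruct l as [|[|l]]; simpl.
  - rewrite <- RtoC_mult. f_equal. ring.
  - unfold Cmult, RtoC; simpl. f_equal; ring.
  - pose proof (halfr_spec l) as (Hc & Hs & H).
    set (c := fst (halfr l)) in *. set (s := snd (halfr l)) in *.
    assert (H1 : sqrt ((1 + c) / 2) * sqrt ((1 + c) / 2) = (1 + c) / 2)
      by (apply sqrt_sqrt; lra).
    assert (H2 : 0 < sqrt ((1 + c) / 2)) by (apply sqrt_lt_R0; lra).
    set (c' := sqrt ((1 + c) / 2)) in *.
    transitivity (c, s); [|symmetry; apply surjective_pairing].
    unfold Cmult; simpl. f_equal.
    + replace (s / (2 * c') * (s / (2 * c'))) with (s * s / (4 * (c' * c'))) by (field; lra).
      rewrite H1. replace (s * s) with ((1 - c) * (1 + c)) by (ring_simplify; nra).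
      field. lra.
    + field. lra.
Qed.

Lemma om_mod l : Cmod (om l) = 1.
Proof.
  destruct l as [|[|l]]; simpl.
  - apply Cmod_1.
  - rewrite Cmod_R. rewrite Rabs_left; lra.
  - pose proof (halfr_spec l) as (_ & _ & H). unfold Cmod.
    replace (fst (halfr l) ^ 2 + snd (halfr l) ^ 2) with 1 by (rewrite <- H; ring).
    apply sqrt_1.
Qed.

Lemma om_pow2 l k : (om (l + k) ^ (2 ^ k) = om l)%C.
Proof.
  induction k as [|k IH].
  - rewrite Nat.add_0_r. simpl. ring.
  - rewrite Nat.pow_succ_r', Cpow_mult_r, Nat.add_succ_r.
    replace (om (S (l + k)) ^ 2)%C with (om (S (l + k)) * om (S (l + k)))%C by (simpl; ring).
    now rewrite om_sqr.
Qed.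

Lemma om_period l : (om l ^ (2 ^ l) = 1)%C.
Proof. rewrite <- (Nat.add_0_l l) at 1. rewrite om_pow2. reflexivity. Qed.

Lemma om_mod_period l k : (om l ^ k = om l ^ (k mod 2 ^ l))%C.
Proof.
  rewrite (Nat.div_mod_eq k (2 ^ l)) at 1.
  rewrite Cpow_add_r, Cpow_mult_r, om_period, Cpow_1_l. ring.
Qed.

Lemma om_even l k : (om (S l) ^ (2 * k) = om l ^ k)%C.
Proof.
  now rewrite Cpow_mult_r, (Cpow_S _ 1), Cpow_1_r, om_sqr.
Qed.

(** An even exponent descends to level [l]; an odd one is excluded because raising to the power 2^l
    gives an odd power of -1. *)
Lemma om_neq1 l t : (0 < t < 2 ^ l)%nat -> (om l ^ t)%C <> RtoC 1.
Proof.
  revert t; induction l as [|l IH]; intros t Ht.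
  - simpl in Ht; lia.
  - destruct (Nat.Even_or_Odd t) as [[k ->]|[k ->]].
    + rewrite om_even. apply IH. simpl in Ht. lia.
    + intros H. clear IH Ht.
      assert (E : ((om (S l) ^ (2 * k + 1)) ^ (2 ^ l) = RtoC (-1))%C).
      { rewrite <- Cpow_mult_r, Nat.mul_comm, Cpow_mult_r.
        replace (om (S l) ^ 2 ^ l)%C with (om 1) by (symmetry; apply (om_pow2 1 l)).
        simpl om. rewrite Nat.add_1_r, Cpow_S, Cpow_mult_r.
        replace (RtoC (-1) ^ 2)%C with (RtoC 1) by (simpl; unfold Cmult, RtoC; simpl; f_equal; ring).
        rewrite Cpow_1_l. ring. }
      rewrite H, Cpow_1_l in E. apply (f_equal fst) in E. simpl in E. lra.
Qed.

(** * Finite complex sums, orthogonality and the exact transform *)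

Fixpoint csum (n : nat) (f : nat -> C) : C :=
  match n with 0%nat => RtoC 0 | S n => (csum n f + f n)%C end.

Lemma csum_ext n f g : (forall i, (i < n)%nat -> f i = g i) -> csum n f = csum n g.
Proof. induction n; simpl; intros H; auto. rewrite IHn, H; auto. Qed.

Lemma csum_scal n c f : csum n (fun i => c * f i)%C = (c * csum n f)%C.
Proof. induction n; simpl; [ring|]. rewrite IHn; ring. Qed.

Lemma csum_plus n f g : csum n (fun i => f i + g i)%C = (csum n f + csum n g)%C.
Proof. induction n; simpl; [ring|]. rewrite IHn; ring. Qed.

Lemma csum_0 n f : (forall i, (i < n)%nat -> f i = RtoC 0) -> csum n f = RtoC 0.
Proof. induction n; simpl; intros H; auto. rewrite IHn, H; auto. ring. Qed.

Lemma csum_swap n m f :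
  csum n (fun i => csum m (fun j => f i j)) = csum m (fun j => csum n (fun i => f i j)).
Proof.
  induction n; simpl; [symmetry; apply csum_0; auto|].
  rewrite IHn, <- csum_plus. reflexivity.
Qed.

Lemma csum_even_odd n f :
  csum (2 * n) f = (csum n (fun i => f (2 * i)%nat) + csum n (fun i => f (2 * i + 1)%nat))%C.
Proof.
  induction n; [simpl; ring|].
  replace (2 * S n)%nat with (S (S (2 * n))) by lia. cbn [csum]. rewrite IHn.
  replace (2 * n + 1)%nat with (S (2 * n)) by lia. ring.
Qed.

Lemma csum_mod n f b : (forall i, (i < n)%nat -> Cmod (f i) <= b) -> Cmod (csum n f) <= INR n * b.
Proof.
  induction n; intros H.
  - simpl. rewrite Cmod_0. lra.
  - rewrite S_INR. cbn [csum]. eapply Rle_trans; [apply Cmod_triangle|].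
    pose proof (IHn (fun i Hi => H i (Nat.lt_lt_succ_r _ _ Hi))). pose proof (H n (Nat.lt_succ_diag_r n)). lra.
Qed.

Lemma geom_sum n (q : C) : q <> RtoC 1 -> (q ^ n = 1)%C -> csum n (fun k => q ^ k)%C = RtoC 0.
Proof.
  intros Hq Hn.
  assert (E : ((q - 1) * csum n (fun k => q ^ k) = q ^ n - 1)%C).
  { clear. induction n; simpl; [ring|]. rewrite Cmult_plus_distr_l, IHn. ring. }
  rewrite Hn in E. replace (1 - 1)%C with (RtoC 0) in E by ring.
  assert (Hq1 : (q - 1)%C <> RtoC 0) by (intros H; apply Hq; transitivity (q - 1 + 1)%C; [ring|rewrite H; ring]).
  replace (csum n (fun k => q ^ k)%C) with (/ (q - 1) * ((q - 1) * csum n (fun k => q ^ k)))%C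
    by (field; exact Hq1).
  rewrite E. ring.
Qed.

Lemma om_orth m t :
  csum (2 ^ m) (fun k => om m ^ (k * t))%C =
  if (t mod 2 ^ m =? 0)%nat then RtoC (INR (2 ^ m)) else RtoC 0.
Proof.
  rewrite (csum_ext _ _ (fun k => (om m ^ (t mod 2 ^ m)) ^ k)%C).
  2:{ intros i _. rewrite Nat.mul_comm, Cpow_mult_r, (om_mod_period m t). reflexivity. }
  destruct (Nat.eqb_spec (t mod 2 ^ m) 0) as [->|Hn].
  - rewrite (csum_ext _ _ (fun _ => RtoC 1)) by (intros; simpl; apply Cpow_1_l).
    clear. induction (2 ^ m)%nat as [|n IH]; auto.
    cbn [csum]. rewrite IH, S_INR, RtoC_plus. reflexivity.
  - apply geom_sum.
    + apply om_neq1. pose proof (Nat.mod_upper_bound t (2 ^ m)).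
      pose proof (Nat.pow_nonzero 2 m). lia.
    + rewrite <- Cpow_mult_r, Nat.mul_comm, Cpow_mult_r, om_period. apply Cpow_1_l.
Qed.

(* [xl m x l] is the content of the array after [l] levels of the transform. *)
Definition xl (m : nat) (x : nat -> C) (l i : nat) : C :=
  csum (2 ^ l) (fun j => x (i / 2 ^ l + j * 2 ^ (m - l))%nat * om l ^ (j * (i mod 2 ^ l)))%C.

Definition dftc (m : nat) (x : nat -> C) (k : nat) : C :=
  csum (2 ^ m) (fun j => x j * om m ^ (j * k))%C.

Lemma fidx_div l i : (fidx l i / 2 ^ l = i / 2 ^ S l)%nat.
Proof.
  unfold fidx. pose proof (Nat.pow_nonzero 2 l ltac:(lia)).
  rewrite Nat.div_add_l by auto. rewrite (Nat.div_small (i mod 2 ^ l)); [lia|].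
  apply Nat.mod_upper_bound; auto.
Qed.

Lemma fidx_mod l i : (fidx l i mod 2 ^ l = i mod 2 ^ l)%nat.
Proof.
  unfold fidx. rewrite Nat.add_comm, Nat.Div0.mod_add. apply Nat.Div0.mod_mod.
Qed.

Lemma fidx_lt m l i :
  (l < m)%nat -> (i < 2 ^ m)%nat -> (fidx l i + 2 ^ (m - 1) < 2 ^ m)%nat.
Proof.
  intros Hl Hi. unfold fidx.
  replace m with ((m - 1 - l) + S l)%nat in Hi at 1 by lia.
  rewrite Nat.pow_add_r in Hi.
  assert (H1 : (i / 2 ^ S l < 2 ^ (m - 1 - l))%nat)
    by (apply Nat.Div0.div_lt_upper_bound; lia).
  pose proof (Nat.mod_upper_bound i (2 ^ l) (Nat.pow_nonzero 2 l ltac:(lia))) as H2.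
  assert (E : (2 ^ m = 2 * 2 ^ (m - 1))%nat)
    by (rewrite <- Nat.pow_succ_r'; f_equal; lia).
  assert (E2 : (2 ^ (m - 1) = 2 ^ (m - 1 - l) * 2 ^ l)%nat)
    by (rewrite <- Nat.pow_add_r; f_equal; lia).
  nia.
Qed.

Lemma pow2_split a b : (a < b)%nat -> (2 ^ (b - a) = 2 * 2 ^ (b - S a))%nat.
Proof. intros. rewrite <- Nat.pow_succ_r'. f_equal. lia. Qed.

(** Decimation in time: the even [j] give the first term, the odd ones the second after the factor
    [om (S l) ^ (i mod 2 ^ S l)] is pulled out. What remains are powers of [om l], whose exponents
    matter only modulo 2^l. *)
Lemma xl_step m x l i :
  (l < m)%nat ->
  xl m x (S l) i =
  (xl m x l (fidx l i) +
   om m ^ (i mod 2 ^ S l * 2 ^ (m - S l)) * xl m x l (fidx l i + 2 ^ (m - 1)))%C.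
Proof.
  intros Hl. unfold xl.
  assert (E : (2 ^ (m - 1) = 2 ^ (m - S l) * 2 ^ l)%nat)
    by (rewrite <- Nat.pow_add_r; f_equal; lia).
  assert (Hp : (2 ^ l <> 0)%nat) by (apply Nat.pow_nonzero; lia).
  rewrite E, Nat.div_add, Nat.Div0.mod_add, fidx_div, fidx_mod by auto.
  rewrite Nat.pow_succ_r' at 1. rewrite csum_even_odd. f_equal.
  - apply csum_ext; intros j _. f_equal.
    + f_equal. rewrite (pow2_split l m Hl). nia.
    + rewrite <- Nat.mul_assoc, om_even.
      rewrite om_mod_period, (om_mod_period l (j * (i mod 2 ^ l))). f_equal.
      rewrite <- (Nat.Div0.mul_mod_idemp_r j (i mod 2 ^ S l)). f_equal. f_equal.
      rewrite Nat.pow_succ_r', Nat.mul_comm, Nat.Div0.mod_mul_r.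
      rewrite (Nat.mul_comm (2 ^ l)), Nat.Div0.mod_add. apply Nat.Div0.mod_mod.
  - rewrite <- csum_scal. apply csum_ext; intros j _.
    set (k := (i mod 2 ^ S l)%nat).
    assert (E1 : (om m ^ (k * 2 ^ (m - S l)) = om (S l) ^ k)%C).
    { rewrite Nat.mul_comm, Cpow_mult_r. f_equal.
      replace m with (S l + (m - S l))%nat at 1 by lia. apply om_pow2. }
    assert (E2 : (om (S l) ^ ((2 * j + 1) * k) = om (S l) ^ k * om l ^ (j * (i mod 2 ^ l)))%C).
    { replace ((2 * j + 1) * k)%nat with (k + 2 * (j * k))%nat by lia.
      rewrite Cpow_add_r, om_even. f_equal.
      rewrite om_mod_period, (om_mod_period l (j * (i mod 2 ^ l))). f_equal.
      rewrite <- (Nat.Div0.mul_mod_idemp_r j k). f_equal. f_equal. unfold k.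
      rewrite Nat.pow_succ_r', Nat.mul_comm, Nat.Div0.mod_mul_r.
      rewrite (Nat.mul_comm (2 ^ l)), Nat.Div0.mod_add. apply Nat.Div0.mod_mod. }
    rewrite E1, E2.
    replace (i / 2 ^ S l + (2 * j + 1) * 2 ^ (m - S l))%nat
      with (i / 2 ^ S l + 2 ^ (m - S l) + j * 2 ^ (m - l))%nat
      by (rewrite (pow2_split l m Hl); nia).
    ring.
Qed.

Lemma xl_0 m x i : (i < 2 ^ m)%nat -> xl m x 0 i = x i.
Proof.
  intros Hi. unfold xl. rewrite Nat.pow_0_r, Nat.div_1_r. cbn [csum].
  rewrite Nat.mul_0_l, Nat.add_0_r. simpl. ring.
Qed.

Lemma xl_m m x i : (i < 2 ^ m)%nat -> xl m x m i = dftc m x i.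
Proof.
  intros Hi. unfold xl, dftc. apply csum_ext; intros j _.
  rewrite Nat.div_small, Nat.mod_small, Nat.sub_diag by auto.
  simpl. now rewrite Nat.mul_1_r.
Qed.

(** * Error analysis *)

Definition val (Q : Z) (z : Z * Z) : C := (IZR (fst z) / IZR Q, IZR (snd z) / IZR Q).

Definition near (Q : Z) (e : R) (z : Z * Z) (c : C) : Prop := Cmod (val Q z - c) <= e.

Lemma IZR_div_bounds a b :
  (0 < b)%Z -> IZR a / IZR b - 1 <= IZR (a / b) <= IZR a / IZR b.
Proof.
  intros Hb. pose proof (Z.div_mod a b ltac:(lia)) as E.
  pose proof (Z.mod_pos_bound a b Hb) as [H1 H2].
  apply IZR_lt in Hb. apply IZR_le in H1. apply IZR_lt in H2.
  apply (f_equal IZR) in E. rewrite plus_IZR, mult_IZR in E.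
  replace (IZR a / IZR b) with (IZR (a / b) + IZR (a mod b) / IZR b) by (rewrite E; field; lra).
  assert (0 <= IZR (a mod b) / IZR b <= 1).
  { split; [apply Rmult_le_pos; [lra|apply Rlt_le, Rinv_0_lt_compat; lra]|].
    apply Rmult_le_reg_r with (IZR b); [lra|]. unfold Rdiv.
    rewrite Rmult_assoc, Rinv_l; lra. }
  lra.
Qed.

Lemma Cmod_le_sum (c : C) : Cmod c <= Rabs (fst c) + Rabs (snd c).
Proof.
  unfold Cmod.
  pose proof (Rabs_pos (fst c)). pose proof (Rabs_pos (snd c)).
  rewrite <- (sqrt_square (Rabs (fst c) + Rabs (snd c))) by lra.
  apply sqrt_le_1_alt. rewrite <- (pow2_abs (fst c)), <- (pow2_abs (snd c)). nra.
Qed.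

Lemma cmulz_val Q x y :
  (0 < Q)%Z -> Cmod (val Q (cmulz Q x y) - val Q x * val Q y) <= 2 / IZR Q.
Proof.
  intros HQ. destruct x as [a b], y as [c d].
  eapply Rle_trans; [apply Cmod_le_sum|]. unfold val, cmulz; simpl.
  pose proof (IZR_div_bounds (a * c - b * d) Q HQ) as H1.
  pose proof (IZR_div_bounds (a * d + b * c) Q HQ) as H2.
  rewrite minus_IZR, !mult_IZR in H1. rewrite plus_IZR, !mult_IZR in H2.
  apply IZR_lt in HQ. set (q := IZR Q) in *.
  assert (Hi : 0 < / q) by (apply Rinv_0_lt_compat; lra).
  set (r1 := IZR ((a * c - b * d) / Q)) in *. set (r2 := IZR ((a * d + b * c) / Q)) in *.
  match goal with |- Rabs ?u + Rabs ?v <= _ =>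
    replace u with ((r1 - (IZR a * IZR c - IZR b * IZR d) / q) * / q) by (field; lra);
    replace v with ((r2 - (IZR a * IZR d + IZR b * IZR c) / q) * / q) by (field; lra)
  end.
  rewrite !Rabs_mult, (Rabs_right (/ q)) by lra.
  assert (Rabs (r1 - (IZR a * IZR c - IZR b * IZR d) / q) <= 1) by (apply Rabs_le; lra).
  assert (Rabs (r2 - (IZR a * IZR d + IZR b * IZR c) / q) <= 1) by (apply Rabs_le; lra).
  unfold Rdiv. nra.
Qed.

Lemma near_bound Q e z c b : near Q e z c -> Cmod c <= b -> Cmod (val Q z) <= b + e.
Proof.
  unfold near. intros H1 H2.
  replace (val Q z) with (c + (val Q z - c))%C by ring.
  eapply Rle_trans; [apply Cmod_triangle|]. lra.
Qed.

Lemma near_le Q e e' z c : near Q e z c -> e <= e' -> near Q e' z c.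
Proof. unfold near; lra. Qed.

Lemma near_cmulz Q e1 e2 b1 b2 z1 z2 c1 c2 :
  (0 < Q)%Z -> near Q e1 z1 c1 -> near Q e2 z2 c2 ->
  Cmod (val Q z1) <= b1 -> Cmod c2 <= b2 ->
  near Q (b1 * e2 + b2 * e1 + 2 / IZR Q) (cmulz Q z1 z2) (c1 * c2).
Proof.
  unfold near. intros HQ H1 H2 B1 B2.
  replace (val Q (cmulz Q z1 z2) - c1 * c2)%C
    with ((val Q (cmulz Q z1 z2) - val Q z1 * val Q z2) +
          (val Q z1 * (val Q z2 - c2) + (val Q z1 - c1) * c2))%C by ring.
  eapply Rle_trans; [apply Cmod_triangle|].
  pose proof (cmulz_val Q z1 z2 HQ).
  pose proof (Cmod_triangle (val Q z1 * (val Q z2 - c2)) ((val Q z1 - c1) * c2)) as H3.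
  rewrite !Cmod_mult in H3.
  pose proof (Cmod_ge_0 (val Q z1)). pose proof (Cmod_ge_0 (val Q z2 - c2)).
  pose proof (Cmod_ge_0 (val Q z1 - c1)). pose proof (Cmod_ge_0 c2).
  assert (Cmod (val Q z1) * Cmod (val Q z2 - c2) <= b1 * e2) by (apply Rmult_le_compat; auto).
  assert (Cmod (val Q z1 - c1) * Cmod c2 <= e1 * b2) by (apply Rmult_le_compat; auto).
  lra.
Qed.

Lemma near_caddz Q e1 e2 z1 z2 c1 c2 :
  near Q e1 z1 c1 -> near Q e2 z2 c2 -> near Q (e1 + e2) (caddz z1 z2) (c1 + c2).
Proof.
  unfold near. intros H1 H2.
  replace (val Q (caddz z1 z2) - (c1 + c2))%C
    with ((val Q z1 - c1) + (val Q z2 - c2))%C.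
  - eapply Rle_trans; [apply Cmod_triangle|]. lra.
  - unfold val, caddz, Cminus, Cplus, Copp; simpl. rewrite !plus_IZR. unfold Rdiv. f_equal; ring.
Qed.

(** The errors do not accumulate with [l]: the new cosine is at least sqrt(1/2) > 7/10, so the
    square root contracts the error of its argument and the divisor stays comparable to [Q]. The
    bounds 4 and 30 are chosen so that one half-angle step, roundings included, reproduces them. *)
Lemma halfz_near Q l :
  (1000 <= Q)%Z -> (Q mod 2 = 0)%Z ->
  Rabs (IZR (fst (halfz Q l)) - IZR Q * fst (halfr l)) <= 4 /\
  Rabs (IZR (snd (halfz Q l)) - IZR Q * snd (halfr l)) <= 30 /\
  (0 <= fst (halfz Q l))%Z /\ (0 <= snd (halfz Q l))%Z.
Proof.
  intros HQ HQ2.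
  assert (E : IZR (Q / 2) = IZR Q / 2).
  { pose proof (Z.div_mod Q 2 ltac:(lia)) as E. rewrite HQ2, Z.add_0_r in E.
    apply (f_equal IZR) in E. rewrite mult_IZR in E. lra. }
  assert (Hq2 : (0 < Q / 2)%Z) by (apply Z.div_str_pos; lia).
  assert (HqR : 1000 <= IZR Q) by (apply IZR_le; lia).
  induction l as [|l (Hc & Hs & Pc & Ps)].
  - simpl. repeat split; try lia; apply Rabs_le; lra.
  - cbn [halfz halfr fst snd].
    destruct (halfr_spec l) as (Rc & Rs & R1).
    pose proof (halfr_spec (S l)) as (_ & _ & R1'). cbn [halfr fst snd] in R1'.
    set (c := fst (halfz Q l)) in *. set (s := snd (halfz Q l)) in *.
    set (rc := fst (halfr l)) in *. set (rs := snd (halfr l)) in *.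
    set (x := ((Q + c) * (Q / 2))%Z) in *.
    assert (Hx : (0 <= x)%Z) by (unfold x; nia).
    pose proof (Z.sqrt_spec x Hx) as [S1 S2].
    pose proof (Z.sqrt_nonneg x) as S0.
    set (c' := Z.sqrt x) in *.
    apply IZR_le in S1. apply IZR_lt in S2.
    unfold Z.succ in S2. rewrite !mult_IZR, plus_IZR in S2. rewrite mult_IZR in S1.
    unfold x in S1, S2. rewrite mult_IZR, plus_IZR, E in S1, S2.
    assert (Q1 : sqrt ((1 + rc) / 2) * sqrt ((1 + rc) / 2) = (1 + rc) / 2)
      by (apply sqrt_sqrt; lra).
    assert (Q2 : 0 < sqrt ((1 + rc) / 2)) by (apply sqrt_lt_R0; lra).
    set (rc' := sqrt ((1 + rc) / 2)) in *.
    assert (Q3 : 7 / 10 <= rc') by nra.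
    apply Rabs_le_between in Hc. apply Rabs_le_between in Hs.
    set (q := IZR Q) in *. set (C' := q * rc').
    assert (HC : C' * C' = (q + q * rc) * (q / 2)) by (unfold C'; nra).
    assert (HC7 : 7 / 10 * q <= C') by (unfold C'; nra).
    assert (c0 : 0 <= IZR c') by (apply IZR_le; auto).
    assert (K1 : (IZR c - q * rc) * (q / 2) <= 4 * (q / 2)) by (apply Rmult_le_compat_r; lra).
    assert (K2 : (-4) * (q / 2) <= (IZR c - q * rc) * (q / 2)) by (apply Rmult_le_compat_r; lra).
    assert (H4 : Rabs (IZR c' - C') <= 4).
    { apply Rabs_le. split.
      - destruct (Rle_lt_dec (-4) (IZR c' - C')) as [|Hn]; auto. exfalso.
        assert ((IZR c' + 1) * (IZR c' + 1) - C' * C' > - (2 * q)) by lra.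
        assert (3 * (7 / 10 * q) <= (C' - IZR c' - 1) * (IZR c' + 1 + C'))
          by (apply Rmult_le_compat; lra).
        lra.
      - destruct (Rle_lt_dec (IZR c' - C') 4) as [|Hn]; auto. exfalso.
        assert (IZR c' * IZR c' - C' * C' <= 2 * q) by lra.
        assert (4 * (2 * (7 / 10 * q)) <= (IZR c' - C') * (IZR c' + C'))
          by (apply Rmult_le_compat; lra).
        lra. }
    assert (Hc' : (0 < c')%Z).
    { apply lt_IZR. apply Rabs_le_between in H4. lra. }
    repeat split; auto; [|apply Z.div_pos; nia].
    apply Rabs_le_between in H4.
    pose proof (Z.div_mod (s * (Q / 2)) c' ltac:(lia)) as D.
    pose proof (Z.mod_pos_bound (s * (Q / 2)) c' Hc') as [M1 M2].
    set (s' := (s * (Q / 2) / c')%Z) in *. set (r := ((s * (Q / 2)) mod c')%Z) in *.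
    apply (f_equal IZR) in D. rewrite plus_IZR, !mult_IZR, E in D.
    apply IZR_le in M1. apply IZR_lt in M2.
    set (rs' := rs / (2 * rc')) in *.
    assert (Hrs : rs' * rc' = rs / 2) by (unfold rs'; field; lra).
    assert (Hrs0 : 0 <= rs' <= 1).
    { split; [unfold rs'; apply Rmult_le_pos; auto; apply Rlt_le, Rinv_0_lt_compat; lra|nra]. }
    (* The division with remainder [r] is compared with the exact relation rs' * rc' = rs / 2; the
       error of the new sine then appears multiplied by [c'] and is isolated by dividing. *)
    assert (K : (IZR s - q * rs) * (q / 2) =
                (IZR s' - q * rs') * IZR c' + q * rs' * (IZR c' - C') + IZR r).
    { unfold C'. fold q in D.
      replace ((IZR s - q * rs) * (q / 2)) with (IZR s * (q / 2) - q * q * (rs / 2)) by field.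
      rewrite D, <- Hrs. ring. }
    assert (B1 : Rabs ((IZR s' - q * rs') * IZR c') <= 15 * q + 4 * q + IZR c').
    { replace ((IZR s' - q * rs') * IZR c')
        with ((IZR s - q * rs) * (q / 2) - q * rs' * (IZR c' - C') - IZR r) by lra.
      assert (-(15 * q) <= (IZR s - q * rs) * (q / 2) <= 15 * q) by (split; nra).
      assert (-(4 * q) <= q * rs' * (IZR c' - C') <= 4 * q).
      { assert (0 <= q * rs' <= q) by (split; nra).
        assert (0 <= q * rs' * (IZR c' - C' + 4)) by (apply Rmult_le_pos; lra).
        assert (0 <= q * rs' * (4 - (IZR c' - C'))) by (apply Rmult_le_pos; lra).
        lra. }
      apply Rabs_le; lra. }
    rewrite Rabs_mult, (Rabs_right (IZR c')) in B1 by lra.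
    assert (B2 : 19 * q <= 28 * IZR c') by lra.
    pose proof (Rabs_pos (IZR s' - q * rs')).
    apply Rmult_le_reg_r with (IZR c'); lra.
Qed.

Lemma val_unit Q : (0 < Q)%Z -> val Q (Q, 0%Z) = RtoC 1.
Proof.
  intros H. apply IZR_lt in H. unfold val, RtoC; simpl. f_equal; field; lra.
Qed.

Lemma rootz_near Q l :
  (1000 <= Q)%Z -> (Q mod 2 = 0)%Z -> near Q (34 / IZR Q) (rootz Q l) (om l).
Proof.
  intros HQ HQ2. assert (HqR : 1000 <= IZR Q) by (apply IZR_le; lia).
  assert (Hi : 0 < / IZR Q) by (apply Rinv_0_lt_compat; lra).
  unfold near. destruct l as [|[|l]]; cbn [rootz om].
  - rewrite val_unit by lia. replace (1 - 1)%C with (RtoC 0) by ring.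
    rewrite Cmod_0. unfold Rdiv; nra.
  - replace (val Q (- Q, 0)%Z) with (RtoC (-1)).
    + replace (RtoC (-1) - RtoC (-1))%C with (RtoC 0) by ring.
      rewrite Cmod_0. unfold Rdiv; nra.
    + unfold val, RtoC; simpl. rewrite opp_IZR. f_equal; field; lra.
  - destruct (halfz_near Q l HQ HQ2) as (H1 & H2 & _).
    eapply Rle_trans; [apply Cmod_le_sum|].
    unfold val; cbn [fst snd Cminus Cplus Copp].
    replace (IZR (fst (halfz Q l)) / IZR Q + - fst (halfr l))
      with ((IZR (fst (halfz Q l)) - IZR Q * fst (halfr l)) * / IZR Q) by (field; lra).
    replace (IZR (snd (halfz Q l)) / IZR Q + - snd (halfr l))
      with ((IZR (snd (halfz Q l)) - IZR Q * snd (halfr l)) * / IZR Q) by (field; lra).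
    rewrite !Rabs_mult, (Rabs_right (/ IZR Q)) by lra. unfold Rdiv. nra.
Qed.

Lemma om_pow_mod l k : Cmod (om l ^ k)%C = 1.
Proof. rewrite Cmod_pow, om_mod. apply pow1. Qed.

(** Each odd binary digit of [k] adds about 36/Q: 34 from the root and 2 from rounding the product.
    The true growth is linear in [l]; the generous 2^l - 1 swallows the second-order terms. *)
Lemma twz_near Q l k :
  (1000 <= Q)%Z -> (Q mod 2 = 0)%Z -> (k < 2 ^ l)%nat ->
  near Q ((2 ^ l - 1) * (36 / IZR Q)) (twz Q l k) (om l ^ k)%C.
Proof.
  intros HQ HQ2. assert (HqR : 1000 <= IZR Q) by (apply IZR_le; lia).
  assert (Hi : 0 < / IZR Q) by (apply Rinv_0_lt_compat; lra).
  revert k; induction l as [|l IH]; intros k Hk.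
  - replace k with 0%nat by (simpl in Hk; lia). unfold near. cbn [twz Cpow].
    rewrite val_unit by lia. replace (1 - 1)%C with (RtoC 0) by ring.
    rewrite Cmod_0. simpl. lra.
  - cbn [twz]. rewrite Nat.pow_succ_r' in Hk.
    assert (Hk2 : (k / 2 < 2 ^ l)%nat) by (apply Nat.Div0.div_lt_upper_bound; lia).
    specialize (IH _ Hk2).
    assert (P : 1 <= 2 ^ l) by (apply pow_R1_Rle; lra).
    assert (HI : 36 / IZR Q = 36 * / IZR Q) by reflexivity.
    rewrite HI in *. cbn [pow].
    pose proof (Nat.div_mod_eq k 2) as Ek.
    destruct (Nat.even k) eqn:Ev.
    + apply Nat.even_spec in Ev as [j ->].
      rewrite Nat.mul_comm, Nat.div_mul, Nat.mul_comm in * by lia.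
      rewrite om_even. eapply near_le; [exact IH|]. nra.
    + assert (Od : Nat.odd k = true) by (rewrite <- Nat.negb_even, Ev; auto).
      apply Nat.odd_spec in Od as [j ->].
      replace ((2 * j + 1) / 2)%nat with j in *.
      2:{ rewrite Nat.mul_comm, Nat.div_add_l by lia. simpl. lia. }
      rewrite Cpow_add_r, om_even, Cpow_1_r.
      eapply near_le.
      * apply near_cmulz with (b1 := 1 + (2 ^ l - 1) * (36 * / IZR Q)) (b2 := 1);
          [lia|exact IH|apply rootz_near; auto| |rewrite om_mod; lra].
        eapply near_bound; [exact IH|]. rewrite om_pow_mod. lra.
      * assert (34 / IZR Q = 34 * / IZR Q) as -> by reflexivity.
        assert (2 / IZR Q = 2 * / IZR Q) as -> by reflexivity.
        assert (I1 : / IZR Q <= / 1000) by (apply Rinv_le_contravar; lra).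
        set (i := / IZR Q) in *. set (p := 2 ^ l) in *.
        assert (0 <= (p - 1) * (36 * i - 1224 * (i * i))) by (apply Rmult_le_pos; nra).
        lra.
Qed.

(** A butterfly turns an error e into 3 e, as a computed twiddle factor has modulus at most 2, plus
    the twiddle error times values of size 2^l * G, plus rounding; a factor 4 per level covers all
    of it. After m levels the factor is (2^m)^2, polynomial in the length, so it costs only O(m)
    further bits of [Q]. *)
Lemma fftz_near Q m X x G e0 :
  (1000 <= Q)%Z -> (Q mod 2 = 0)%Z -> 36 * 2 ^ m <= IZR Q -> 0 <= e0 -> 0 <= G ->
  (forall i, (i < 2 ^ m)%nat -> near Q e0 (X i) (x i)) ->
  (forall i, (i < 2 ^ m)%nat -> Cmod (x i) <= G) ->
  forall l, (l <= m)%nat -> forall i, (i < 2 ^ m)%nat ->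
    near Q (4 ^ l * (e0 + 36 * 2 ^ m / IZR Q * G + 2 / IZR Q)) (fftz Q m X l i) (xl m x l i).
Proof.
  intros HQ HQ2 HQm He HG HX Hx.
  assert (HqR : 1000 <= IZR Q) by (apply IZR_le; lia).
  assert (Hi : 0 < / IZR Q) by (apply Rinv_0_lt_compat; lra).
  assert (P : 1 <= 2 ^ m) by (apply pow_R1_Rle; lra).
  set (d := 36 * 2 ^ m / IZR Q).
  assert (Hd : 0 <= d <= 1).
  { unfold d; split; [apply Rmult_le_pos; lra|].
    apply Rmult_le_reg_r with (IZR Q); [lra|]. unfold Rdiv. rewrite Rmult_assoc, Rinv_l; lra. }
  assert (Hu : 0 <= 2 / IZR Q) by (unfold Rdiv; nra).
  set (u := 2 / IZR Q) in *.
  assert (HdG : 0 <= d * G) by nra.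
  induction l as [|l IH]; intros Hl i Hi'.
  - cbn [fftz pow]. rewrite xl_0 by auto. eapply near_le; [apply HX; auto|]. lra.
  - cbn [fftz]. rewrite xl_step by lia.
    pose proof (fidx_lt m l i ltac:(lia) Hi') as F.
    assert (Hk : (i mod 2 ^ S l * 2 ^ (m - S l) < 2 ^ m)%nat).
    { replace m with (S l + (m - S l))%nat at 2 by lia. rewrite Nat.pow_add_r.
      apply Nat.mul_lt_mono_pos_r; [pose proof (Nat.pow_nonzero 2 (m - S l)); lia|].
      apply Nat.mod_upper_bound. apply Nat.pow_nonzero; lia. }
    pose proof (twz_near Q m _ HQ HQ2 Hk) as T.
    set (k := (i mod 2 ^ S l * 2 ^ (m - S l))%nat) in *.
    assert (T' : near Q d (twz Q m k) (om m ^ k)%C).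
    { eapply near_le; [exact T|]. unfold d, Rdiv. nra. }
    assert (Gx : Cmod (xl m x l (fidx l i + 2 ^ (m - 1))) <= 2 ^ l * G).
    { unfold xl.
      replace (2 ^ l) with (INR (2 ^ l)) by (rewrite pow_INR; f_equal; simpl; lra).
      apply csum_mod. intros j Hj. rewrite Cmod_mult, om_pow_mod, Rmult_1_r. apply Hx.
      assert (Em : (2 ^ m = 2 ^ l * 2 ^ (m - l))%nat) by (rewrite <- Nat.pow_add_r; f_equal; lia).
      rewrite Em in F |- *.
      assert (((fidx l i + 2 ^ (m - 1)) / 2 ^ l < 2 ^ (m - l))%nat)
        by (apply Nat.Div0.div_lt_upper_bound; lia).
      nia. }
    eapply near_le.
    + apply near_caddz; [apply IH; lia|].
      apply near_cmulz with (b1 := 2) (b2 := 2 ^ l * G);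
        [lia|exact T'|apply IH; lia| |exact Gx].
      replace 2 with (1 + 1) by ring. eapply near_bound; [eapply near_le; [exact T'|lra]|].
      rewrite om_pow_mod; lra.
    + fold u. set (e := e0 + d * G + u) in *.
      assert (P4 : 1 <= 4 ^ l) by (apply pow_R1_Rle; lra).
      assert (P2 : 2 ^ l <= 4 ^ l) by (apply pow_incr; lra).
      cbn [pow].
      assert (2 ^ l * G * d <= 4 ^ l * (d * G)) by nra.
      assert (u <= 4 ^ l * u) by nra.
      assert (4 ^ l * e = 4 ^ l * e0 + 4 ^ l * (d * G) + 4 ^ l * u) by (unfold e; ring).
      assert (0 <= 4 ^ l * e0) by nra. lra.
Qed.

(** * Triple cyclic convolution *)

Lemma csum_scal_r n c f : csum n (fun i => f i * c)%C = (csum n f * c)%C.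
Proof. induction n; simpl; [ring|]. rewrite IHn; ring. Qed.

Lemma csum_prod3 n f g h (w : C) :
  (csum n f * csum n g * csum n h * w)%C =
  csum n (fun a => csum n (fun b => csum n (fun c => f a * g b * h c * w)))%C.
Proof.
  rewrite (csum_ext n (fun a => csum n (fun b => csum n (fun c => f a * g b * h c * w)))%C
             (fun a => f a * (csum n g * csum n h * w))%C).
  - rewrite csum_scal_r. ring.
  - intros a _.
    rewrite (csum_ext n _ (fun b => g b * (f a * csum n h * w))%C).
    + rewrite csum_scal_r. ring.
    + intros b _.
      rewrite (csum_ext n _ (fun c => h c * (f a * g b * w))%C) by (intros; ring).
      rewrite csum_scal_r. ring.
Qed.

Lemma csum_nat n t : csum n (fun i => RtoC (INR (t i))) = RtoC (INR (nsum n t)).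
Proof.
  induction n; simpl; [reflexivity|]. now rewrite IHn, plus_INR, RtoC_plus.
Qed.

Definition ind (b : bool) : nat := if b then 1%nat else 0%nat.

(** Applying the forward transform once more to a product of forward transforms reads the
    convolution at [- k]; hence the sum a + b + c + k is required to vanish modulo [M]. *)
Definition hits (M : nat) (f g h : nat -> nat) (k : nat) : nat :=
  nsum M (fun a => nsum M (fun b => nsum M (fun c =>
    (f a * g b * h c * ind ((a + b + c + k) mod M =? 0))%nat))).

Definition cn (f : nat -> nat) (i : nat) : C := RtoC (INR (f i)).

Lemma triple_dft m f g h k :
  dftc m (fun i => dftc m (cn f) i * dftc m (cn g) i * dftc m (cn h) i)%C k =
  RtoC (INR (2 ^ m) * INR (hits (2 ^ m) f g h k)).
Proof.
  set (M := (2 ^ m)%nat). unfold dftc. fold M.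
  rewrite (csum_ext M _ (fun i => csum M (fun a => csum M (fun b => csum M (fun c =>
     cn f a * cn g b * cn h c * om m ^ (i * (a + b + c + k))))))%C).
  2:{ intros i _. rewrite csum_prod3. apply csum_ext; intros a _.
      apply csum_ext; intros b _. apply csum_ext; intros c _.
      replace (i * (a + b + c + k))%nat with (a * i + b * i + c * i + i * k)%nat by lia.
      rewrite !Cpow_add_r. ring. }
  unfold hits. rewrite csum_swap.
  rewrite RtoC_mult, <- csum_nat, <- csum_scal. apply csum_ext; intros a _.
  rewrite csum_swap, <- csum_nat, <- csum_scal. apply csum_ext; intros b _.
  rewrite csum_swap, <- csum_nat, <- csum_scal. apply csum_ext; intros c _.
  rewrite csum_scal. unfold M at 1. rewrite om_orth. fold M.
  unfold cn, ind. rewrite !mult_INR, !RtoC_mult.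
  destruct (_ =? 0)%nat; simpl; ring.
Qed.

Lemma nsum_pos n t i : (i < n)%nat -> (t i <= nsum n t)%nat.
Proof.
  induction n; simpl; intros; [lia|].
  destruct (Nat.eq_dec i n) as [->|]; [lia|]. specialize (IHn ltac:(lia)). lia.
Qed.

(** Turns an error estimate into a size bound on the two integers. Such bounds guarantee that the
    residues kept by the machine determine the integers. *)
Lemma near_comps Q e z c b :
  (0 < Q)%Z -> near Q e z c -> Cmod c + e <= IZR b ->
  (Z.abs (fst z) <= b * Q)%Z /\ (Z.abs (snd z) <= b * Q)%Z.
Proof.
  intros HQ Hn Hb. pose proof (near_bound _ _ _ _ _ Hn (Rle_refl _)) as H.
  apply IZR_lt in HQ.
  assert (H0 : forall x, Rabs (x / IZR Q) <= IZR b -> Rabs x <= IZR b * IZR Q).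
  { intros x Hx. unfold Rdiv in Hx. rewrite Rabs_mult, Rabs_inv, (Rabs_right (IZR Q)) in Hx by lra.
    apply Rmult_le_reg_r with (/ IZR Q); [apply Rinv_0_lt_compat; lra|].
    rewrite Rmult_assoc, Rinv_r by lra. lra. }
  split; apply le_IZR; rewrite abs_IZR, mult_IZR; apply H0.
  - pose proof (Rmax_Cmod (val Q z)) as Hm. pose proof (Rmax_l (Rabs (fst (val Q z))) (Rabs (snd (val Q z)))).
    unfold val in *; simpl in *. lra.
  - pose proof (Rmax_Cmod (val Q z)) as Hm. pose proof (Rmax_r (Rabs (fst (val Q z))) (Rabs (snd (val Q z)))).
    unfold val in *; simpl in *. lra.
Qed.

(** * The precision that suffices for exact rounding *)

Section Precision.
Variables (m : nat) (Q : Z).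
Let M := IZR (2 ^ Z.of_nat m).
Let Mz := (2 ^ Z.of_nat m)%Z.
Hypothesis Hm : (2 <= m)%nat.
Hypothesis HQ2 : (Q mod 2 = 0)%Z.
Hypothesis HQ : (Mz ^ 11 <= Q)%Z.

Lemma M_pow : 2 ^ m = M.
Proof. unfold M. now rewrite <- pow_IZR. Qed.

Lemma Mz_pow k : IZR (Mz ^ Z.of_nat k) = M ^ k.
Proof. symmetry. apply pow_IZR. Qed.

Lemma M_ge4 : 4 <= M.
Proof. rewrite <- M_pow. replace 4 with (2 ^ 2) by ring. apply Rle_pow; lra || auto. Qed.

Lemma Q_ge : M ^ 11 <= IZR Q.
Proof.
  unfold M. rewrite pow_IZR. apply IZR_le. exact HQ.
Qed.

(** The origin of the exponent 11: the analysis needs [Q] above a constant times M^6, and M >= 4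
    converts the other five powers into the constant 1024. *)
Lemma Q_ge5 : 1024 * M ^ 6 <= IZR Q.
Proof.
  eapply Rle_trans; [|apply Q_ge].
  pose proof M_ge4 as H4.
  replace 1024 with (4 ^ 5) by ring.
  replace (M ^ 11) with (M ^ 5 * M ^ 6) by ring.
  apply Rmult_le_compat_r; [apply pow_le; lra|]. apply pow_incr; lra.
Qed.

Lemma M6_ge : 4096 <= M ^ 6.
Proof.
  pose proof M_ge4 as H4. replace 4096 with (4 ^ 6) by ring. apply pow_incr; lra.
Qed.

Lemma Q_1000 : (1000 <= Q)%Z.
Proof. apply le_IZR. pose proof Q_ge5. pose proof M6_ge. lra. Qed.

Lemma M_ge6 : M <= M ^ 6.
Proof.
  pose proof M_ge4 as H4. replace (M ^ 6) with (M * M ^ 5) by ring.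
  assert (1 <= M ^ 5) by (apply pow_R1_Rle; lra). nra.
Qed.

Lemma Q_36 : 36 * 2 ^ m <= IZR Q.
Proof. rewrite M_pow. pose proof Q_ge5. pose proof M_ge6. pose proof M6_ge. lra. Qed.

Lemma INR_M : INR (2 ^ m) = M.
Proof. rewrite pow_INR, <- M_pow. f_equal. Qed.

Lemma pow4_M l : (l <= m)%nat -> 4 ^ l <= M ^ 2.
Proof.
  intros Hl. rewrite <- M_pow, <- pow_mult, Nat.mul_comm, pow_mult.
  replace (2 ^ 2) with 4 by ring. apply Rle_pow; lra || auto.
Qed.

Lemma twz_comps_le l k :
  (l <= m)%nat -> (k < 2 ^ l)%nat ->
  (Z.abs (fst (twz Q l k)) <= 2 * Q)%Z /\ (Z.abs (snd (twz Q l k)) <= 2 * Q)%Z.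
Proof.
  intros Hl Hk. pose proof Q_1000 as HQ1.
  eapply near_comps; [lia|apply twz_near; auto|].
  rewrite om_pow_mod.
  pose proof Q_36 as H.
  assert (2 ^ l <= 2 ^ m) by (apply Rle_pow; lra || auto).
  assert (0 < IZR Q) by (apply IZR_lt; lia).
  enough ((2 ^ l - 1) * (36 / IZR Q) <= 1) by lra.
  apply Rmult_le_reg_r with (IZR Q); auto.
  replace ((2 ^ l - 1) * (36 / IZR Q) * IZR Q) with ((2 ^ l - 1) * 36) by (field; lra). lra.
Qed.

Lemma rootz_comps l :
  (Z.abs (fst (rootz Q l)) <= 2 * Q)%Z /\ (Z.abs (snd (rootz Q l)) <= 2 * Q)%Z.
Proof.
  pose proof Q_1000 as HQ1.
  eapply near_comps; [lia|apply rootz_near; auto|].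
  rewrite om_mod. assert (1000 <= IZR Q) by (apply IZR_le; lia).
  enough (34 / IZR Q <= 1) by lra.
  apply Rmult_le_reg_r with (IZR Q); [lra|].
  replace (34 / IZR Q * IZR Q) with 34 by (field; lra). lra.
Qed.

Let iq := / IZR Q.

Lemma iq_pos : 0 < iq.
Proof.
  unfold iq. apply Rinv_0_lt_compat. pose proof Q_1000. apply IZR_lt. lia.
Qed.

Lemma iq_M : iq * (1024 * M ^ 6) <= 1.
Proof.
  unfold iq. pose proof Q_ge5. pose proof M6_ge.
  apply Rmult_le_reg_l with (IZR Q); [lra|]. rewrite <- Rmult_assoc, Rinv_r by lra. lra.
Qed.

Section Forward.
Variable f : nat -> nat.
Hypothesis Hf : forall i, (f i <= 1)%nat.

Lemma fwd_near l i :
  (l <= m)%nat -> (i < 2 ^ m)%nat ->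
  near Q (38 * M ^ 3 * iq) (fftz Q m (inz Q f) l i) (xl m (cn f) l i).
Proof.
  intros Hl Hi. pose proof Q_1000 as HQ1.
  pose proof iq_pos. pose proof M_ge4.
  eapply near_le.
  - apply (fftz_near Q m (inz Q f) (cn f) 1 0); auto; try lra.
    + apply Q_36.
    + intros j _. unfold near. unfold inz, cn, val. cbn [fst snd].
      rewrite mult_IZR, <- INR_IZR_INZ.
      assert (0 < IZR Q) by (apply IZR_lt; lia).
      replace (IZR Q * INR (f j) / IZR Q, 0 / IZR Q) with (RtoC (INR (f j)))
        by (unfold RtoC; f_equal; field; lra).
      replace (INR (f j) - INR (f j))%C with (RtoC 0) by ring. rewrite Cmod_0. lra.
    + intros j _. unfold cn. rewrite Cmod_R.
      assert (H1 := Hf j). apply le_INR in H1. simpl in H1.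
      rewrite Rabs_right; [auto|]. apply Rle_ge, pos_INR.
  - rewrite M_pow. pose proof (pow4_M l Hl) as P.
    assert (0 <= 4 ^ l) by (apply pow_le; lra).
    replace (0 + 36 * M / IZR Q * 1 + 2 / IZR Q) with ((36 * M + 2) * iq) by (unfold iq, Rdiv; ring).
    replace (38 * M ^ 3 * iq) with (M ^ 2 * (38 * M * iq)) by ring.
    apply Rmult_le_compat; auto.
    + apply Rmult_le_pos; lra.
    + apply Rmult_le_compat_r; lra.
Qed.

Lemma xl_mod l i : (l <= m)%nat -> (i < 2 ^ m)%nat -> Cmod (xl m (cn f) l i) <= M.
Proof.
  intros Hl Hi. unfold xl. pose proof M_ge4.
  apply Rle_trans with (INR (2 ^ l) * 1).
  - apply csum_mod. intros j _. rewrite Cmod_mult, om_pow_mod, Rmult_1_r.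
    unfold cn. rewrite Cmod_R.
    assert (H1 := Hf (i / 2 ^ l + j * 2 ^ (m - l))). apply le_INR in H1. simpl in H1.
    rewrite Rabs_right; [auto|]. apply Rle_ge, pos_INR.
  - rewrite Rmult_1_r, <- INR_M. apply le_INR. apply Nat.pow_le_mono_r; lia.
Qed.

Lemma eps_small : 38 * M ^ 3 * iq * (26 * M ^ 3) <= 1.
Proof.
  pose proof iq_M. pose proof iq_pos.
  assert (0 <= M ^ 6 * iq) by (pose proof M6_ge; apply Rmult_le_pos; lra).
  replace (38 * M ^ 3 * iq * (26 * M ^ 3)) with (988 * (M ^ 6 * iq)) by ring. lra.
Qed.

Lemma M3_ge : M <= M ^ 3 /\ 64 <= M ^ 3.
Proof.
  pose proof M_ge4. split.
  - replace (M ^ 3) with (M * (M * M)) by ring. assert (16 <= M * M) by nra. nra.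
  - replace 64 with (4 ^ 3) by ring. apply pow_incr; lra.
Qed.

Lemma fwd_comps l i :
  (l <= m)%nat -> (i < 2 ^ m)%nat ->
  (Z.abs (fst (fftz Q m (inz Q f) l i)) <= 2 * Mz * Q)%Z /\
  (Z.abs (snd (fftz Q m (inz Q f) l i)) <= 2 * Mz * Q)%Z.
Proof.
  intros Hl Hi. pose proof Q_1000. eapply near_comps; [lia|apply fwd_near; auto|].
  pose proof (xl_mod l i Hl Hi). pose proof eps_small. pose proof M3_ge. pose proof M_ge4.
  assert (0 <= 38 * M ^ 3 * iq) by (pose proof iq_pos; apply Rmult_le_pos; lra).
  assert (0 <= 38 * M ^ 3 * iq * (26 * M ^ 3 - 1)) by (apply Rmult_le_pos; lra).
  rewrite mult_IZR. change (IZR Mz) with M. lra.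
Qed.

Lemma dft_near i :
  (i < 2 ^ m)%nat -> near Q (38 * M ^ 3 * iq) (dftz Q m (inz Q f) i) (dftc m (cn f) i).
Proof.
  intros Hi. rewrite <- xl_m by auto. apply fwd_near; auto.
Qed.

Lemma dft_mod i : (i < 2 ^ m)%nat -> Cmod (dftc m (cn f) i) <= M.
Proof. intros Hi. rewrite <- xl_m by auto. apply xl_mod; auto. Qed.

End Forward.

Section Triple.
Variables f g h : nat -> nat.
Hypothesis Hf : forall i, (f i <= 1)%nat.
Hypothesis Hg : forall i, (g i <= 1)%nat.
Hypothesis Hh : forall i, (h i <= 1)%nat.

Let eps := 38 * M ^ 3 * iq.

Lemma eps_bounds : 0 <= eps /\ eps * (26 * M ^ 3) <= 1 /\ eps <= 1 /\ 2 * iq <= eps.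
Proof.
  pose proof eps_small as H. fold eps in H. pose proof M3_ge. pose proof iq_pos.
  assert (0 <= eps) by (apply Rmult_le_pos; lra).
  assert (0 <= eps * (26 * M ^ 3 - 1)) by (apply Rmult_le_pos; lra).
  repeat split; auto; [lra|]. unfold eps. nra.
Qed.

Lemma prod2_near i :
  (i < 2 ^ m)%nat ->
  near Q (4 * M * eps) (cmulz Q (dftz Q m (inz Q f) i) (dftz Q m (inz Q g) i))
    (dftc m (cn f) i * dftc m (cn g) i).
Proof.
  intros Hi. pose proof Q_1000. destruct eps_bounds as (E0 & E1 & E2 & E3). pose proof M_ge4.
  eapply near_le.
  - apply near_cmulz with (e1 := eps) (e2 := eps) (b1 := M + eps) (b2 := M); [lia| | | |].
    + apply dft_near; auto.
    + apply dft_near; auto.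
    + eapply near_bound; [apply dft_near; auto|apply dft_mod; auto].
    + apply dft_mod; auto.
  - replace (2 / IZR Q) with (2 * iq) by reflexivity. nra.
Qed.

Lemma prod3_near i :
  (i < 2 ^ m)%nat ->
  near Q (10 * M ^ 2 * eps) (prodz Q m f g h i)
    (dftc m (cn f) i * dftc m (cn g) i * dftc m (cn h) i).
Proof.
  intros Hi. pose proof Q_1000. destruct eps_bounds as (E0 & E1 & E2 & E3). pose proof M_ge4.
  assert (B : Cmod (dftc m (cn f) i * dftc m (cn g) i) <= M * M).
  { rewrite Cmod_mult. pose proof (dft_mod f Hf i Hi). pose proof (dft_mod g Hg i Hi).
    apply Rmult_le_compat; auto; apply Cmod_ge_0. }
  eapply near_le.
  - apply near_cmulz with (e1 := 4 * M * eps) (e2 := eps) (b1 := M * M + 4 * M * eps) (b2 := M); [lia| | | |].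
    + apply prod2_near; auto.
    + apply dft_near; auto.
    + eapply near_bound; [apply prod2_near; auto|exact B].
    + apply dft_mod; auto.
  - replace (2 / IZR Q) with (2 * iq) by reflexivity.
    assert (P0 : 0 <= M * eps) by (apply Rmult_le_pos; lra).
    assert (0 <= M * eps * (1 - eps)) by (apply Rmult_le_pos; lra).
    assert (0 <= M * eps * (M - 4)) by (apply Rmult_le_pos; lra).
    assert (0 <= eps * (M - 1)) by (apply Rmult_le_pos; lra).
    assert (0 <= M * M * eps) by (rewrite Rmult_assoc; apply Rmult_le_pos; lra).
    lra.
Qed.

Lemma prod2_comps i :
  (i < 2 ^ m)%nat ->
  let z := cmulz Q (dftz Q m (inz Q f) i) (dftz Q m (inz Q g) i) in
  (Z.abs (fst z) <= 2 * Mz ^ 2 * Q)%Z /\ (Z.abs (snd z) <= 2 * Mz ^ 2 * Q)%Z.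
Proof.
  intros Hi z. pose proof Q_1000.
  eapply near_comps; [lia|apply prod2_near; auto|].
  destruct eps_bounds as (E0 & E1 & E2 & E3). pose proof M_ge4.
  assert (B : Cmod (dftc m (cn f) i * dftc m (cn g) i) <= M * M).
  { rewrite Cmod_mult. pose proof (dft_mod f Hf i Hi). pose proof (dft_mod g Hg i Hi).
    apply Rmult_le_compat; auto; apply Cmod_ge_0. }
  change 2%Z with (Z.of_nat 2) at 2.
  rewrite mult_IZR, (Mz_pow 2). change (IZR Mz) with M. nra.
Qed.

Lemma triple_mod i :
  (i < 2 ^ m)%nat ->
  Cmod (dftc m (cn f) i * dftc m (cn g) i * dftc m (cn h) i) <= M ^ 3.
Proof.
  intros Hi. rewrite !Cmod_mult.
  pose proof (dft_mod f Hf i Hi). pose proof (dft_mod g Hg i Hi). pose proof (dft_mod h Hh i Hi).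
  replace (M ^ 3) with (M * M * M) by ring.
  repeat (apply Rmult_le_compat; auto; try apply Cmod_ge_0).
  apply Rmult_le_pos; apply Cmod_ge_0.
Qed.

(** The pointwise products carry the error 10 * M^2 * (38 * M^3 / Q) and have size at most M^3. The
    second transform multiplies the error by M^2, which gives 380 * M^7 / Q; its twiddle and
    rounding errors are of lower order and are rounded up into 420. *)
Lemma inv_near l i :
  (l <= m)%nat -> (i < 2 ^ m)%nat ->
  near Q (420 * M ^ 7 * iq) (fftz Q m (prodz Q m f g h) l i)
    (xl m (fun i => dftc m (cn f) i * dftc m (cn g) i * dftc m (cn h) i)%C l i).
Proof.
  intros Hl Hi. pose proof Q_1000 as HQ1. pose proof iq_pos. pose proof M_ge4.
  destruct eps_bounds as (E0 & E1 & E2 & E3).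
  eapply near_le.
  - apply (fftz_near Q m (prodz Q m f g h) _ (M ^ 3) (10 * M ^ 2 * eps)); auto; try lra.
    + apply Q_36.
    + apply Rmult_le_pos; auto. nra.
    + apply pow_le; lra.
    + apply prod3_near.
    + apply triple_mod.
  - rewrite M_pow. pose proof (pow4_M l Hl) as P.
    assert (0 <= 4 ^ l) by (apply pow_le; lra).
    replace (420 * M ^ 7 * iq) with (M ^ 2 * (420 * M ^ 5 * iq)) by ring.
    apply Rmult_le_compat; auto.
    + replace (10 * M ^ 2 * eps + 36 * M / IZR Q * M ^ 3 + 2 / IZR Q)
        with ((380 * M ^ 5 + 36 * M ^ 4 + 2) * iq) by (unfold eps, iq, Rdiv; ring).
      assert (0 <= M ^ 5) by (apply pow_le; lra). assert (0 <= M ^ 4) by (apply pow_le; lra).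
      apply Rmult_le_pos; lra.
    + replace (10 * M ^ 2 * eps + 36 * M / IZR Q * M ^ 3 + 2 / IZR Q)
        with ((380 * M ^ 5 + 36 * M ^ 4 + 2) * iq) by (unfold eps, iq, Rdiv; ring).
      apply Rmult_le_compat_r; [lra|].
      assert (1 <= M ^ 4) by (apply pow_R1_Rle; lra).
      assert (4 * M ^ 4 <= M ^ 5) by (replace (M ^ 5) with (M * M ^ 4) by ring; nra).
      lra.
Qed.

(** The transform is not normalised, so its exact values are multiples of [M], and an error below M
    / 2 permits exact rounding. This inequality decides how large [Q] has to be. *)
Lemma inv_eps : 420 * M ^ 7 * iq < M / 2.
Proof.
  pose proof iq_M. pose proof M_ge4.
  replace (420 * M ^ 7 * iq) with (420 * (M ^ 6 * iq) * M) by ring. nra.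
Qed.

Lemma inv_comps l i :
  (l <= m)%nat -> (i < 2 ^ m)%nat ->
  (Z.abs (fst (fftz Q m (prodz Q m f g h) l i)) <= Mz ^ 5 * Q)%Z /\
  (Z.abs (snd (fftz Q m (prodz Q m f g h) l i)) <= Mz ^ 5 * Q)%Z.
Proof.
  intros Hl Hi. pose proof Q_1000.
  eapply near_comps; [lia|apply inv_near; auto|].
  pose proof inv_eps. pose proof M_ge4. pose proof M3_ge as [H3 H4].
  assert (X : Cmod (xl m (fun i => dftc m (cn f) i * dftc m (cn g) i * dftc m (cn h) i)%C l i) <= M * M ^ 3).
  { unfold xl. apply Rle_trans with (INR (2 ^ l) * M ^ 3).
    - apply csum_mod. intros j Hj. rewrite Cmod_mult, om_pow_mod, Rmult_1_r.
      apply triple_mod.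
      assert (Em : (2 ^ m = 2 ^ l * 2 ^ (m - l))%nat) by (rewrite <- Nat.pow_add_r; f_equal; lia).
      rewrite Em in Hi |- *.
      assert ((i / 2 ^ l < 2 ^ (m - l))%nat) by (apply Nat.Div0.div_lt_upper_bound; lia).
      nia.
    - apply Rmult_le_compat_r; [lra|]. rewrite <- INR_M. apply le_INR. apply Nat.pow_le_mono_r; lia. }
  change 5%Z with (Z.of_nat 5). rewrite (Mz_pow 5). change (IZR Mz) with M.
  replace (M ^ 5) with (M * (M * M ^ 3)) by ring.
  assert (M * 64 <= M * M ^ 3) by nra. nra.
Qed.

Lemma conv_near u :
  (u < 2 ^ m)%nat ->
  let k := ((2 ^ m - u) mod 2 ^ m)%nat in
  Rabs (IZR (convz Q m f g h u) / IZR Q - M * INR (hits (2 ^ m) f g h k)) < M / 2.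
Proof.
  intros Hu k.
  assert (Hk : (k < 2 ^ m)%nat) by (apply Nat.mod_upper_bound; lia).
  pose proof (inv_near m k (le_n m) Hk) as H. pose proof inv_eps.
  rewrite xl_m, triple_dft, INR_M in H by auto. unfold near in H.
  unfold convz. fold k. unfold dftz. set (z := fftz Q m (prodz Q m f g h) m k) in *.
  set (w := (val Q z - RtoC (M * INR (hits (2 ^ m) f g h k)))%C) in H.
  pose proof (Rmax_Cmod w). pose proof (Rmax_l (Rabs (fst w)) (Rabs (snd w))).
  change (Rabs (fst w) < M / 2). lra.
Qed.

Lemma hits_spec u :
  (u < 2 ^ m)%nat ->
  let k := ((2 ^ m - u) mod 2 ^ m)%nat in
  ((exists a b c, (a < 2 ^ m)%nat /\ (b < 2 ^ m)%nat /\ (c < 2 ^ m)%nat /\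
     f a = 1%nat /\ g b = 1%nat /\ h c = 1%nat /\ ((a + b + c) mod 2 ^ m)%nat = u) ->
   (1 <= hits (2 ^ m) f g h k)%nat) /\
  (hits (2 ^ m) f g h k <> 0%nat ->
   exists a b c, (a < 2 ^ m)%nat /\ (b < 2 ^ m)%nat /\ (c < 2 ^ m)%nat /\
     f a = 1%nat /\ g b = 1%nat /\ h c = 1%nat /\ ((a + b + c) mod 2 ^ m)%nat = u).
Proof.
  intros Hu k. set (N := (2 ^ m)%nat) in *.
  assert (Hk : forall x, ((x + k) mod N = 0 <-> x mod N = u)%nat).
  { intros x. unfold k. rewrite Nat.Div0.add_mod_idemp_r, <- Nat.Div0.add_mod_idemp_l.
    pose proof (Nat.mod_upper_bound x N ltac:(lia)). set (r := (x mod N)%nat) in *.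
    split; intros H1.
    - destruct (Nat.lt_ge_cases (r + (N - u)) N).
      + rewrite Nat.mod_small in H1 by lia. lia.
      + replace (r + (N - u))%nat with (r - u + 1 * N)%nat in H1 by lia.
        rewrite Nat.Div0.mod_add, Nat.mod_small in H1 by lia. lia.
    - replace (r + (N - u))%nat with N by lia. apply Nat.Div0.mod_same. }
  split.
  - intros (a & b & c & Ha & Hb & Hc & Fa & Gb & Hc1 & E). unfold hits.
    eapply Nat.le_trans; [|apply (nsum_pos N _ a Ha)]. cbv beta.
    eapply Nat.le_trans; [|apply (nsum_pos N _ b Hb)]. cbv beta.
    eapply Nat.le_trans; [|apply (nsum_pos N _ c Hc)]. cbv beta.
    rewrite Fa, Gb, Hc1, (proj2 (Hk _) E). simpl. lia.
  - intros Hn. unfold hits in Hn.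
    assert (Ex : forall n t, nsum n t <> 0%nat -> exists i, (i < n)%nat /\ t i <> 0%nat).
    { clear. induction n; simpl; intros t H; [lia|].
      destruct (Nat.eq_dec (t n) 0) as [E|E].
      - destruct (IHn t) as (i & ? & ?); [lia|]. exists i; auto.
      - exists n; auto. }
    apply Ex in Hn as (a & Ha & Hn). apply Ex in Hn as (b & Hb & Hn).
    apply Ex in Hn as (c & Hc & Hn).
    exists a, b, c. specialize (Hf a). specialize (Hg b). specialize (Hh c).
    destruct (f a) as [|[|]]; simpl in Hn; try lia.
    destruct (g b) as [|[|]]; simpl in Hn; try lia.
    destruct (h c) as [|[|]]; simpl in Hn; try lia.
    repeat split; auto. apply Hk.
    destruct (Nat.eqb_spec ((a + b + c + k) mod N) 0); auto. simpl in Hn. lia.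
Qed.

(** Adding half a spacing puts vanishing and positive counts on different sides of M * Q and keeps
    the value nonnegative, so that a single division of natural numbers decides the matter. *)
Theorem convz_spec u :
  (u < 2 ^ m)%nat ->
  let hit := exists a b c, (a < 2 ^ m)%nat /\ (b < 2 ^ m)%nat /\ (c < 2 ^ m)%nat /\
     f a = 1%nat /\ g b = 1%nat /\ h c = 1%nat /\ ((a + b + c) mod 2 ^ m)%nat = u in
  let z := (convz Q m f g h u + Mz * (Q / 2))%Z in
  (hit -> (Mz * Q <= z)%Z) /\ (0 <= z)%Z /\ (~ hit -> (z < Mz * Q)%Z).
Proof.
  intros Hu hit z. pose proof (conv_near u Hu) as H. pose proof (hits_spec u Hu) as [S1 S2].
  cbv zeta in *. set (n := hits _ _ _ _ _) in *.
  pose proof Q_1000. pose proof M_ge4.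
  assert (HqR : 0 < IZR Q) by (apply IZR_lt; lia).
  assert (E : IZR (Q / 2) = IZR Q / 2).
  { pose proof (Z.div_mod Q 2 ltac:(lia)) as E. rewrite HQ2, Z.add_0_r in E.
    apply (f_equal IZR) in E. rewrite mult_IZR in E. lra. }
  assert (Ez : IZR z = (IZR (convz Q m f g h u) / IZR Q + M / 2) * IZR Q).
  { unfold z. rewrite plus_IZR, mult_IZR, E. change (IZR Mz) with M. field. lra. }
  apply Rabs_def2 in H as [B1 B2].
  pose proof (pos_INR n).
  repeat split.
  - intros Hh1. apply S1, le_INR in Hh1. simpl in Hh1.
    apply le_IZR. rewrite mult_IZR, Ez. change (IZR Mz) with M. apply Rmult_le_compat_r; [lra|]. nra.
  - apply le_IZR. rewrite Ez. apply Rmult_le_pos; nra.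
  - intros Hno. destruct (Nat.eq_dec n 0) as [E0|E0].
    + rewrite E0 in *. simpl in *. apply lt_IZR. rewrite mult_IZR, Ez. change (IZR Mz) with M.
      apply Rmult_lt_compat_r; lra.
    + exfalso. apply Hno, S2, E0.
Qed.

End Triple.
End Precision.

End Fourier.

(** * Machine arithmetic *)

Notation rN := 1 (only parsing).
Notation rS := 2 (only parsing).
Notation rQ := 3 (only parsing).
Notation rD := 4 (only parsing).
Notation rH := 5 (only parsing).
Notation rG := 6 (only parsing).
Notation rT := 7 (only parsing).
Notation rX0 := 8 (only parsing).
Notation rY0 := 9 (only parsing).
Notation rP := 10 (only parsing).
Notation rA := 11 (only parsing).

Definition enc (D : nat) (z : Z) : nat := Z.to_nat (z mod Z.of_nat D).

Lemma enc_lt D z : D <> 0 -> enc D z < D.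
Proof.
  intros H. unfold enc. pose proof (Z.mod_pos_bound z (Z.of_nat D)). lia.
Qed.

Lemma enc_of_nat D z : D <> 0 -> Z.of_nat (enc D z) = (z mod Z.of_nat D)%Z.
Proof.
  intros H. unfold enc. pose proof (Z.mod_pos_bound z (Z.of_nat D)). lia.
Qed.

Lemma enc_nat D k : k < D -> enc D (Z.of_nat k) = k.
Proof. intros H. unfold enc. rewrite Z.mod_small by lia. lia. Qed.

Lemma enc_opp D k : 0 < k <= D -> enc D (- Z.of_nat k) = D - k.
Proof.
  intros H. unfold enc.
  replace (- Z.of_nat k)%Z with (Z.of_nat (D - k) + (-1) * Z.of_nat D)%Z by lia.
  rewrite Z.mod_add, Z.mod_small by lia. lia.
Qed.

Lemma enc_add D x y : D <> 0 -> (enc D x + enc D y) mod D = enc D (x + y).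
Proof.
  intros H. apply Nat2Z.inj.
  rewrite Nat2Z.inj_mod, Nat2Z.inj_add, !enc_of_nat by auto.
  symmetry. apply Z.add_mod. lia.
Qed.

(* Residues modulo [D] represent the integers of [-D/2, D/2); a signed division by
   [Q] is performed on the value shifted by [D/2]. *)
Lemma enc_scale D H Q G (t : nat) z :
  Q <> 0 -> D = 2 * H -> H = Q * G -> G <= D ->
  (Z.of_nat t mod Z.of_nat D = z mod Z.of_nat D)%Z ->
  (- Z.of_nat H <= z < Z.of_nat H)%Z ->
  (((t + H) mod D) / Q + (D - G)) mod D = enc D (z / Z.of_nat Q).
Proof.
  intros HQ HD HH HG Ht Hz. apply Nat2Z.inj.
  rewrite Nat2Z.inj_mod, Nat2Z.inj_add, Nat2Z.inj_div, Nat2Z.inj_mod, Nat2Z.inj_add,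
    enc_of_nat, Nat2Z.inj_sub by lia.
  rewrite (Z.add_mod (Z.of_nat t)), Ht, <- Z.add_mod by lia.
  rewrite (Z.mod_small (z + _)) by lia.
  replace (z + Z.of_nat H)%Z with (z + Z.of_nat G * Z.of_nat Q)%Z by lia.
  rewrite Z.div_add by lia.
  replace (z / Z.of_nat Q + Z.of_nat G + (Z.of_nat D - Z.of_nat G))%Z
    with (z / Z.of_nat Q + 1 * Z.of_nat D)%Z by lia.
  now rewrite Z.mod_add by lia.
Qed.

(** The register [rG] holds D - G, where G = H / Q; adding it modulo [D] undoes the shift by [H]
    after the division by [Q]. *)
Definition fixres (e : expr) : expr :=
  Bin OMod (Bin OAdd (Bin ODiv (Bin OMod (Bin OAdd e (Var rH)) (Var rD)) (Var rQ))
                     (Var rG)) (Var rD).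

(** A truncated difference of the two products would lose the sign, so [- ci] enters as D - ci,
    which has the right residue. *)
Definition emulre (xr xi cr ci : nat) : expr :=
  fixres (Bin OAdd (Bin OMul (Var xr) (Var cr))
                   (Bin OMul (Bin OSub (Var rD) (Var ci)) (Var xi))).

Definition emulim (xr xi cr ci : nat) : expr :=
  fixres (Bin OAdd (Bin OMul (Var xr) (Var ci)) (Bin OMul (Var xi) (Var cr))).

Record num_env (D H Q G b : nat) : Prop := {
  ne_Q : Q = 2 ^ b;
  ne_b : 1 <= b;
  ne_D : D = 2 * H;
  ne_H : H = Q * G;
  ne_G : Q <= G
}.

Section Arithmetic.
Variables D H Q G b : nat.
Hypothesis NE : num_env D H Q G b.

Lemma Q_pos : 2 <= Q.
Proof.
  destruct NE. subst Q. change 2 with (2 ^ 1) at 1. apply Nat.pow_le_mono_r; lia.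
Qed.

Lemma D_big : 8 <= D /\ G <= H /\ 2 * Q <= H /\ Q < D.
Proof. pose proof Q_pos. destruct NE. nia. Qed.

Definition num_regs (s : state) : Prop :=
  vr s rQ = Q /\ vr s rD = D /\ vr s rH = H /\ vr s rG = D - G.

Definition small (B : Z) (z : Z * Z) : Prop :=
  (Z.abs (fst z) <= B)%Z /\ (Z.abs (snd z) <= B)%Z.

Lemma small_prod Bx By x y :
  small Bx x -> small By y ->
  (Z.abs (fst x * fst y - snd x * snd y) <= 2 * (Bx * By))%Z /\
  (Z.abs (fst x * snd y + snd x * fst y) <= 2 * (Bx * By))%Z.
Proof.
  intros [H1 H2] [H3 H4].
  assert (K : forall a c, (Z.abs a <= Bx)%Z -> (Z.abs c <= By)%Z -> (Z.abs (a * c) <= Bx * By)%Z).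
  { intros a c Ha Hc. rewrite Z.abs_mul. apply Z.mul_le_mono_nonneg; lia. }
  pose proof (K _ _ H1 H3) as K1. pose proof (K _ _ H2 H4) as K2.
  pose proof (K _ _ H1 H4) as K3. pose proof (K _ _ H2 H3) as K4.
  set (p1 := (fst x * fst y)%Z) in *. set (p2 := (snd x * snd y)%Z) in *.
  set (p3 := (fst x * snd y)%Z) in *. set (p4 := (snd x * fst y)%Z) in *.
  set (B := (Bx * By)%Z) in *. clearbody p1 p2 p3 p4 B. clear - K1 K2 K3 K4. lia.
Qed.

Lemma eval_emul s xr xi cr ci x y Bx By :
  num_regs s -> vr s xr = enc D (fst x) -> vr s xi = enc D (snd x) ->
  vr s cr = enc D (fst y) -> vr s ci = enc D (snd y) ->
  small Bx x -> small By y -> (2 * (Bx * By) < Z.of_nat H)%Z ->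
  eval s (emulre xr xi cr ci) = enc D (fst (cmulz (Z.of_nat Q) x y)) /\
  eval s (emulim xr xi cr ci) = enc D (snd (cmulz (Z.of_nat Q) x y)).
Proof.
  intros (RQ & RD & RH & RG) E1 E2 E3 E4 Sx Sy HB.
  pose proof (small_prod _ _ _ _ Sx Sy) as [P1 P2].
  pose proof Q_pos as HQ2. pose proof D_big as (HD & HG & _ & _).
  destruct NE. cbn [emulre emulim fixres eval opf].
  rewrite RQ, RD, RH, RG, E1, E2, E3, E4.
  pose proof (enc_lt D (snd y) ltac:(lia)).
  split; apply enc_scale; try lia; cbn [cmulz fst snd].
  - rewrite Nat2Z.inj_add, !Nat2Z.inj_mul, Nat2Z.inj_sub by lia. rewrite !enc_of_nat by lia.
    replace (fst x * fst y - snd x * snd y)%Z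
      with (fst x * fst y + (0 - snd y) * snd x)%Z by ring.
    rewrite Z.add_mod by lia. rewrite <- Z.mul_mod by lia.
    rewrite (Z.add_mod (fst x * fst y)) by lia. f_equal. f_equal.
    rewrite <- (Z.mul_mod_idemp_l (Z.of_nat D - _)) by lia.
    rewrite (Z.mul_mod_idemp_r _ (snd x)) by lia.
    rewrite <- (Z.mul_mod_idemp_l (0 - _)) by lia. f_equal. f_equal.
    rewrite Zminus_mod_idemp_r.
    replace (Z.of_nat D - snd y)%Z with (0 - snd y + 1 * Z.of_nat D)%Z by ring.
    apply Z.mod_add. lia.
  - rewrite Nat2Z.inj_add, !Nat2Z.inj_mul. rewrite !enc_of_nat by lia.
    rewrite Z.add_mod by lia. rewrite <- !Z.mul_mod by lia.
    now rewrite <- Z.add_mod by lia.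
Qed.

End Arithmetic.

Ltac wgo :=
  repeat (first [apply wp_seq | apply wp_asg | apply wp_sto];
          cbn [eval opf vr hp setv seth upd Nat.eqb]).

Ltac costs := cbn [cost_e ce length app emulre emulim fixres opi].

(** * Integer square root *)

Notation rsq := 20 (only parsing).
Notation rst := 21 (only parsing).
Notation rv := 22 (only parsing).

(** The binary digits of the root from the top: the argument is below (2 Q)^2, so Q = 2^b is the
    first candidate digit. The truncated difference in the test is nonzero exactly when the squared
    candidate is at most the argument; the second branch does nothing. *)
Definition isqrt : cmd :=
  Seq (Asg rsq (Num 0)) (Seq (Asg rst (Var rQ))
    (While (Var rst)
       (Seq (If (Bin OSub (Bin OAdd (Var rv) (Num 1))
                   (Bin OMul (Bin OAdd (Var rsq) (Var rst)) (Bin OAdd (Var rsq) (Var rst))))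
               (Asg rsq (Bin OAdd (Var rsq) (Var rst)))
               (Asg rsq (Var rsq)))
            (Asg rst (Bin ODiv (Var rst) (Num 2)))))).

Lemma isqrt_spec V b s (P : state -> nat -> Prop) :
  vr s rQ = 2 ^ b -> vr s rv < (2 * 2 ^ b) * (2 * 2 ^ b) -> 2 * 2 ^ b <= V ->
  (forall s' k, (forall r, wr isqrt r = false -> vr s' r = vr s r) ->
     (forall a, hp s' a = hp s a) ->
     vr s' rsq = Nat.sqrt (vr s rv) -> k <= 100 * (b + 1) -> P s' k) ->
  wp V isqrt s P.
Proof.
  intros HQ Hv HV HP.
  set (v := vr s rv) in *.
  eapply wp_conseq with (Q' := fun s' k =>
    (forall a, hp s' a = hp s a) /\ vr s' rsq = Nat.sqrt v /\ k <= 100 * (b + 1)).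
  2:{ intros s' k F (A1 & A2 & A3). apply HP; auto. }
  unfold isqrt. wgo; [lia|rewrite HQ; lia|].
  (* The root lies in the half-open interval from [rsq] to [rsq] + w. The third clause keeps every
     candidate at most 2 * 2^b, so that it fits below [V]. *)
  apply wp_loop with (n := b + 1) (t := fun _ => 60)
    (I := fun i s1 => let w := 2 ^ (b + 1 - i) in
       vr s1 rst = w / 2 /\ vr s1 rsq * vr s1 rsq <= v < (vr s1 rsq + w) * (vr s1 rsq + w) /\
       (i <= b -> vr s1 rsq + w <= 2 * 2 ^ b) /\ vr s1 rv = v /\ (forall a, hp s1 a = hp s a)).
  - cbn [vr hp setv upd Nat.eqb]. rewrite Nat.sub_0_r, Nat.add_1_r, Nat.pow_succ_r', HQ.
    rewrite (Nat.mul_comm 2), Nat.div_mul by lia. repeat split; auto; try (fold v; lia).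
  - intros i s1 Hi (I1 & I2 & I3 & I4 & I5) F.
    assert (E : 2 ^ (b + 1 - i) = 2 * 2 ^ (b - i)).
    { rewrite <- Nat.pow_succ_r'. f_equal. lia. }
    assert (E' : 2 ^ (b + 1 - S i) = 2 ^ (b - i)) by (f_equal; lia).
    set (w := 2 ^ (b - i)) in *.
    assert (Hw : 1 <= w) by (pose proof (Nat.pow_nonzero 2 (b - i)); lia).
    assert (Hwb : w <= 2 ^ b) by (apply Nat.pow_le_mono_r; lia).
    rewrite E in *. rewrite (Nat.mul_comm 2 w), Nat.div_mul in I1 by lia.
    specialize (I3 ltac:(lia)). destruct I2 as [I2a I2b].
    cbn [eval]. rewrite I1. split; [lia|].
    apply wp_seq. apply wp_if; cbn [eval opf]; rewrite I1, I4; intros Hc.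
    + wgo; rewrite ?I1; [lia|apply Nat.Div0.div_le_upper_bound; lia|].
      rewrite E'. split; [|cbn; lia].
      repeat split; auto; try nia.
    + wgo; rewrite ?I1; [lia|apply Nat.Div0.div_le_upper_bound; lia|].
      rewrite E'. split; [|cbn; lia].
      repeat split; auto; try nia.
  - intros s1 (I1 & _) _. cbn [eval]. rewrite I1, Nat.sub_diag. reflexivity.
  - intros s1 k (I1 & I2 & _ & _ & I5) _ Hk.
    rewrite nsum_const in Hk. split; [exact I5|]. split.
    + symmetry. apply Nat.sqrt_unique. rewrite Nat.sub_diag in I2. simpl in I2. lia.
    + cbn [cost_e ce length app] in Hk |- *.
      change (cost_e (Var rst)) with 2 in Hk. cbn. lia.
Qed.

(** * Roots of unity *)

Notation rM := 12 (only parsing).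
Notation rh := 13 (only parsing).
Notation rk := 14 (only parsing).
Notation rc := 15 (only parsing).
Notation rs := 16 (only parsing).
Notation rx := 17 (only parsing).
Notation ry := 18 (only parsing).
Notation rL := 19 (only parsing).

Notation "a [+] b" := (Bin OAdd a b) (at level 50, left associativity, only parsing).
Notation "a [-] b" := (Bin OSub a b) (at level 50, left associativity, only parsing).
Notation "a [*] b" := (Bin OMul a b) (at level 40, left associativity, only parsing).
Notation "a [/] b" := (Bin ODiv a b) (at level 40, left associativity, only parsing).
Notation "a [%] b" := (Bin OMod a b) (at level 40, left associativity, only parsing).
Notation "a ;; b" := (Seq a b) (at level 60, right associativity, only parsing).
Notation "r ::= e" := (Asg r e) (at level 55, only parsing).

(** The table is refined in place. With spacing 2h it holds the powers of the root of order M /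
    (2h); an entry at an odd multiple of h is its left neighbour times the root of order M / h. Each
    entry is computed once, so the table costs O(M) plus one square root per level. *)
Definition tw_inner : cmd :=
  rx ::= Ld (Var rT [+] Num 4 [*] Var rk [*] Var rh) ;;
  ry ::= Ld (Var rT [+] Num 4 [*] Var rk [*] Var rh [+] Num 1) ;;
  Sto (Var rT [+] (Num 4 [*] Var rk [*] Var rh [+] Num 2 [*] Var rh)) (emulre rx ry rc rs) ;;
  Sto (Var rT [+] (Num 4 [*] Var rk [*] Var rh [+] Num 2 [*] Var rh) [+] Num 1) (emulim rx ry rc rs).

Definition tw_body : cmd :=
  rL ::= Var rM [/] (Num 2 [*] Var rh) ;;
  For rk (Var rL) tw_inner ;;
  rv ::= (Var rQ [+] Var rc) [*] (Var rQ [/] Num 2) ;;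
  isqrt ;;
  rs ::= Var rs [*] (Var rQ [/] Num 2) [/] Var rsq ;;
  rc ::= Var rsq ;;
  rh ::= Var rh [/] Num 2.

(** The start is entry 0, equal to 1, and entry M / 2, equal to -1. The latter sits at offset [rM]
    because a complex number takes two cells, and -1 is encoded by D - Q. *)
Definition twiddle : cmd :=
  Sto (Var rT) (Var rQ) ;;
  Sto (Var rT [+] Num 1) (Num 0) ;;
  Sto (Var rT [+] Var rM) (Var rD [-] Var rQ) ;;
  Sto (Var rT [+] Var rM [+] Num 1) (Num 0) ;;
  rh ::= Var rM [/] Num 4 ;;
  rc ::= Num 0 ;;
  rs ::= Var rQ ;;
  While (Var rh) tw_body.

Lemma hupd_eq m r x : hupd m r x r = x.
Proof. apply upd_eq. Qed.

Lemma hupd_neq m r x y : y <> r -> hupd m r x y = m y.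
Proof. apply upd_neq. Qed.

(** [pe_H] leaves room for unreduced products: components reach M^5 * Q in the inverse transform and
    2 * Q in the table of roots, and two such products are added before the division by [Q]. *)
Record prec_env (V D H Q G b m M : nat) : Prop := {
  pe_num : num_env D H Q G b;
  pe_m : 2 <= m;
  pe_M : M = 2 ^ m;
  pe_Q : M ^ 11 <= Q;
  pe_H : 16 * M ^ 5 * (Q * Q) <= H;
  pe_V : 4 * D <= V
}.

Section Transform.
Variables V D H Q G b m M : nat.
Hypothesis PE : prec_env V D H Q G b m M.

Let NE : num_env D H Q G b := pe_num _ _ _ _ _ _ _ _ PE.
Let Qz := Z.of_nat Q.

Lemma Qz_even : (Qz mod 2 = 0)%Z.
Proof.
  unfold Qz. rewrite (ne_Q _ _ _ _ _ NE). pose proof (ne_b _ _ _ _ _ NE).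
  destruct b as [|b']; [lia|].
  rewrite Nat.pow_succ_r', Nat2Z.inj_mul, Z.mul_comm. apply Z.mod_mul. lia.
Qed.

Lemma Mz_eq : (2 ^ Z.of_nat m)%Z = Z.of_nat M.
Proof. rewrite (pe_M _ _ _ _ _ _ _ _ PE), Nat2Z.inj_pow. reflexivity. Qed.

Lemma Qz_big : ((2 ^ Z.of_nat m) ^ 11 <= Qz)%Z.
Proof.
  rewrite Mz_eq. change 11%Z with (Z.of_nat 11). rewrite <- Nat2Z.inj_pow.
  apply Nat2Z.inj_le, (pe_Q _ _ _ _ _ _ _ _ PE).
Qed.

Lemma M_4 : 4 <= M.
Proof.
  rewrite (pe_M _ _ _ _ _ _ _ _ PE). change 4 with (2 ^ 2).
  apply Nat.pow_le_mono_r; [lia|apply PE].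
Qed.

Lemma Hz_big : (16 * Z.of_nat M ^ 5 * (Qz * Qz) <= Z.of_nat H)%Z.
Proof.
  unfold Qz. pose proof (pe_H _ _ _ _ _ _ _ _ PE) as HH.
  apply Nat2Z.inj_le in HH. rewrite !Nat2Z.inj_mul, Nat2Z.inj_pow in HH. exact HH.
Qed.

Lemma M5_big : (1024 <= Z.of_nat M ^ 5)%Z.
Proof.
  pose proof M_4. change 1024%Z with (4 ^ 5)%Z. apply Z.pow_le_mono_l. lia.
Qed.

Lemma prod_ok Bx By :
  (0 <= Bx <= Z.of_nat M ^ 5 * Qz)%Z -> (0 <= By <= 2 * Qz)%Z ->
  (2 * (Bx * By) < Z.of_nat H)%Z.
Proof.
  intros H1 H2. pose proof Hz_big. pose proof M5_big.
  assert (0 < Qz)%Z by (unfold Qz; pose proof (Q_pos _ _ _ _ _ NE); lia).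
  assert (Bx * By <= (Z.of_nat M ^ 5 * Qz) * (2 * Qz))%Z by (apply Z.mul_le_mono_nonneg; lia).
  assert (0 < Z.of_nat M ^ 5 * (Qz * Qz))%Z by nia.
  lia.
Qed.

Definition carr (h : nat -> nat) (base n : nat) (f : nat -> Z * Z) : Prop :=
  forall i, i < n -> h (base + 2 * i) = enc D (fst (f i)) /\
                     h (base + 2 * i + 1) = enc D (snd (f i)).

Lemma tw_small l k : l <= m -> k < 2 ^ l -> small (2 * Qz) (twz Qz l k).
Proof.
  intros. destruct (twz_comps_le m Qz (pe_m _ _ _ _ _ _ _ _ PE) Qz_even Qz_big l k); auto.
  split; auto.
Qed.

Lemma halfz_ok l :
  (0 <= fst (halfz Qz l) <= 2 * Qz)%Z /\ (0 <= snd (halfz Qz l) <= 2 * Qz)%Z.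
Proof.
  pose proof (rootz_comps m Qz (pe_m _ _ _ _ _ _ _ _ PE) Qz_even Qz_big (S (S l))) as [H1 H2].
  cbn [rootz] in H1, H2.
  destruct (halfz_near Qz l) as (_ & _ & H3 & H4).
  - apply (Q_1000 m Qz (pe_m _ _ _ _ _ _ _ _ PE) Qz_big).
  - apply Qz_even.
  - lia.
Qed.

Lemma twz_even l k : twz Qz (S l) (2 * k) = twz Qz l k.
Proof.
  cbn [twz]. replace (Nat.even (2 * k)) with true
    by (symmetry; apply Nat.even_spec; exists k; lia).
  now rewrite Nat.mul_comm, Nat.div_mul by lia.
Qed.

Lemma twz_odd l k :
  twz Qz (S l) (2 * k + 1) = cmulz Qz (twz Qz l k) (rootz Qz (S l)).
Proof.
  cbn [twz]. replace (Nat.even (2 * k + 1)) with false.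
  - replace ((2 * k + 1) / 2) with k; auto.
    rewrite Nat.mul_comm, Nat.div_add_l by lia. simpl. lia.
  - symmetry. rewrite <- Nat.negb_odd. apply negb_false_iff, Nat.odd_spec. exists k; lia.
Qed.

Lemma tw_body_spec s T0 i (P : state -> nat -> Prop) :
  num_regs D H Q G s -> vr s rT = T0 -> vr s rM = M -> i < m - 1 ->
  vr s rh = 2 ^ (m - 1 - i) / 2 ->
  vr s rc = Z.to_nat (fst (halfz Qz i)) -> vr s rs = Z.to_nat (snd (halfz Qz i)) ->
  (forall k, k < 2 ^ S i ->
     hp s (T0 + 2 * (k * 2 ^ (m - S i))) = enc D (fst (twz Qz (S i) k)) /\
     hp s (T0 + 2 * (k * 2 ^ (m - S i)) + 1) = enc D (snd (twz Qz (S i) k))) ->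
  (forall s' t, t <= 200 * 2 ^ S i + 100 * (b + 1) + 200 ->
     vr s' rh = 2 ^ (m - 1 - S i) / 2 ->
     vr s' rc = Z.to_nat (fst (halfz Qz (S i))) ->
     vr s' rs = Z.to_nat (snd (halfz Qz (S i))) ->
     (forall k, k < 2 ^ S (S i) ->
       hp s' (T0 + 2 * (k * 2 ^ (m - S (S i)))) = enc D (fst (twz Qz (S (S i)) k)) /\
       hp s' (T0 + 2 * (k * 2 ^ (m - S (S i))) + 1) = enc D (snd (twz Qz (S (S i)) k))) ->
     (forall a, a < T0 \/ T0 + 2 * M <= a -> hp s' a = hp s a) -> P s' t) ->
  wp V tw_body s P.
Proof.
  intros NR ET EM Hi Eh Ec Es IT HP.
  pose proof (pe_m _ _ _ _ _ _ _ _ PE) as Hm.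
  pose proof (pe_M _ _ _ _ _ _ _ _ PE) as HM.
  pose proof (pe_V _ _ _ _ _ _ _ _ PE) as HV.
  pose proof (D_big _ _ _ _ _ NE) as (HD8 & HGH & HQH & HQD).
  pose proof (Q_pos _ _ _ _ _ NE) as HQ2. pose proof (ne_D _ _ _ _ _ NE) as HDH.
  pose proof (halfz_ok i) as [Hc Hs]. pose proof (halfz_ok (S i)) as [Hc' Hs'].
  set (h := 2 ^ (m - S (S i))).
  assert (E1 : 2 ^ (m - 1 - i) = 2 * h)
    by (unfold h; rewrite <- Nat.pow_succ_r'; f_equal; lia).
  assert (E2 : 2 ^ (m - S i) = 2 * h)
    by (unfold h; rewrite <- Nat.pow_succ_r'; f_equal; lia).
  assert (E3 : M = 2 ^ S i * (2 * h)).
  { rewrite HM, <- E2, <- Nat.pow_add_r. f_equal. lia. }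
  assert (Hh : 1 <= h) by (unfold h; pose proof (Nat.pow_nonzero 2 (m - S (S i))); lia).
  set (L := 2 ^ S i) in *.
  rewrite E1, (Nat.mul_comm 2 h), Nat.div_mul in Eh by lia.
  rewrite E2 in IT.
  assert (HL : 1 <= L) by (unfold L; pose proof (Nat.pow_nonzero 2 (S i)); lia).
  assert (HhM : 2 * h <= M /\ L <= M).
  { rewrite E3. split; [rewrite <- (Nat.mul_1_l (2 * h)) at 1; apply Nat.mul_le_mono_r; lia|].
    rewrite <- (Nat.mul_1_r L) at 1. apply Nat.mul_le_mono_l; lia. }
  assert (HMV : M <= V).
  { pose proof (pe_Q _ _ _ _ _ _ _ _ PE). pose proof M_4.
    assert (M ^ 1 <= M ^ 11) by (apply Nat.pow_le_mono_r; lia). rewrite Nat.pow_1_r in *. lia. }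
  unfold tw_body. apply wp_seq, wp_asg.
  { cbn [eval opf]. rewrite EM. etransitivity; [|exact HMV].
    etransitivity; [apply Nat.Div0.div_le_upper_bound with (q := M)|lia].
    rewrite Eh. rewrite <- (Nat.mul_1_l M) at 1. apply Nat.mul_le_mono_r; lia. }
  assert (EL : eval s (Bin ODiv (Var rM) (Bin OMul (Num 2) (Var rh))) = L).
  { cbn [eval opf]. rewrite EM, Eh, E3. apply Nat.div_mul. lia. }
  rewrite EL. set (s0 := setv s rL L).
  apply wp_seq.
  apply wp_for with (n := L) (t := fun _ => 150)
    (I := fun k hh =>
      (forall a, a < T0 \/ T0 + 2 * M <= a -> hh a = hp s a) /\
      (forall j, j < L -> hh (T0 + 2 * (j * (2 * h))) = enc D (fst (twz Qz (S i) j)) /\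
         hh (T0 + 2 * (j * (2 * h)) + 1) = enc D (snd (twz Qz (S i) j))) /\
      (forall j, j < k -> hh (T0 + 2 * ((2 * j + 1) * h)) = enc D (fst (twz Qz (S (S i)) (2 * j + 1))) /\
         hh (T0 + 2 * ((2 * j + 1) * h) + 1) = enc D (snd (twz Qz (S (S i)) (2 * j + 1))))).
  - reflexivity.
  - lia.
  - intros s1 j _ F _ _. cbn [eval]. rewrite (F rL) by reflexivity. reflexivity.
  - split; [auto|]. split; [exact IT|]. intros; lia.
  - intros k s1 Hk Ek F (I1 & I2 & I3).
    assert (FT : vr s1 rT = T0) by (rewrite F by reflexivity; exact ET).
    assert (Fh : vr s1 rh = h) by (rewrite F by reflexivity; exact Eh).
    assert (Fc : vr s1 rc = Z.to_nat (fst (halfz Qz i))) by (rewrite F by reflexivity; exact Ec).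
    assert (Fs : vr s1 rs = Z.to_nat (snd (halfz Qz i))) by (rewrite F by reflexivity; exact Es).
    assert (NR1 : num_regs D H Q G s1).
    { destruct NR as (A1 & A2 & A3 & A4). repeat split; rewrite F by reflexivity; assumption. }
    destruct (I2 k Hk) as [J1 J2].
    assert (A1 : T0 + 4 * k * h = T0 + 2 * (k * (2 * h))) by lia.
    assert (X1 : hp s1 (T0 + 4 * k * h) = enc D (fst (twz Qz (S i) k))) by (rewrite A1; exact J1).
    assert (X2 : hp s1 (T0 + 4 * k * h + 1) = enc D (snd (twz Qz (S i) k))) by (rewrite A1; exact J2).
    pose proof (enc_lt D (fst (twz Qz (S i) k)) ltac:(lia)).
    pose proof (enc_lt D (snd (twz Qz (S i) k)) ltac:(lia)).
    unfold tw_inner.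
    apply wp_seq, wp_asg; [cbn [eval opf]; rewrite FT, Ek, Fh, X1; lia|].
    cbn [eval opf]. rewrite FT, Ek, Fh, X1.
    apply wp_seq, wp_asg; [cbn [eval opf vr hp setv upd Nat.eqb]; rewrite FT, Ek, Fh, X2; lia|].
    cbn [eval opf vr hp setv upd Nat.eqb]. rewrite FT, Ek, Fh, X2.
    match goal with |- wp _ _ ?st _ => set (s2 := st) end.
    assert (Enc : forall z, (0 <= z <= 2 * Qz)%Z -> Z.to_nat z = enc D z).
    { intros z Hz. unfold enc. rewrite Z.mod_small; auto. unfold Qz in Hz. lia. }
    assert (EV : forall s3, (forall r, vr s3 r = vr s2 r) ->
       eval s3 (emulre rx ry rc rs) = enc D (fst (twz Qz (S (S i)) (2 * k + 1))) /\
       eval s3 (emulim rx ry rc rs) = enc D (snd (twz Qz (S (S i)) (2 * k + 1)))).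
    { intros s3 F3. rewrite twz_odd. cbn [rootz].
      apply (eval_emul D H Q G b NE) with (Bx := (2 * Qz)%Z) (By := (2 * Qz)%Z).
      - destruct NR1 as (N1 & N2 & N3 & N4). repeat split; rewrite F3; assumption.
      - rewrite F3; reflexivity.
      - rewrite F3; reflexivity.
      - rewrite F3. rewrite <- Enc by auto. exact Fc.
      - rewrite F3. rewrite <- Enc by auto. exact Fs.
      - apply tw_small; [lia|exact Hk].
      - split; lia.
      - apply prod_ok; [|unfold Qz; lia]. pose proof M5_big. assert (0 <= Qz)%Z by (unfold Qz; lia).
        split; [lia|apply Z.mul_le_mono_nonneg_r; lia]. }
    destruct (EV s2 (fun _ => eq_refl)) as [EV1 _].
    pose proof (enc_lt D (fst (twz Qz (S (S i)) (2 * k + 1))) ltac:(lia)).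
    pose proof (enc_lt D (snd (twz Qz (S (S i)) (2 * k + 1))) ltac:(lia)).
    apply wp_seq, wp_sto; [rewrite EV1; lia|].
    rewrite EV1.
    match goal with |- wp _ _ ?st _ => set (s3 := st) end.
    destruct (EV s3 (fun _ => eq_refl)) as [_ EV2].
    apply wp_sto; [rewrite EV2; lia|]. rewrite EV2.
    assert (B1 : eval s2 (Var rT [+] (Num 4 [*] Var rk [*] Var rh [+] Num 2 [*] Var rh))
             = T0 + 2 * ((2 * k + 1) * h)).
    { unfold s2. cbn [eval opf vr setv upd Nat.eqb]. rewrite FT, Ek, Fh. lia. }
    assert (B2 : eval s3 (Var rT [+] (Num 4 [*] Var rk [*] Var rh [+] Num 2 [*] Var rh) [+] Num 1)
             = T0 + 2 * ((2 * k + 1) * h) + 1).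
    { unfold s3, s2. cbn [eval opf vr seth setv upd Nat.eqb]. rewrite FT, Ek, Fh. lia. }
    assert (Hs3 : hp s3 = hupd (hp s1) (T0 + 2 * ((2 * k + 1) * h))
                            (enc D (fst (twz Qz (S (S i)) (2 * k + 1))))).
    { unfold s3. cbn [hp seth]. rewrite B1. reflexivity. }
    rewrite B2. cbn [hp seth]. rewrite Hs3.
    assert (K1 : (2 * k + 1) * h < M).
    { assert ((2 * k + 2) * h <= (2 * L) * h) by (apply Nat.mul_le_mono_r; lia). lia. }
    split; [|costs; lia].
    split; [|split].
    + intros a Ha. rewrite !hupd_neq by lia. auto.
    + intros j Hj. destruct (I2 j Hj) as [Y1 Y2].
      assert (j * (2 * h) <> (2 * k + 1) * h).
      { replace (j * (2 * h)) with ((2 * j) * h) by lia. intros E.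
        apply Nat.mul_cancel_r in E; lia. }
      rewrite !hupd_neq by lia. auto.
    + intros j Hj. destruct (Nat.eq_dec j k) as [->|Hjk].
      * rewrite hupd_eq, hupd_neq, hupd_eq by lia. auto.
      * assert ((2 * j + 1) * h <> (2 * k + 1) * h).
        { intros E. apply Nat.mul_cancel_r in E; lia. }
        rewrite !hupd_neq by lia. apply I3. lia.
  - intros s1 t (I1 & I2 & I3) F Ek Ht. cbv beta.
    rewrite nsum_const in Ht. change (cost_e (Var rL)) with 2 in Ht.
    destruct NR as (A1 & A2 & A3 & A4).
    assert (FQ : vr s1 rQ = Q) by (rewrite F by reflexivity; exact A1).
    assert (Fc : vr s1 rc = Z.to_nat (fst (halfz Qz i))) by (rewrite F by reflexivity; exact Ec).
    assert (Fs : vr s1 rs = Z.to_nat (snd (halfz Qz i))) by (rewrite F by reflexivity; exact Es).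
    assert (Fh : vr s1 rh = h) by (rewrite F by reflexivity; exact Eh).
    set (v := (Q + Z.to_nat (fst (halfz Qz i))) * (Q / 2)).
    assert (HQQ : Q * Q <= H).
    { pose proof (pe_H _ _ _ _ _ _ _ _ PE). pose proof M_4.
      assert (1 <= M ^ 5) by (pose proof (Nat.pow_nonzero M 5); lia).
      assert (1 * (Q * Q) <= M ^ 5 * (Q * Q)) by (apply Nat.mul_le_mono_r; lia). lia. }
    assert (HQ2e : Q = 2 * (Q / 2)).
    { pose proof Qz_even as E. unfold Qz in E. pose proof (Nat.div_mod_eq Q 2).
      change 2%Z with (Z.of_nat 2) in E. rewrite <- Nat2Z.inj_mod in E. lia. }
    assert (Hv : v <= 2 * (Q * Q)).
    { unfold v. assert (Z.to_nat (fst (halfz Qz i)) <= 2 * Q) by (unfold Qz in *; lia).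
      apply Nat.le_trans with ((3 * Q) * (Q / 2)); [apply Nat.mul_le_mono_r; lia|].
      apply Nat.le_trans with ((3 * Q) * (Q / 2) + Q * (Q / 2)); [lia|].
      assert (E4 : Q * (2 * (Q / 2)) = Q * Q) by (now rewrite <- HQ2e). lia. }
    assert (Hsq : Z.to_nat (fst (halfz Qz (S i))) = Nat.sqrt v).
    { cbn [halfz fst].
      assert (Ev : ((Qz + fst (halfz Qz i)) * (Qz / 2))%Z = Z.of_nat v).
      { unfold v, Qz. rewrite Nat2Z.inj_mul, Nat2Z.inj_add, Nat2Z.inj_div, Z2Nat.id by (unfold Qz in *; lia).
        reflexivity. }
      rewrite Ev. symmetry. apply Nat.sqrt_unique.
      fold v. pose proof (Z.sqrt_spec (Z.of_nat v) ltac:(lia)) as [S1 S2].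
      pose proof (Z.sqrt_nonneg (Z.of_nat v)) as S0.
      destruct (Z_of_nat_complete _ S0) as [r Er]. rewrite Er in *. rewrite Nat2Z.id. lia. }
    assert (Hsn : Z.to_nat (snd (halfz Qz (S i))) =
                  Z.to_nat (snd (halfz Qz i)) * (Q / 2) / Nat.sqrt v).
    { rewrite <- Hsq. apply Nat2Z.inj.
      rewrite Nat2Z.inj_div, Nat2Z.inj_mul, Nat2Z.inj_div, !Z2Nat.id by lia.
      reflexivity. }
    apply wp_seq, wp_asg.
    { cbn [eval opf]. rewrite FQ, Fc. fold v. lia. }
    cbn [eval opf]. rewrite FQ, Fc. fold v.
    apply wp_seq.
    apply isqrt_spec with (b := b).
    { cbn [vr setv upd Nat.eqb]. rewrite FQ. apply NE. }
    { cbn [vr setv upd Nat.eqb]. rewrite <- (ne_Q _ _ _ _ _ NE). lia. }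
    { rewrite <- (ne_Q _ _ _ _ _ NE). lia. }
    cbn [vr hp setv upd Nat.eqb].
    intros s2 t2 F2 H2 E2' Ht2.
    assert (GQ : vr s2 rQ = Q) by (rewrite F2 by reflexivity; exact FQ).
    assert (Gs : vr s2 rs = Z.to_nat (snd (halfz Qz i))) by (rewrite F2 by reflexivity; exact Fs).
    assert (Gh : vr s2 rh = h) by (rewrite F2 by reflexivity; exact Fh).
    assert (EQz : Qz = Z.of_nat Q) by reflexivity.
    assert (P1 : Z.to_nat (fst (halfz Qz (S i))) <= V) by lia.
    assert (P2 : Z.to_nat (snd (halfz Qz (S i))) <= V) by lia.
    unfold v in E2'. wgo.
    + rewrite Gs, GQ, E2'. fold v. rewrite <- Hsn. exact P2.
    + rewrite E2'. fold v. rewrite <- Hsq. exact P1.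
    + rewrite Gh. apply Nat.Div0.div_le_upper_bound. lia.
    + apply HP; cbn [vr hp setv upd Nat.eqb].
      * costs. clearbody L. clear - Ht Ht2. lia.
      * rewrite Gh. unfold h. do 2 f_equal. lia.
      * rewrite E2'. fold v. auto.
      * rewrite Gs, GQ, E2'. fold v. auto.
      * fold h. intros k Hk. rewrite !H2.
        destruct (Nat.Even_or_Odd k) as [[j ->]|[j ->]].
        -- rewrite twz_even. replace (2 * j * h) with (j * (2 * h)) by lia.
           apply I2. unfold L. rewrite (Nat.pow_succ_r' 2 (S i)) in Hk. lia.
        -- apply I3. unfold L. rewrite (Nat.pow_succ_r' 2 (S i)) in Hk. lia.
      * intros a Ha. rewrite H2. auto.
Qed.
End Transform.

(** * Transform routines *)

Notation rX := 23 (only parsing).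
Notation rY := 24 (only parsing).
Notation rw := 25 (only parsing).
Notation rj := 26 (only parsing).
Notation ra := 27 (only parsing).
Notation rb := 28 (only parsing).
Notation rsl := 29 (only parsing).
Notation rln := 30 (only parsing).

(** The first value of [rj] is [fidx], with [rh] the power 2^l. The partner entry is M / 2 further
    on, that is [rM] cells. The second value of [rj] is the index of the twiddle factor, [rw] being
    M / (2 * rh). *)
Definition fft_inner : cmd :=
  rj ::= Var rk [/] (Num 2 [*] Var rh) [*] Var rh [+] Var rk [%] Var rh ;;
  ra ::= Ld (Var rX [+] Num 2 [*] Var rj) ;;
  rb ::= Ld (Var rX [+] Num 2 [*] Var rj [+] Num 1) ;;
  rx ::= Ld (Var rX [+] Num 2 [*] Var rj [+] Var rM) ;;
  ry ::= Ld (Var rX [+] Num 2 [*] Var rj [+] Var rM [+] Num 1) ;;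
  rj ::= Var rk [%] (Num 2 [*] Var rh) [*] Var rw ;;
  rc ::= Ld (Var rT [+] Num 2 [*] Var rj) ;;
  rs ::= Ld (Var rT [+] Num 2 [*] Var rj [+] Num 1) ;;
  Sto (Var rY [+] Num 2 [*] Var rk) ((Var ra [+] emulre rc rs rx ry) [%] Var rD) ;;
  Sto (Var rY [+] Num 2 [*] Var rk [+] Num 1) ((Var rb [+] emulim rc rs rx ry) [%] Var rD).

Definition fft_body : cmd :=
  rw ::= Var rM [/] (Num 2 [*] Var rh) ;;
  For rk (Var rM) fft_inner ;;
  rj ::= Var rX ;;
  rX ::= Var rY ;;
  rY ::= Var rj ;;
  rh ::= Num 2 [*] Var rh.

Definition fft : cmd := rh ::= Num 1 ;; While (Var rM [-] Var rh) fft_body.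

(** The factor 1 - (1 - (rln - rk)) is 1 for rk < rln and 0 otherwise: zero padding without a
    branch, whatever the cells beyond the window contain. *)
Definition load : cmd :=
  For rk (Var rM)
    (Sto (Var rX [+] Num 2 [*] Var rk)
       (Var rQ [*] (Ld (Var rsl [+] Var rk) [*] (Num 1 [-] (Num 1 [-] (Var rln [-] Var rk))))) ;;
     Sto (Var rX [+] Num 2 [*] Var rk [+] Num 1) (Num 0)).

Definition copyc (dst src : nat) : cmd :=
  For rk (Var rM)
    (Sto (Var dst [+] Num 2 [*] Var rk) (Ld (Var src [+] Num 2 [*] Var rk)) ;;
     Sto (Var dst [+] Num 2 [*] Var rk [+] Num 1) (Ld (Var src [+] Num 2 [*] Var rk [+] Num 1))).

Definition mulc : cmd :=
  For rk (Var rM)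
    (rx ::= Ld (Var rP [+] Num 2 [*] Var rk) ;;
     ry ::= Ld (Var rP [+] Num 2 [*] Var rk [+] Num 1) ;;
     rc ::= Ld (Var rX [+] Num 2 [*] Var rk) ;;
     rs ::= Ld (Var rX [+] Num 2 [*] Var rk [+] Num 1) ;;
     Sto (Var rP [+] Num 2 [*] Var rk) (emulre rx ry rc rs) ;;
     Sto (Var rP [+] Num 2 [*] Var rk [+] Num 1) (emulim rx ry rc rs)).

Definition disj (x y n : nat) : Prop := x + n <= y \/ y + n <= x.

Lemma carr_ext D h h' base n f :
  (forall a, base <= a < base + 2 * n -> h' a = h a) -> carr D h base n f -> carr D h' base n f.
Proof. intros E C i Hi. rewrite !E by lia. auto. Qed.

Section Fill.
Variables V D : nat.

Lemma wp_fillc ri e body n base (f : nat -> Z * Z) tb s (P : state -> nat -> Prop) :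
  wr body ri = false -> n <= V ->
  (forall s1, fr body ri s s1 -> eval s1 e = n) ->
  (forall i s1, i < n -> vr s1 ri = i -> fr body ri s s1 ->
     (forall a, a < base \/ base + 2 * n <= a -> hp s1 a = hp s a) ->
     wp V body s1 (fun s2 t => t <= tb /\
       hp s2 (base + 2 * i) = enc D (fst (f i)) /\ hp s2 (base + 2 * i + 1) = enc D (snd (f i)) /\
       (forall a, a <> base + 2 * i -> a <> base + 2 * i + 1 -> hp s2 a = hp s1 a))) ->
  (forall s1 t, fr body ri s s1 -> carr D (hp s1) base n f ->
     (forall a, a < base \/ base + 2 * n <= a -> hp s1 a = hp s a) ->
     t <= n * (tb + cost_e e + 12) + cost_e e + 12 -> P s1 t) ->
  wp V (For ri e body) s P.
Proof.
  intros Hri HnV He Hb HP.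
  apply wp_fill with (n := n) (k := 2) (base := base) (tb := tb)
    (val := fun j => if Nat.even j then enc D (fst (f (j / 2))) else enc D (snd (f (j / 2)))); auto.
  - intros i s1 Hi Hv Hf _ Ho.
    eapply wp_conseq; [apply (Hb i); auto|].
    { intros a Ha. apply Ho. lia. }
    intros s2 t _ (Ht & E1 & E2 & E3). split; [exact Ht|]. split.
    + intros j Hj. assert (j = 2 * i \/ j = 2 * i + 1) as [-> | ->] by lia.
      * rewrite Nat.even_mul. cbn [Nat.even orb]. rewrite Nat.mul_comm, Nat.div_mul, Nat.mul_comm by lia.
        exact E1.
      * replace (Nat.even (2 * i + 1)) with false.
        -- replace ((2 * i + 1) / 2) with i; [rewrite Nat.add_assoc; exact E2|].
           rewrite Nat.mul_comm, Nat.div_add_l by lia. simpl. lia.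
        -- symmetry. rewrite <- Nat.negb_odd. apply negb_false_iff, Nat.odd_spec. exists i; lia.
    + intros a Ha. apply E3; lia.
  - intros s1 t Hf E1 E2 Ht. apply HP; auto.
    intros i Hi. split.
    + rewrite E1 by lia. rewrite Nat.even_mul. cbn [Nat.even orb].
      now rewrite Nat.mul_comm, Nat.div_mul by lia.
    + rewrite <- Nat.add_assoc, E1 by lia.
      replace (Nat.even (2 * i + 1)) with false.
      * replace ((2 * i + 1) / 2) with i; auto.
        rewrite Nat.mul_comm, Nat.div_add_l by lia. simpl. lia.
      * symmetry. rewrite <- Nat.negb_odd. apply negb_false_iff, Nat.odd_spec. exists i; lia.
Qed.
End Fill.

Section Transform2.
Variables V D H Q G b m M : nat.
Hypothesis PE : prec_env V D H Q G b m M.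

Let NE : num_env D H Q G b := pe_num _ _ _ _ _ _ _ _ PE.
Let Qz := Z.of_nat Q.
Let R := (Z.of_nat M ^ 5 * Qz)%Z.

Lemma env_facts :
  M = 2 ^ m /\ 2 <= m /\ 4 <= M /\ M <= Q /\ 2 <= Q /\ 4 * D <= V /\ D = 2 * H /\ 2 * Q <= H.
Proof.
  pose proof (pe_Q _ _ _ _ _ _ _ _ PE). pose proof (M_4 _ _ _ _ _ _ _ _ PE) as H4.
  assert (M ^ 1 <= M ^ 11) by (apply Nat.pow_le_mono_r; lia). rewrite Nat.pow_1_r in *.
  pose proof (D_big _ _ _ _ _ NE) as (HD8 & HGH & HQH & HQD).
  pose proof (Q_pos _ _ _ _ _ NE). destruct PE. pose proof (ne_D _ _ _ _ _ NE). repeat split; auto; lia.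
Qed.

Lemma twiddle_spec s T0 (P : state -> nat -> Prop) :
  num_regs D H Q G s -> vr s rT = T0 -> vr s rM = M ->
  (forall s' t, (forall r, wr twiddle r = false -> vr s' r = vr s r) ->
     t <= 400 * M + m * (100 * b + 400) + 200 ->
     carr D (hp s') T0 M (twz Qz m) ->
     (forall a, a < T0 \/ T0 + 2 * M <= a -> hp s' a = hp s a) -> P s' t) ->
  wp V twiddle s P.
Proof.
  intros NR ET EM HP.
  pose proof env_facts as (HM & Hm & HM4 & HMQ & HQ2 & HV & HDH & HQH).
  destruct NR as (N1 & N2 & N3 & N4).
  eapply wp_conseq with (Q' := fun s' t => t <= 400 * M + m * (100 * b + 400) + 200 /\
     carr D (hp s') T0 M (twz Qz m) /\
     (forall a, a < T0 \/ T0 + 2 * M <= a -> hp s' a = hp s a)).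
  2:{ intros s' t F (A1 & A2 & A3). apply HP; auto. }
  unfold twiddle. wgo; rewrite ?ET, ?EM, ?N1, ?N2; try lia.
  { etransitivity; [apply Nat.Div0.div_le_upper_bound with (q := M)|]; lia. }
  match goal with |- wp _ _ ?st _ => set (s0 := st) end.
  (* The passes fill 2, 4, ..., 2^(m-1) new entries, a geometric series; the m * b term of the bound
     pays for the square roots. *)
  apply wp_loop with (n := m - 1)
    (t := fun i => 200 * 2 ^ S i + 100 * (b + 1) + 200)
    (I := fun i s1 =>
      vr s1 rh = 2 ^ (m - 1 - i) / 2 /\
      vr s1 rc = Z.to_nat (fst (halfz Qz i)) /\ vr s1 rs = Z.to_nat (snd (halfz Qz i)) /\
      (forall k, k < 2 ^ S i ->
        hp s1 (T0 + 2 * (k * 2 ^ (m - S i))) = enc D (fst (twz Qz (S i) k)) /\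
        hp s1 (T0 + 2 * (k * 2 ^ (m - S i)) + 1) = enc D (snd (twz Qz (S i) k))) /\
      (forall a, a < T0 \/ T0 + 2 * M <= a -> hp s1 a = hp s a)).
  - unfold s0. cbn [vr hp setv seth upd Nat.eqb]. repeat split.
    + rewrite HM, Nat.sub_0_r. replace m with (S (S (m - 2))) at 1 by lia.
      replace (m - 1) with (S (m - 2)) by lia. rewrite !Nat.pow_succ_r'.
      rewrite (Nat.mul_comm 2 (2 ^ (m - 2))), Nat.div_mul by lia.
      replace (2 * (2 ^ (m - 2) * 2)) with (2 ^ (m - 2) * 4) by lia. apply Nat.div_mul. lia.
    + cbn [halfz snd]. unfold Qz. now rewrite Nat2Z.id.
    + assert (E : 2 * 2 ^ (m - 1) = M)
        by (rewrite HM, <- Nat.pow_succ_r'; f_equal; lia).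
      rewrite Nat.pow_1_r in H0.
      assert (k = 0 \/ k = 1) as [-> | ->] by lia.
      * rewrite Nat.mul_0_l, Nat.mul_0_r, Nat.add_0_r. rewrite !hupd_neq, hupd_eq by lia.
        cbn [twz Nat.even fst]. symmetry. apply enc_nat. lia.
      * rewrite Nat.mul_1_l, E. rewrite !hupd_neq, hupd_eq by lia.
        cbn [twz Nat.even rootz cmulz fst snd].
        rewrite Z.mul_0_l, Z.sub_0_r, Z.mul_comm, Z.div_mul by (unfold Qz; lia).
        symmetry. apply enc_opp. lia.
    + assert (E : 2 * 2 ^ (m - 1) = M)
        by (rewrite HM, <- Nat.pow_succ_r'; f_equal; lia).
      rewrite Nat.pow_1_r in H0.
      assert (k = 0 \/ k = 1) as [-> | ->] by lia.
      * rewrite Nat.mul_0_l, Nat.mul_0_r, Nat.add_0_r. rewrite !hupd_neq, hupd_eq by lia.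
        cbn [twz Nat.even snd]. symmetry. apply (enc_nat D 0). lia.
      * rewrite Nat.mul_1_l, E. rewrite hupd_eq by lia.
        cbn [twz Nat.even rootz cmulz fst snd].
        rewrite Z.mul_0_l, Z.mul_0_r, Z.add_0_l, Z.div_0_l by (unfold Qz; lia).
        symmetry. apply (enc_nat D 0). lia.
    + intros a Ha. rewrite !hupd_neq by lia. reflexivity.
  - intros i s1 Hi (I1 & I2 & I3 & I4 & I5) F. split.
    + cbn [eval]. rewrite I1. replace (m - 1 - i) with (S (m - 2 - i)) by lia.
      rewrite Nat.pow_succ_r', Nat.mul_comm, Nat.div_mul by lia. apply Nat.pow_nonzero. lia.
    + assert (F' : forall r, wr tw_body r = false -> r =? rh = false -> r =? rc = false ->
        r =? rs = false -> vr s1 r = vr s r).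
      { intros r R1 R2 R3 R4. rewrite F by auto. unfold s0. cbn [vr setv seth].
        unfold upd. now rewrite R2, R3, R4. }
      apply (tw_body_spec V D H Q G b m M PE s1 T0 i); auto.
      * repeat split; rewrite F' by reflexivity; assumption.
      * rewrite F' by reflexivity; assumption.
      * rewrite F' by reflexivity; assumption.
      * intros s' t Ht J1 J2 J3 J4 J5. repeat split; auto; try apply J4; auto.
        intros a Ha. rewrite J5, I5 by auto. reflexivity.
  - intros s1 (I1 & _) _. cbn [eval]. rewrite I1, Nat.sub_diag. reflexivity.
  - intros s1 t (I1 & I2 & I3 & I4 & I5) _ Ht. split; [|split].
    + change (cost_e (Var rh)) with 2 in Ht.
      assert (Es : nsum (m - 1) (fun i => 200 * 2 ^ S i + 100 * (b + 1) + 200) + 400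
              = 400 * 2 ^ (m - 1) + (m - 1) * (100 * (b + 1) + 200)).
      { clear. induction (m - 1) as [|n IH]; [reflexivity|].
        cbn [nsum]. rewrite (Nat.pow_succ_r' 2 n). lia. }
      assert (E : 2 * 2 ^ (m - 1) = M)
        by (rewrite HM, <- Nat.pow_succ_r'; f_equal; lia).
      assert (Em : m = (m - 1) + 1) by lia. revert Ht.
      costs. set (S1 := nsum _ _) in *. clearbody S1. set (u := m - 1) in *. rewrite Em. clearbody u.
      rewrite !Nat.mul_add_distr_r, !Nat.mul_add_distr_l in *. lia.
    + intros k Hk. replace (S (m - 1)) with m in I4 by lia.
      destruct (I4 k) as [J1 J2]; [lia|].
      rewrite Nat.sub_diag, Nat.mul_1_r in J1, J2. auto.
    + exact I5.
Qed.

Lemma fft_body_spec s T0 XB YB l F (P : state -> nat -> Prop) :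
  num_regs D H Q G s -> vr s rT = T0 -> vr s rM = M -> vr s rX = XB -> vr s rY = YB ->
  vr s rh = 2 ^ l -> l < m -> XB <= V -> YB <= V ->
  disj T0 YB (2 * M) -> disj XB YB (2 * M) ->
  carr D (hp s) T0 M (twz Qz m) -> carr D (hp s) XB M F ->
  (forall i, i < M -> small R (F i)) ->
  (forall s' t, t <= 300 * M + 200 ->
     vr s' rX = YB -> vr s' rY = XB -> vr s' rh = 2 ^ S l ->
     carr D (hp s') YB M (fun i => caddz (F (fidx l i))
        (cmulz Qz (twz Qz m (i mod 2 ^ S l * 2 ^ (m - S l))) (F (fidx l i + 2 ^ (m - 1))))) ->
     (forall a, a < YB \/ YB + 2 * M <= a -> hp s' a = hp s a) -> P s' t) ->
  wp V fft_body s P.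
Proof.
  intros NR ET EM EX EY Eh Hl HXV HYV D1 D2 CT CX HR HP.
  pose proof env_facts as (HM & Hm & HM4 & HMQ & HQ2 & HV & HDH & HQH).
  set (h := 2 ^ l) in *.
  assert (Hh : 1 <= h) by (unfold h; pose proof (Nat.pow_nonzero 2 l); lia).
  assert (E1 : 2 ^ S l = 2 * h) by apply Nat.pow_succ_r'.
  set (w := 2 ^ (m - S l)) in *.
  assert (Hw : 1 <= w) by (unfold w; pose proof (Nat.pow_nonzero 2 (m - S l)); lia).
  assert (E2 : M = w * (2 * h)).
  { rewrite HM, <- E1. unfold w. rewrite <- Nat.pow_add_r. f_equal. lia. }
  assert (EMh : 2 * 2 ^ (m - 1) = M)
    by (rewrite HM, <- Nat.pow_succ_r'; f_equal; lia).
  assert (HhM : 2 * h <= M /\ w <= M).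
  { rewrite E2. split; [rewrite <- (Nat.mul_1_l (2 * h)) at 1; apply Nat.mul_le_mono_r; lia|].
    rewrite <- (Nat.mul_1_r w) at 1. apply Nat.mul_le_mono_l; lia. }
  rewrite E1 in *.
  assert (EW : M / (2 * h) = w) by (rewrite E2; apply Nat.div_mul; lia).
  unfold fft_body. apply wp_seq, wp_asg; cbn [eval opf]; rewrite EM, Eh, EW; [lia|].
  apply wp_seq.
  set (f := fun i => caddz (F (fidx l i)) (cmulz Qz (twz Qz m (i mod (2 * h) * w)) (F (fidx l i + 2 ^ (m - 1))))).
  apply wp_fillc with (D := D) (n := M) (base := YB) (f := f) (tb := 260).
  - reflexivity.
  - lia.
  - intros s1 Fr. cbn [eval]. rewrite Fr by reflexivity. exact EM.
  - intros i s1 Hi Ek Fr Ho.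
    assert (FT : vr s1 rT = T0) by (rewrite Fr by reflexivity; exact ET).
    assert (FM : vr s1 rM = M) by (rewrite Fr by reflexivity; exact EM).
    assert (FX : vr s1 rX = XB) by (rewrite Fr by reflexivity; exact EX).
    assert (FY : vr s1 rY = YB) by (rewrite Fr by reflexivity; exact EY).
    assert (Fh : vr s1 rh = h) by (rewrite Fr by reflexivity; exact Eh).
    assert (Fw : vr s1 rw = w) by (rewrite Fr by reflexivity; reflexivity).
    assert (NR1 : num_regs D H Q G s1).
    { destruct NR as (A1 & A2 & A3 & A4). repeat split; rewrite Fr by reflexivity; assumption. }
    set (j := fidx l i).
    assert (Ej : i / (2 * h) * h + i mod h = j) by (unfold j, fidx; rewrite E1; reflexivity).
    assert (Hj : j + 2 ^ (m - 1) < M) by (rewrite HM in *; apply fidx_lt; auto).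
    set (k := i mod (2 * h) * w).
    assert (Hk : k < M).
    { unfold k. rewrite E2, Nat.mul_comm. apply Nat.mul_lt_mono_pos_l; [lia|].
      apply Nat.mod_upper_bound. lia. }
    assert (CT1 : carr D (hp s1) T0 M (twz Qz m)).
    { apply carr_ext with (h := hp s); auto. intros a Ha. apply Ho. unfold disj in D1. lia. }
    assert (CX1 : carr D (hp s1) XB M F).
    { apply carr_ext with (h := hp s); auto. intros a Ha. apply Ho. unfold disj in D2. lia. }
    destruct (CX1 j ltac:(lia)) as [Y1 Y2].
    destruct (CX1 (j + 2 ^ (m - 1)) ltac:(lia)) as [Y3 Y4].
    destruct (CT1 k Hk) as [Y5 Y6].
    replace (XB + 2 * (j + 2 ^ (m - 1))) with (XB + 2 * j + M) in Y3, Y4 by lia.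
    assert (HE : forall z, enc D z <= V) by (intros z; pose proof (enc_lt D z); lia).
    unfold fft_inner.
    apply wp_seq, wp_asg; cbn [eval opf vr hp setv upd Nat.eqb]; rewrite Ek, Fh, Ej; [lia|].
    apply wp_seq, wp_asg; cbn [eval opf vr hp setv upd Nat.eqb]; rewrite FX, Y1; [auto|].
    apply wp_seq, wp_asg; cbn [eval opf vr hp setv upd Nat.eqb]; rewrite FX, Y2; [auto|].
    apply wp_seq, wp_asg; cbn [eval opf vr hp setv upd Nat.eqb]; rewrite FX, FM, Y3; [auto|].
    apply wp_seq, wp_asg; cbn [eval opf vr hp setv upd Nat.eqb]; rewrite FX, FM, Y4; [auto|].
    apply wp_seq, wp_asg; cbn [eval opf vr hp setv upd Nat.eqb]; rewrite Ek, Fh, Fw; fold k; [lia|].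
    apply wp_seq, wp_asg; cbn [eval opf vr hp setv upd Nat.eqb]; rewrite FT, Y5; [auto|].
    apply wp_seq, wp_asg; cbn [eval opf vr hp setv upd Nat.eqb]; rewrite FT, Y6; [auto|].
    match goal with |- wp _ _ ?st _ => set (s2 := st) end.
    assert (EV : forall s3, (forall r, vr s3 r = vr s2 r) ->
       eval s3 (emulre rc rs rx ry) = enc D (fst (cmulz Qz (twz Qz m k) (F (j + 2 ^ (m - 1))))) /\
       eval s3 (emulim rc rs rx ry) = enc D (snd (cmulz Qz (twz Qz m k) (F (j + 2 ^ (m - 1)))))).
    { intros s3 F3.
      apply (eval_emul D H Q G b NE) with (Bx := (2 * Qz)%Z) (By := R).
      - destruct NR1 as (A1 & A2 & A3 & A4). repeat split; rewrite F3; assumption.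
      - rewrite F3; reflexivity.
      - rewrite F3; reflexivity.
      - rewrite F3; reflexivity.
      - rewrite F3; reflexivity.
      - apply (tw_small V D H Q G b m M PE); [lia|rewrite <- HM; exact Hk].
      - apply HR. lia.
      - rewrite (Z.mul_comm (2 * Qz)). apply (prod_ok V D H Q G b m M PE); [|unfold Qz; lia].
        split; [|reflexivity]. unfold R, Qz. apply Z.mul_nonneg_nonneg; [apply Z.pow_nonneg; lia|lia]. }
    assert (VD : forall s3, (forall r, vr s3 r = vr s2 r) -> vr s3 rD = D).
    { intros s3 F3. rewrite F3. destruct NR1 as (A1 & A2 & A3 & A4). exact A2. }
    assert (W1 : forall s3, (forall r, vr s3 r = vr s2 r) ->
      eval s3 ((Var ra [+] emulre rc rs rx ry) [%] Var rD) = enc D (fst (f i)) /\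
      eval s3 ((Var rb [+] emulim rc rs rx ry) [%] Var rD) = enc D (snd (f i))).
    { intros s3 F3. destruct (EV s3 F3) as [V1 V2].
      cbn [eval opf] in *. rewrite V1, V2, VD by auto.
      rewrite (F3 ra), (F3 rb). unfold s2. cbn [vr setv upd Nat.eqb].
      rewrite !enc_add by lia. auto. }
    destruct (W1 s2 (fun _ => eq_refl)) as [W2 _].
    apply wp_seq, wp_sto; rewrite W2; [auto|].
    match goal with |- wp _ _ ?st _ => set (s3 := st) end.
    destruct (W1 s3 (fun _ => eq_refl)) as [_ W3].
    apply wp_sto; rewrite W3; [auto|].
    assert (Hs3 : hp s3 = hupd (hp s1) (YB + 2 * i) (enc D (fst (f i)))).
    { unfold s3. cbn [hp seth]. unfold s2. cbn [eval opf vr hp setv upd Nat.eqb].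
      rewrite FY, Ek. reflexivity. }
    assert (Ea : eval s3 (Var rY [+] Num 2 [*] Var rk [+] Num 1) = YB + 2 * i + 1).
    { unfold s3, s2. cbn [eval opf vr hp seth setv upd Nat.eqb]. rewrite FY, Ek. reflexivity. }
    rewrite Ea. cbn [hp seth]. rewrite Hs3. clear.
    split; [costs; lia|]. split; [|split].
    + rewrite hupd_neq, hupd_eq by lia. reflexivity.
    + rewrite hupd_eq. reflexivity.
    + intros a A1 A2. rewrite !hupd_neq by lia. reflexivity.
  - intros s1 t Fr C1 Ho Ht. cbv beta.
    assert (FX : vr s1 rX = XB) by (rewrite Fr by reflexivity; exact EX).
    assert (FY : vr s1 rY = YB) by (rewrite Fr by reflexivity; exact EY).
    assert (Fh : vr s1 rh = h) by (rewrite Fr by reflexivity; exact Eh).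
    wgo; rewrite ?FX, ?FY, ?Fh; try lia.
    apply HP; cbn [vr hp setv upd Nat.eqb]; auto.
    revert Ht. clear. costs. lia.
Qed.

(** The levels alternate between the two buffers, so the parity of [m] decides where the result
    lies; the postcondition speaks of [rX] and leaves the case open. *)
Lemma fft_spec s T0 XB YB F (P : state -> nat -> Prop) :
  num_regs D H Q G s -> vr s rT = T0 -> vr s rM = M -> vr s rX = XB -> vr s rY = YB ->
  XB <= V -> YB <= V ->
  disj T0 YB (2 * M) -> disj T0 XB (2 * M) -> disj XB YB (2 * M) ->
  carr D (hp s) T0 M (twz Qz m) -> carr D (hp s) XB M F ->
  (forall l i, l <= m -> i < M -> small R (fftz Qz m F l i)) ->
  (forall s' t, (forall r, wr fft r = false -> vr s' r = vr s r) ->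
     t <= m * (300 * M + 300) + 50 ->
     (vr s' rX = XB \/ vr s' rX = YB) ->
     carr D (hp s') (vr s' rX) M (dftz Qz m F) ->
     (forall a, (a < YB \/ YB + 2 * M <= a) -> (a < XB \/ XB + 2 * M <= a) -> hp s' a = hp s a) -> P s' t) ->
  wp V fft s P.
Proof.
  intros NR ET EM EX EY HXV HYV D1 D2 D3 CT CX HR HP.
  pose proof env_facts as (HM & Hm & HM4 & HMQ & HQ2 & HV & HDH & HQH).
  eapply wp_conseq with (Q' := fun s' t => t <= m * (300 * M + 300) + 50 /\
     (vr s' rX = XB \/ vr s' rX = YB) /\
     carr D (hp s') (vr s' rX) M (dftz Qz m F) /\
     (forall a, (a < YB \/ YB + 2 * M <= a) -> (a < XB \/ XB + 2 * M <= a) -> hp s' a = hp s a)).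
  2:{ intros s' t Fr (A1 & A2 & A3 & A4). apply HP; auto. }
  unfold fft. apply wp_seq, wp_asg; [cbn [eval]; lia|].
  set (s0 := setv s rh (eval s (Num 1))).
  apply wp_loop with (n := m) (t := fun _ => 300 * M + 200)
    (I := fun i s1 => vr s1 rh = 2 ^ i /\
      ((vr s1 rX = XB /\ vr s1 rY = YB) \/ (vr s1 rX = YB /\ vr s1 rY = XB)) /\
      carr D (hp s1) (vr s1 rX) M (fftz Qz m F i) /\
      (forall a, (a < YB \/ YB + 2 * M <= a) -> (a < XB \/ XB + 2 * M <= a) -> hp s1 a = hp s a)).
  - unfold s0. cbn [vr hp setv upd Nat.eqb eval]. rewrite EX. repeat split; auto; apply CX; auto.
  - intros i s1 Hi (I1 & I2 & I3 & I4) Fr. split.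
    { cbn [eval opf]. rewrite (Fr rM) by reflexivity. unfold s0. cbn [vr setv upd Nat.eqb].
      rewrite EM, I1, HM. pose proof (Nat.pow_lt_mono_r 2 i m). lia. }
    assert (Fr' : forall r, r =? 13 = false -> wr fft_body r = false -> vr s1 r = vr s r).
    { intros r R1 R2. rewrite Fr by auto. unfold s0. cbn [vr setv]. unfold upd. now rewrite R1. }
    assert (NR1 : num_regs D H Q G s1).
    { destruct NR as (A1 & A2 & A3 & A4). repeat split; rewrite Fr' by reflexivity; assumption. }
    assert (CT1 : carr D (hp s1) T0 M (twz Qz m)).
    { apply carr_ext with (h := hp s); auto. intros a Ha. unfold disj in *. apply I4; lia. }
    assert (FT : vr s1 rT = T0) by (rewrite Fr' by reflexivity; auto).
    assert (FM : vr s1 rM = M) by (rewrite Fr' by reflexivity; auto).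
    destruct I2 as [[X1 X2]|[X1 X2]]; rewrite X1 in I3.
    + apply (fft_body_spec s1 T0 XB YB i (fftz Qz m F i)); auto.
      { intros j Hj. apply HR; [lia|auto]. }
      intros s' t Ht J1 J2 J3 J4 J5. split; [|exact Ht]. rewrite J1. split; [auto|].
      split; [auto|]. split; [exact J4|]. intros a A1 A2. rewrite J5; auto.
    + apply (fft_body_spec s1 T0 YB XB i (fftz Qz m F i)); auto.
      { unfold disj in *; lia. }
      { intros j Hj. apply HR; [lia|auto]. }
      intros s' t Ht J1 J2 J3 J4 J5. split; [|exact Ht]. rewrite J1. split; [auto|].
      split; [auto|]. split; [exact J4|]. intros a A1 A2. rewrite J5; auto.
  - intros s1 (I1 & _) Fr. cbn [eval opf]. rewrite I1, (Fr rM) by reflexivity.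
    unfold s0. cbn [vr setv upd Nat.eqb]. rewrite EM, HM. lia.
  - intros s1 t (I1 & I2 & I3 & I4) Fr Ht. rewrite nsum_const in Ht.
    split; [|split; [|split]]; auto; [|destruct I2 as [[]|[]]; auto].
    revert Ht. clear. costs. lia.
Qed.

Lemma load_spec s XB SB ln (P : state -> nat -> Prop) :
  num_regs D H Q G s -> vr s rM = M -> vr s rX = XB -> vr s rsl = SB -> vr s rln = ln ->
  (forall i, i < ln -> hp s (SB + i) <= 1) ->
  (SB + M <= XB \/ XB + 2 * M <= SB) ->
  (forall s' t, (forall r, wr load r = false -> vr s' r = vr s r) ->
     t <= 100 * M + 50 ->
     carr D (hp s') XB M (inz Qz (fun i => hp s (SB + i) * ind (i <? ln))) ->
     (forall a, a < XB \/ XB + 2 * M <= a -> hp s' a = hp s a) -> P s' t) ->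
  wp V load s P.
Proof.
  intros NR EM EX ES EL HW1 Hd HP.
  pose proof env_facts as (HM & Hm & HM4 & HMQ & HQ2 & HV & HDH & HQH).
  eapply wp_conseq with (Q' := fun s' t => t <= 100 * M + 50 /\
     carr D (hp s') XB M (inz Qz (fun i => hp s (SB + i) * ind (i <? ln))) /\
     (forall a, a < XB \/ XB + 2 * M <= a -> hp s' a = hp s a)).
  2:{ intros s' t Fr (A1 & A2 & A3). apply HP; auto. }
  unfold load.
  apply wp_fillc with (D := D) (n := M) (base := XB)
    (f := inz Qz (fun i => hp s (SB + i) * ind (i <? ln))) (tb := 70).
  - reflexivity.
  - lia.
  - intros s1 Fr. cbn [eval]. rewrite Fr by reflexivity. exact EM.
  - intros i s1 Hi Ek Fr Ho.
    assert (FX : vr s1 rX = XB) by (rewrite Fr by reflexivity; exact EX).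
    assert (FQ : vr s1 rQ = Q) by (rewrite Fr by reflexivity; apply NR).
    assert (FS : vr s1 rsl = SB) by (rewrite Fr by reflexivity; exact ES).
    assert (FL : vr s1 rln = ln) by (rewrite Fr by reflexivity; exact EL).
    set (v := Q * (hp s (SB + i) * ind (i <? ln))).
    assert (Ei : 1 - (1 - (ln - i)) = ind (i <? ln)).
    { unfold ind. destruct (Nat.ltb_spec i ln); lia. }
    assert (Hv : v <= Q).
    { unfold v. specialize (HW1 i). unfold ind. destruct (Nat.ltb_spec i ln); [|lia].
      destruct (hp s (SB + i)) as [|[|]]; lia. }
    assert (Hx : hp s1 (SB + i) = hp s (SB + i)) by (apply Ho; lia).
    apply wp_seq, wp_sto; cbn [eval opf vr hp seth]; rewrite FQ, FS, FL, Ek, Hx, Ei; fold v; [lia|].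
    apply wp_sto; cbn [eval opf vr hp seth]; [lia|].
    rewrite FX, Ek. split; [costs; lia|].
    assert (Ev : enc D (fst (inz Qz (fun i => hp s (SB + i) * ind (i <? ln)) i)) = v).
    { unfold inz. cbn [fst]. unfold Qz. rewrite <- Nat2Z.inj_mul. fold v. apply enc_nat. lia. }
    rewrite Ev. cbn [inz snd]. split; [|split].
    + rewrite hupd_neq, hupd_eq by lia. reflexivity.
    + rewrite hupd_eq. symmetry. apply (enc_nat D 0). lia.
    + intros a A1 A2. rewrite !hupd_neq by lia. reflexivity.
  - intros s1 t Fr C1 Ho Ht. split; [|split]; auto.
    revert Ht. clear. costs. lia.
Qed.

Lemma copyc_spec dst src s DB SB F (P : state -> nat -> Prop) :
  dst <> rk -> src <> rk ->
  vr s rM = M -> vr s dst = DB -> vr s src = SB ->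
  carr D (hp s) SB M F -> disj DB SB (2 * M) ->
  (forall s' t, (forall r, wr (copyc dst src) r = false -> vr s' r = vr s r) ->
     t <= 100 * M + 50 ->
     carr D (hp s') DB M F ->
     (forall a, a < DB \/ DB + 2 * M <= a -> hp s' a = hp s a) -> P s' t) ->
  wp V (copyc dst src) s P.
Proof.
  intros Hd1 Hd2 EM ED ES C Hd HP.
  pose proof env_facts as (HM & Hm & HM4 & HMQ & HQ2 & HV & HDH & HQH).
  eapply wp_conseq with (Q' := fun s' t => t <= 100 * M + 50 /\ carr D (hp s') DB M F /\
     (forall a, a < DB \/ DB + 2 * M <= a -> hp s' a = hp s a)).
  2:{ intros s' t Fr (A1 & A2 & A3). apply HP; auto. }
  unfold copyc.
  apply wp_fillc with (D := D) (n := M) (base := DB) (f := F) (tb := 70).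
  - reflexivity.
  - lia.
  - intros s1 Fr. cbn [eval]. rewrite Fr by reflexivity. exact EM.
  - intros i s1 Hi Ek Fr Ho.
    assert (FD : vr s1 dst = DB) by (rewrite Fr; auto; apply Nat.eqb_neq; auto).
    assert (FS : vr s1 src = SB) by (rewrite Fr; auto; apply Nat.eqb_neq; auto).
    destruct (C i Hi) as [Y1 Y2].
    assert (X1 : hp s1 (SB + 2 * i) = enc D (fst (F i)))
      by (rewrite Ho; auto; unfold disj in Hd; lia).
    assert (X2 : hp s1 (SB + 2 * i + 1) = enc D (snd (F i)))
      by (rewrite Ho; auto; unfold disj in Hd; lia).
    assert (HE : forall z, enc D z <= V) by (intros z; pose proof (enc_lt D z); lia).
    apply wp_seq, wp_sto; cbn [eval opf vr hp seth]; rewrite FS, Ek, X1; [auto|].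
    assert (X3 : hupd (hp s1) (vr s1 dst + 2 * i) (enc D (fst (F i))) (SB + 2 * i + 1) = enc D (snd (F i))).
    { rewrite hupd_neq; auto. rewrite FD. unfold disj in Hd. lia. }
    apply wp_sto; cbn [eval opf vr hp seth]; rewrite FS, Ek, X3; [auto|].
    rewrite FD. clear. split; [costs; lia|]. split; [|split].
    + rewrite hupd_neq, hupd_eq by lia. reflexivity.
    + rewrite hupd_eq. reflexivity.
    + intros a A1 A2. rewrite !hupd_neq by lia. reflexivity.
  - intros s1 t Fr C1 Ho Ht. split; [|split]; auto.
    revert Ht. clear. costs. lia.
Qed.

Lemma mulc_spec s PB XB F E Bx By (P : state -> nat -> Prop) :
  num_regs D H Q G s -> vr s rM = M -> vr s rP = PB -> vr s rX = XB ->
  carr D (hp s) PB M F -> carr D (hp s) XB M E -> disj PB XB (2 * M) ->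
  (forall i, i < M -> small Bx (F i)) -> (forall i, i < M -> small By (E i)) ->
  (2 * (Bx * By) < Z.of_nat H)%Z ->
  (forall s' t, (forall r, wr mulc r = false -> vr s' r = vr s r) ->
     t <= 250 * M + 50 ->
     carr D (hp s') PB M (fun i => cmulz Qz (F i) (E i)) ->
     (forall a, a < PB \/ PB + 2 * M <= a -> hp s' a = hp s a) -> P s' t) ->
  wp V mulc s P.
Proof.
  intros NR EM EP EX CF CE Hd SF SE HB HP.
  pose proof env_facts as (HM & Hm & HM4 & HMQ & HQ2 & HV & HDH & HQH).
  eapply wp_conseq with (Q' := fun s' t => t <= 250 * M + 50 /\
     carr D (hp s') PB M (fun i => cmulz Qz (F i) (E i)) /\
     (forall a, a < PB \/ PB + 2 * M <= a -> hp s' a = hp s a)).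
  2:{ intros s' t Fr (A1 & A2 & A3). apply HP; auto. }
  unfold mulc.
  set (f := fun i => cmulz Qz (F i) (E i)).
  (* The invariant keeps the part of the array that has not been overwritten yet. *)
  apply wp_for with (n := M) (t := fun _ => 220)
    (I := fun i h => (forall j, j < i -> h (PB + 2 * j) = enc D (fst (f j)) /\ h (PB + 2 * j + 1) = enc D (snd (f j))) /\
       (forall a, a < PB \/ PB + 2 * i <= a -> h a = hp s a)).
  - reflexivity.
  - lia.
  - intros s1 i _ Fr _ _. cbn [eval]. rewrite Fr by reflexivity. exact EM.
  - split; [intros; lia|auto].
  - intros i s1 Hi Ek Fr [I1 I2].
    assert (FP : vr s1 rP = PB) by (rewrite Fr by reflexivity; exact EP).
    assert (FX : vr s1 rX = XB) by (rewrite Fr by reflexivity; exact EX).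
    assert (NR1 : num_regs D H Q G s1).
    { destruct NR as (A1 & A2 & A3 & A4). repeat split; rewrite Fr by reflexivity; assumption. }
    destruct (CF i Hi) as [Y1 Y2]. destruct (CE i Hi) as [Y3 Y4].
    rewrite <- (I2 (PB + 2 * i)) in Y1 by lia. rewrite <- (I2 (PB + 2 * i + 1)) in Y2 by lia.
    rewrite <- (I2 (XB + 2 * i)) in Y3 by (unfold disj in Hd; lia).
    rewrite <- (I2 (XB + 2 * i + 1)) in Y4 by (unfold disj in Hd; lia).
    assert (HE : forall z, enc D z <= V) by (intros z; pose proof (enc_lt D z); lia).
    apply wp_seq, wp_asg; cbn [eval opf vr hp setv upd Nat.eqb]; rewrite FP, Ek, Y1; [auto|].
    apply wp_seq, wp_asg; cbn [eval opf vr hp setv upd Nat.eqb]; rewrite FP, Ek, Y2; [auto|].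
    apply wp_seq, wp_asg; cbn [eval opf vr hp setv upd Nat.eqb]; rewrite FX, Ek, Y3; [auto|].
    apply wp_seq, wp_asg; cbn [eval opf vr hp setv upd Nat.eqb]; rewrite FX, Ek, Y4; [auto|].
    match goal with |- wp _ _ ?st _ => set (s2 := st) end.
    assert (EV : forall s3, (forall r, vr s3 r = vr s2 r) ->
       eval s3 (emulre rx ry rc rs) = enc D (fst (f i)) /\
       eval s3 (emulim rx ry rc rs) = enc D (snd (f i))).
    { intros s3 F3.
      apply (eval_emul D H Q G b NE) with (Bx := Bx) (By := By); auto; try (rewrite F3; reflexivity).
      destruct NR1 as (A1 & A2 & A3 & A4). repeat split; rewrite F3; assumption. }
    destruct (EV s2 (fun _ => eq_refl)) as [W2 _].
    apply wp_seq, wp_sto; rewrite W2; [auto|].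
    match goal with |- wp _ _ ?st _ => set (s3 := st) end.
    destruct (EV s3 (fun _ => eq_refl)) as [_ W3].
    apply wp_sto; rewrite W3; [auto|].
    assert (Hs3 : hp s3 = hupd (hp s1) (PB + 2 * i) (enc D (fst (f i)))).
    { unfold s3. cbn [hp seth]. unfold s2. cbn [eval opf vr hp setv upd Nat.eqb].
      rewrite FP, Ek. reflexivity. }
    assert (Ea : eval s3 (Var rP [+] Num 2 [*] Var rk [+] Num 1) = PB + 2 * i + 1).
    { unfold s3, s2. cbn [eval opf vr hp seth setv upd Nat.eqb]. rewrite FP, Ek. reflexivity. }
    rewrite Ea. cbn [hp seth]. rewrite Hs3.
    split; [split|clear; costs; lia].
    + intros j Hj. destruct (Nat.eq_dec j i) as [->|Hji].
      * rewrite hupd_eq, hupd_neq, hupd_eq by lia. auto.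
      * rewrite !hupd_neq by lia. apply I1. lia.
    + intros a Ha. rewrite !hupd_neq by lia. apply I2. lia.
  - intros s1 t [I1 I2] Fr _ Ht. split; [|split]; auto.
    rewrite nsum_const in Ht. revert Ht. clear. costs. lia.
Qed.
End Transform2.

(** * Adding windows *)

Notation rT1 := 31 (only parsing).
Notation rT2 := 32 (only parsing).
Notation rp1 := 33 (only parsing).
Notation rp2 := 34 (only parsing).
Notation rnx := 35 (only parsing).
Notation rl1 := 36 (only parsing).
Notation rl2 := 37 (only parsing).
Notation rbd := 38 (only parsing).
Notation ro := 39 (only parsing).

Definition lf (sl : nat) (ln : expr) : cmd :=
  rX ::= Var rX0 ;; rY ::= Var rY0 ;; rsl ::= Var sl ;; rln ::= ln ;; load ;; fft.

(** The minimum of t and 3N by truncated subtraction: the index of the last cell of the window of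
    t. *)
Definition elen (t : nat) : expr := Var t [-] (Var t [-] Num 3 [*] Var rN).

(** The three indices are at most l1, l2 and l1 + l2, so their sum is at most 2 * rbd; a length
    above that makes the cyclic convolution an ordinary one. *)
Definition setM : cmd :=
  rM ::= Num 4 ;;
  While (Num 2 [*] Var rbd [+] Num 1 [-] Var rM) (rM ::= Num 2 [*] Var rM).

(* Rounds the [convz] values to integers, [1 - (1 - x)] being [min x 1]. *)
Definition output : cmd :=
  For rk (Var rL)
    (Sto (Var rnx [+] Var rk)
       (Num 1 [-] (Num 1 [-]
         ((Ld (Var rX [+] Num 2 [*] ((Var rM [-] (Var ro [+] Var rk)) [%] Var rM))
           [+] Var rM [*] (Var rQ [/] Num 2)) [%] Var rD) [/] (Var rM [*] Var rQ)))).

(** The weights are read only up to index l1 + l2: no index of the new window exceeds it, so larger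
    summands cannot contribute. This keeps the cost proportional to the windows while they are still
    shorter than N. The running product is kept in [rP], because all transforms share the same two
    buffers. *)
Definition add_windows : cmd :=
  rl1 ::= elen rT1 ;;
  rl2 ::= elen rT2 ;;
  rbd ::= Var rl1 [+] Var rl2 ;;
  setM ;;
  twiddle ;;
  lf rp1 (Var rl1 [+] Num 1) ;;
  copyc rP rX ;;
  lf rp2 (Var rl2 [+] Num 1) ;;
  mulc ;;
  lf rA (Var rbd [+] Num 1) ;;
  mulc ;;
  rX ::= Var rX0 ;; rY ::= Var rY0 ;;
  copyc rX rP ;;
  fft ;;
  ro ::= (Var rT1 [+] Var rT2 [-] Num 3 [*] Var rN)
           [-] (Var rT1 [-] Num 3 [*] Var rN) [-] (Var rT2 [-] Num 3 [*] Var rN) ;;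
  rL ::= (Var rT1 [+] Var rT2) [-] (Var rT1 [+] Var rT2 [-] Num 3 [*] Var rN) [+] Num 1 ;;
  output.

(* The registers that none of the transform routines changes. *)
Definition klist : list nat := seq 1 12 ++ seq 31 30.

Definition keeps (c : cmd) : Prop := forallb (fun r => negb (wr c r)) klist = true.

Definition same (s s' : state) : Prop := forall r, existsb (Nat.eqb r) klist = true -> vr s' r = vr s r.

Lemma keeps_same c s s' :
  keeps c -> (forall r, wr c r = false -> vr s' r = vr s r) -> same s s'.
Proof.
  intros K F r Hr. apply F. apply existsb_exists in Hr as (x & Hx & E).
  apply Nat.eqb_eq in E. subst x.
  unfold keeps in K. rewrite forallb_forall in K. specialize (K r Hx).
  now apply negb_true_iff in K.
Qed.

Lemma same_trans s1 s2 s3 : same s1 s2 -> same s2 s3 -> same s1 s3.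
Proof. intros H1 H2 r Hr. rewrite H2, H1; auto. Qed.

Lemma same_refl s : same s s.
Proof. intros r _. reflexivity. Qed.

Lemma same_set s s' r x : existsb (Nat.eqb r) klist = false -> same s s' -> same s (setv s' r x).
Proof.
  intros Hr H r' Hr'. cbn [vr setv]. unfold upd.
  destruct (Nat.eqb_spec r' r) as [->|]; [congruence|]. auto.
Qed.

(* Windows have at most [3 N + 1] cells and a transform at most [Mx].  The heap is divided
   in blocks of [S] cells: input at [0], weights at [S], roots of unity at [2 S], FFT
   buffers at [3 S], [4 S] and [5 S], windows from [6 S] on. *)
Record glob_env (V D H Q G b S Mx N : nat) : Prop := {
  ge_num : num_env D H Q G b;
  ge_Q : Mx ^ 11 <= Q;
  ge_H : 16 * Mx ^ 5 * (Q * Q) <= H;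
  ge_V : 4 * D <= V;
  ge_S : 2 * Mx <= S;
  ge_SV : 6 * S <= V;
  ge_N : 1 <= N;
  ge_Mx : 24 * N <= Mx
}.

Definition genv (D H Q G S N : nat) (s : state) : Prop :=
  num_regs D H Q G s /\ vr s rN = N /\ vr s rS = S /\ vr s rT = 2 * S /\ vr s rX0 = 3 * S /\
  vr s rY0 = 4 * S /\ vr s rP = 5 * S /\ vr s rA = S.

Lemma genv_same D H Q G S N s s' : same s s' -> genv D H Q G S N s -> genv D H Q G S N s'.
Proof.
  intros F ((A1 & A2 & A3 & A4) & B1 & B2 & B3 & B4 & B5 & B6 & B7).
  repeat split; rewrite F by reflexivity; assumption.
Qed.

Section Windows.
Variables V D H Q G b S Mx N : nat.
Hypothesis GE : glob_env V D H Q G b S Mx N.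

Let Qz := Z.of_nat Q.

Lemma prec_of m : 2 <= m -> 2 ^ m <= Mx -> prec_env V D H Q G b m (2 ^ m).
Proof.
  intros Hm HM. destruct GE. constructor; auto.
  - etransitivity; [apply Nat.pow_le_mono_l; eauto|auto].
  - etransitivity; [|eauto]. apply Nat.mul_le_mono_r, Nat.mul_le_mono_l, Nat.pow_le_mono_l. auto.
Qed.

(** The upper bound 4 * rbd on the length makes the cost follow the window lengths; with rbd <= 6 N
    it explains the requirement 24 N <= Mx. *)
Lemma setM_spec s (P : state -> nat -> Prop) :
  1 <= vr s rbd -> vr s rbd <= 6 * N ->
  (forall s' t m, (forall r, wr setM r = false -> vr s' r = vr s r) ->
     (forall a, hp s' a = hp s a) ->
     vr s' rM = 2 ^ m -> 2 <= m -> 2 * vr s rbd < 2 ^ m -> 2 ^ m <= 4 * vr s rbd ->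
     t <= 50 * m -> P s' t) ->
  wp V setM s P.
Proof.
  intros Hb1 Hb6 HP. set (bd := vr s rbd) in *.
  set (m := Nat.max 2 (Nat.log2 (2 * bd) + 1)).
  assert (HMxV : Mx <= V) by (destruct GE; lia).
  assert (HMx : 24 * N <= Mx) by apply GE.
  pose proof (Nat.log2_spec (2 * bd) ltac:(lia)) as [L1 L2].
  assert (B1 : 2 * bd < 2 ^ m).
  { eapply Nat.lt_le_trans; [exact L2|]. apply Nat.pow_le_mono_r; lia. }
  assert (B2 : 2 ^ m <= 4 * bd).
  { unfold m. destruct (Nat.max_spec 2 (Nat.log2 (2 * bd) + 1)) as [[_ ->]|[_ ->]].
    - rewrite Nat.add_1_r, Nat.pow_succ_r'. lia.
    - simpl. lia. }
  assert (B3 : forall i, 2 <= i -> i < m -> 2 ^ i <= 2 * bd).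
  { intros i H2 Hi. etransitivity; [|exact L1]. apply Nat.pow_le_mono_r; lia. }
  eapply wp_conseq with (Q' := fun s' t => (forall a, hp s' a = hp s a) /\ vr s' rM = 2 ^ m /\ t <= 50 * m).
  2:{ intros s' t F (A1 & A2 & A3). apply (HP s' t m); auto. lia. }
  unfold setM. apply wp_seq, wp_asg; [cbn [eval]; lia|].
  apply wp_loop with (n := m - 2) (t := fun _ => 20)
    (I := fun i s1 => vr s1 rM = 2 ^ (2 + i) /\ (forall a, hp s1 a = hp s a)).
  - split; reflexivity.
  - intros i s1 Hi [I1 I2] F.
    assert (Fb : vr s1 rbd = bd) by (rewrite F by reflexivity; reflexivity).
    pose proof (B3 (2 + i) ltac:(lia) ltac:(lia)).
    split; [cbn [eval opf]; rewrite Fb, I1; lia|].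
    apply wp_asg; cbn [eval opf]; rewrite I1.
    + rewrite <- Nat.pow_succ_r'. assert (2 ^ Datatypes.S (2 + i) <= 2 ^ m) by (apply Nat.pow_le_mono_r; lia). lia.
    + split; [split|costs; lia]; [|exact I2].
      cbn [vr setv upd Nat.eqb]. rewrite Nat.add_succ_r, Nat.pow_succ_r'. reflexivity.
  - intros s1 [I1 I2] F.
    assert (Fb : vr s1 rbd = bd) by (rewrite F by reflexivity; reflexivity).
    cbn [eval opf]. rewrite Fb, I1. replace (2 + (m - 2)) with m by lia. lia.
  - intros s1 t [I1 I2] F Ht. rewrite nsum_const in Ht.
    replace (2 + (m - 2)) with m in I1 by lia. split; [exact I2|]. split; [exact I1|].
    assert (2 <= m) by lia. clearbody m. revert Ht. costs. lia.
Qed.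

Section Fixed.
Variables m M : nat.
Hypothesis Hm2 : 2 <= m.
Hypothesis EqM : M = 2 ^ m.
Hypothesis HMMx : M <= Mx.

Let PE : prec_env V D H Q G b m M.
Proof. rewrite EqM. apply prec_of; auto. now rewrite <- EqM. Qed.

Let R := (Z.of_nat M ^ 5 * Qz)%Z.

Lemma fwd_small f l i :
  (forall i, f i <= 1) -> l <= m -> i < M ->
  small (2 * Z.of_nat M * Qz) (fftz Qz m (inz Qz f) l i).
Proof.
  intros Hf Hl Hi.
  pose proof (fwd_comps m Qz Hm2 (Qz_even _ _ _ _ _ _ _ _ PE) (Qz_big _ _ _ _ _ _ _ _ PE) f Hf l i Hl) as C.
  rewrite (Mz_eq _ _ _ _ _ _ _ _ PE) in C. rewrite EqM in Hi at 1. specialize (C Hi).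
  exact C.
Qed.

Lemma M_facts :
  (4 <= Z.of_nat M)%Z /\ (2 * Z.of_nat M <= Z.of_nat M ^ 5)%Z /\
  (8 * Z.of_nat M ^ 3 <= Z.of_nat M ^ 5)%Z /\ (0 < Qz)%Z.
Proof.
  pose proof (env_facts _ _ _ _ _ _ _ _ PE) as (_ & _ & HM4 & _ & HQ2 & _).
  set (x := Z.of_nat M). assert (4 <= x)%Z by (unfold x; lia).
  assert (E5 : (x ^ 5 = x * x * (x * x * x))%Z) by ring.
  assert (E3 : (x ^ 3 = x * x * x)%Z) by ring.
  rewrite E5, E3. assert (16 <= x * x)%Z by nia. assert (64 <= x * x * x)%Z by nia.
  unfold Qz. split; [lia|]. split; [|split; [nia|lia]].
  assert (x * 1 <= x * (x * x * x))%Z by (apply Z.mul_le_mono_nonneg_l; lia). nia.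
Qed.

Lemma lf_spec sl ln L s (P : state -> nat -> Prop) :
  existsb (Nat.eqb sl) klist = true ->
  genv D H Q G S N s -> vr s rM = M ->
  vr s sl + M <= 3 * S \/ 5 * S <= vr s sl -> vr s sl <= V ->
  (forall s', same s s' -> eval s' ln = L) -> L <= V ->
  cost_e ln <= 20 ->
  (forall i, i < L -> hp s (vr s sl + i) <= 1) ->
  carr D (hp s) (2 * S) M (twz Qz m) ->
  (forall s' t, same s s' ->
     t <= m * (300 * M + 300) + 100 * M + 200 ->
     (vr s' rX = 3 * S \/ vr s' rX = 4 * S) ->
     carr D (hp s') (vr s' rX) M (dftz Qz m (inz Qz (fun i => hp s (vr s sl + i) * ind (i <? L)))) ->
     (forall a, a < 3 * S \/ 5 * S <= a -> hp s' a = hp s a) -> P s' t) ->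
  wp V (lf sl ln) s P.
Proof.
  intros Hk GV EM Hsl HslV HL HLV Hc Hx CT HP.
  pose proof (env_facts _ _ _ _ _ _ _ _ PE) as (_ & _ & HM4 & HMQ & HQ2 & HV & HDH & HQH).
  assert (HS : 2 * M <= S) by (destruct GE; lia).
  assert (HSV : 6 * S <= V) by (destruct GE; lia).
  set (SB := vr s sl) in *.
  destruct GV as (NR & B1 & B2 & B3 & B4 & B5 & B6 & B7).
  unfold lf.
  apply wp_seq, wp_asg; cbn [eval]; rewrite B4; [lia|].
  apply wp_seq, wp_asg; cbn [eval vr setv upd Nat.eqb]; rewrite B5; [lia|].
  match goal with |- wp _ _ ?st _ => set (s1 := st) end.
  assert (S1 : same s s1) by (repeat apply same_set; auto; apply same_refl).
  apply wp_seq, wp_asg; cbn [eval]; rewrite (S1 sl Hk); fold SB; [lia|].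
  match goal with |- wp _ _ ?st _ => set (s2 := st) end.
  assert (S2 : same s s2) by (apply same_set; auto).
  apply wp_seq, wp_asg; rewrite (HL s2 S2); [lia|].
  match goal with |- wp _ _ ?st _ => set (s3 := st) end.
  assert (S3 : same s s3) by (apply same_set; auto).
  apply wp_seq. apply (load_spec _ _ _ _ _ _ _ _ PE s3 (3 * S) SB L).
  { destruct NR as (A1 & A2 & A3 & A4). repeat split; rewrite S3 by reflexivity; assumption. }
  { rewrite S3 by reflexivity; assumption. }
  { reflexivity. }
  { reflexivity. }
  { reflexivity. }
  { exact Hx. }
  { lia. }
  intros s4 t4 F4 Ht4 C4 O4.
  assert (S4 : same s s4).
  { eapply same_trans; [exact S3|]. eapply keeps_same; [|exact F4]. reflexivity. }
  set (f := fun i => hp s (SB + i) * ind (i <? L)).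
  assert (Hf : forall i, f i <= 1).
  { intros i. unfold f, ind. destruct (Nat.ltb_spec i L); [|lia]. specialize (Hx i). lia. }
  apply (fft_spec _ _ _ _ _ _ _ _ PE s4 (2 * S) (3 * S) (4 * S) (inz Qz f)).
  { destruct NR as (A1 & A2 & A3 & A4). repeat split; rewrite S4 by reflexivity; assumption. }
  { rewrite S4 by reflexivity; assumption. }
  { rewrite S4 by reflexivity; assumption. }
  { rewrite F4 by reflexivity. reflexivity. }
  { rewrite F4 by reflexivity. reflexivity. }
  1, 2: lia.
  1, 2, 3: unfold disj; lia.
  { apply carr_ext with (h := hp s); auto. intros a Ha. apply O4. lia. }
  { exact C4. }
  { intros l i Hl Hi. destruct (fwd_small f l i Hf Hl Hi) as [A1 A2].
    destruct M_facts as (M1 & M2 & M3 & M4).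
    assert (2 * Z.of_nat M * Qz <= Z.of_nat M ^ 5 * Qz)%Z by (apply Z.mul_le_mono_nonneg_r; lia).
    split; unfold Qz in *; lia. }
  intros s5 t5 F5 Ht5 HX5 C5 O5.
  apply HP; auto.
  - eapply same_trans; [exact S4|]. eapply keeps_same; [|exact F5]. reflexivity.
  - revert Ht4 Ht5 Hc. clear. costs. change (length (ce ln 0)) with (cost_e ln). lia.
  - intros a Ha. rewrite O5, O4 by lia. reflexivity.
Qed.

Section Bit.
Variables f g h : nat -> nat.
Hypothesis Hf : forall i, f i <= 1.
Hypothesis Hg : forall i, g i <= 1.
Hypothesis Hh : forall i, h i <= 1.

Lemma inv_small l i : l <= m -> i < M -> small R (fftz Qz m (prodz Qz m f g h) l i).
Proof.
  intros Hl Hi.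
  pose proof (inv_comps m Qz Hm2 (Qz_even _ _ _ _ _ _ _ _ PE) (Qz_big _ _ _ _ _ _ _ _ PE)
    f g h Hf Hg Hh l i Hl) as C.
  rewrite (Mz_eq _ _ _ _ _ _ _ _ PE) in C. rewrite EqM in Hi at 1. exact (C Hi).
Qed.

Lemma prod2_small i :
  i < M -> small (2 * Z.of_nat M ^ 2 * Qz) (cmulz Qz (dftz Qz m (inz Qz f) i) (dftz Qz m (inz Qz g) i)).
Proof.
  intros Hi.
  pose proof (prod2_comps m Qz Hm2 (Qz_even _ _ _ _ _ _ _ _ PE) (Qz_big _ _ _ _ _ _ _ _ PE)
    f g Hf Hg i) as C.
  rewrite (Mz_eq _ _ _ _ _ _ _ _ PE) in C. rewrite EqM in Hi at 1. exact (C Hi).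
Qed.

(** The convolution value is at most [R] in absolute value and [D] is far larger, so after the shift
    by half a spacing the residue is the integer itself and can be compared with M * Q. *)
Lemma bit_spec u :
  u < M ->
  let hit := exists a b c, a < M /\ b < M /\ c < M /\
     f a = 1 /\ g b = 1 /\ h c = 1 /\ (a + b + c) mod M = u in
  let q := (enc D (convz Qz m f g h u) + M * (Q / 2)) mod D / (M * Q) in
  (hit -> 1 <= q) /\ (~ hit -> q = 0).
Proof.
  intros Hu hit q.
  pose proof (env_facts _ _ _ _ _ _ _ _ PE) as (_ & _ & HM4 & HMQ & HQ2 & HV & HDH & HQH).
  pose proof (convz_spec m Qz Hm2 (Qz_even _ _ _ _ _ _ _ _ PE) (Qz_big _ _ _ _ _ _ _ _ PE)
    f g h Hf Hg Hh u) as C.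
  rewrite (Mz_eq _ _ _ _ _ _ _ _ PE) in C. rewrite <- EqM in C. specialize (C Hu).
  cbv zeta in C. fold hit in C. destruct C as (C1 & C2 & C3).
  assert (Hk : (M - u) mod M < M) by (apply Nat.mod_upper_bound; lia).
  destruct (inv_small m _ (le_n m) Hk) as [B _].
  set (z := convz Qz m f g h u) in *.
  assert (B' : (Z.abs z <= R)%Z) by (unfold z, convz, dftz; rewrite <- EqM; exact B).
  destruct M_facts as (M1 & M2 & M3 & M4).
  assert (EQ2 : (Z.of_nat (Q / 2) = Qz / 2)%Z) by (unfold Qz; rewrite Nat2Z.inj_div; reflexivity).
  assert (B2 : (z + Z.of_nat M * (Qz / 2) < Z.of_nat D)%Z).
  { pose proof (Hz_big _ _ _ _ _ _ _ _ PE) as HB. fold Qz in HB.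
    assert (Z.of_nat M * (Qz / 2) <= Z.of_nat M ^ 5 * Qz)%Z.
    { apply Z.mul_le_mono_nonneg; [lia|lia|apply Z.div_pos; lia|].
      apply Z.div_le_upper_bound; lia. }
    assert (Z.of_nat M ^ 5 * Qz * 1 <= Z.of_nat M ^ 5 * Qz * Qz)%Z
      by (apply Z.mul_le_mono_nonneg_l; [apply Z.mul_nonneg_nonneg|]; lia).
    unfold R in B'. lia. }
  assert (E : (enc D z + M * (Q / 2)) mod D = Z.to_nat (z + Z.of_nat M * (Qz / 2))).
  { apply Nat2Z.inj. rewrite Nat2Z.inj_mod, Nat2Z.inj_add, Nat2Z.inj_mul, enc_of_nat, EQ2 by lia.
    rewrite Z.add_mod_idemp_l, Z.mod_small by lia. lia. }
  unfold q. rewrite E.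
  assert (EMQ : Z.of_nat (M * Q) = (Z.of_nat M * Qz)%Z) by (unfold Qz; lia).
  split; intros Hhit.
  - apply C1 in Hhit. apply Nat.div_le_lower_bound; lia.
  - apply C3 in Hhit. apply Nat.div_small. lia.
Qed.

End Bit.

Lemma output_spec s f g h PB L nx off (P : state -> nat -> Prop) :
  (forall i, f i <= 1) -> (forall i, g i <= 1) -> (forall i, h i <= 1) ->
  genv D H Q G S N s -> vr s rM = M -> vr s rX = PB -> vr s rL = L -> vr s rnx = nx ->
  vr s ro = off -> L <= V -> off + L <= M ->
  carr D (hp s) PB M (dftz Qz m (prodz Qz m f g h)) ->
  PB + 2 * M <= nx ->
  (forall s' t, (forall r, wr output r = false -> vr s' r = vr s r) ->
     t <= 100 * L + 20 ->
     (forall i, i < L -> hp s' (nx + i) <= 1 /\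
        (hp s' (nx + i) = 1 <-> exists a b c, a < M /\ b < M /\ c < M /\
           f a = 1 /\ g b = 1 /\ h c = 1 /\ (a + b + c) mod M = off + i)) ->
     (forall a, a < nx \/ nx + L <= a -> hp s' a = hp s a) -> P s' t) ->
  wp V output s P.
Proof.
  intros Hf Hg Hh GV EM EX EL En Eo HLV HoL CP Hnx HP.
  pose proof (env_facts _ _ _ _ _ _ _ _ PE) as (_ & _ & HM4 & HMQ & HQ2 & HV & HDH & HQH).
  destruct GV as ((A1 & A2 & A3 & A4) & _).
  set (bit := fun i => 1 - (1 - (enc D (convz Qz m f g h (off + i)) + M * (Q / 2)) mod D / (M * Q))).
  eapply wp_conseq with (Q' := fun s' t => t <= 100 * L + 20 /\
     (forall i, i < L -> hp s' (nx + i) = bit i) /\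
     (forall a, a < nx \/ nx + L <= a -> hp s' a = hp s a)).
  2:{ intros s' t F (B1 & B2 & B3). apply HP; auto.
      intros i Hi. rewrite B2 by auto. split; [unfold bit; lia|].
      destruct (bit_spec f g h Hf Hg Hh (off + i)) as [C1 C2]; [lia|].
      split.
      - intros Hb.
        match goal with |- ?hit => destruct (Classical_Prop.classic hit) as [|Hn]; auto end.
        exfalso. apply C2 in Hn. unfold bit in Hb. rewrite Hn in Hb. discriminate.
      - intros Hx. apply C1 in Hx. unfold bit. lia. }
  unfold output.
  apply wp_fill with (n := L) (k := 1) (base := nx) (val := bit) (tb := 80); auto.
  - intros s1 F. cbn [eval]. rewrite F by reflexivity. exact EL.
  - intros i s1 Hi Ek F _ Ho.
    set (u := off + i).
    assert (Hk : (M - u) mod M < M) by (apply Nat.mod_upper_bound; lia).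
    destruct (CP _ Hk) as [Y _].
    rewrite <- (Ho (PB + 2 * ((M - u) mod M))) in Y by lia.
    assert (FX : vr s1 rX = PB) by (rewrite F by reflexivity; exact EX).
    assert (FM : vr s1 rM = M) by (rewrite F by reflexivity; exact EM).
    assert (Fo : vr s1 ro = off) by (rewrite F by reflexivity; exact Eo).
    assert (Fn : vr s1 rnx = nx) by (rewrite F by reflexivity; exact En).
    assert (FQ : vr s1 rQ = Q) by (rewrite F by reflexivity; exact A1).
    assert (FD : vr s1 rD = D) by (rewrite F by reflexivity; exact A2).
    assert (Ev : enc D (fst (dftz Qz m (prodz Qz m f g h) ((M - u) mod M))) = enc D (convz Qz m f g h u)).
    { unfold convz. now rewrite <- EqM. }
    rewrite Ev in Y.
    apply wp_sto; cbn [eval opf]; rewrite FX, FM, Fo, FQ, FD, Ek; fold u; rewrite Y.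
    { lia. }
    rewrite Fn. split; [clear; costs; lia|]. split.
    + intros j Hj. replace j with i by lia. cbn [hp seth]. rewrite hupd_eq. reflexivity.
    + intros a Ha. cbn [hp seth]. rewrite hupd_neq by lia. reflexivity.
  - intros s1 t F B1 B2 Ht. split; [|split].
    + revert Ht. clear. costs. lia.
    + intros i Hi. apply B1. lia.
    + intros a Ha. apply B2. lia.
Qed.

End Fixed.

(** [off] is the first number of the new window minus the first numbers of the two old ones, so that
    an index sum off + i stands for the i-th number of the new window. In the cost, m * 2^m comes
    from the transforms and m * b from the square roots. *)
Lemma add_windows_spec s T1 T2 p1 p2 nx (P : state -> nat -> Prop) :
  genv D H Q G S N s -> vr s rT1 = T1 -> vr s rT2 = T2 ->
  vr s rp1 = p1 -> vr s rp2 = p2 -> vr s rnx = nx ->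
  1 <= T1 -> 1 <= T2 -> T1 + T2 <= V ->
  6 * S <= p1 <= V -> 6 * S <= p2 <= V -> 6 * S <= nx ->
  let l1 := Nat.min T1 (3 * N) in
  let l2 := Nat.min T2 (3 * N) in
  let l3 := Nat.min (T1 + T2) (3 * N) in
  let off := (T1 + T2 - 3 * N) - (T1 - 3 * N) - (T2 - 3 * N) in
  (forall i, i <= l1 -> hp s (p1 + i) <= 1) ->
  (forall i, i <= l2 -> hp s (p2 + i) <= 1) ->
  (forall i, i <= l1 + l2 -> hp s (S + i) <= 1) ->
  (forall s' t, (forall r, wr add_windows r = false -> vr s' r = vr s r) ->
     (exists m, 2 ^ m <= 4 * (l1 + l2) /\ t <= 5000 * (m * 2 ^ m) + 200 * (m * b)) ->
     (forall i, i <= l3 -> hp s' (nx + i) <= 1 /\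
       (hp s' (nx + i) = 1 <-> exists x y z, x <= l1 /\ y <= l2 /\ z <= l1 + l2 /\
          hp s (p1 + x) = 1 /\ hp s (p2 + y) = 1 /\ hp s (S + z) = 1 /\
          x + y + z = off + i)) ->
     (forall a, a < 2 * S \/ 6 * S <= a -> a < nx \/ nx + l3 + 1 <= a -> hp s' a = hp s a) ->
     P s' t) ->
  wp V add_windows s P.
Proof.
  intros GV E1 E2 Ep1 Ep2 En HT1 HT2 HTV Hp1 Hp2 Hnx l1 l2 l3 off HW1 HW2 HA HP.
  pose proof (ge_V _ _ _ _ _ _ _ _ _ GE) as HV4.
  pose proof (ge_S _ _ _ _ _ _ _ _ _ GE) as HSM.
  pose proof (ge_SV _ _ _ _ _ _ _ _ _ GE) as HSV.
  pose proof (ge_N _ _ _ _ _ _ _ _ _ GE) as HN1.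
  pose proof (ge_Mx _ _ _ _ _ _ _ _ _ GE) as HMx.
  assert (EN : vr s rN = N) by apply GV.
  eapply wp_conseq with (Q' := fun s' t =>
     (exists m, 2 ^ m <= 4 * (l1 + l2) /\ t <= 5000 * (m * 2 ^ m) + 200 * (m * b)) /\
     (forall i, i <= l3 -> hp s' (nx + i) <= 1 /\
       (hp s' (nx + i) = 1 <-> exists x y z, x <= l1 /\ y <= l2 /\ z <= l1 + l2 /\
          hp s (p1 + x) = 1 /\ hp s (p2 + y) = 1 /\ hp s (S + z) = 1 /\
          x + y + z = off + i)) /\
     (forall a, a < 2 * S \/ 6 * S <= a -> a < nx \/ nx + l3 + 1 <= a -> hp s' a = hp s a)).
  2:{ intros s' t F (B1 & B2 & B3). apply HP; auto. }
  assert (El1 : T1 - (T1 - 3 * N) = l1) by (unfold l1; clear; lia).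
  assert (El2 : T2 - (T2 - 3 * N) = l2) by (unfold l2; clear; lia).
  assert (Hbd : 1 <= l1 + l2 <= 6 * N) by (unfold l1, l2; clear - HT1 HT2 HN1; lia).
  assert (Hoff : off + l3 = l1 + l2) by (unfold off, l1, l2, l3; clear; lia).
  (* Wrapping these equations in [Some] keeps truncated subtractions out of the
     sight of lia, which would case-split on each of them. *)
  assert (Xoff : Some (T1 + T2 - 3 * N - (T1 - 3 * N) - (T2 - 3 * N)) = Some off) by reflexivity.
  assert (Xl3 : Some (T1 + T2 - (T1 + T2 - 3 * N) + 1) = Some (l3 + 1)) by (f_equal; unfold l3; clear; lia).
  unfold add_windows, elen.
  apply wp_seq, wp_asg; cbn [eval opf vr hp setv upd Nat.eqb]; rewrite E1, EN, El1; [lia|].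
  apply wp_seq, wp_asg; cbn [eval opf vr hp setv upd Nat.eqb]; rewrite E2, EN, El2; [lia|].
  clear El1 El2. clearbody l1 l2 l3 off.
  apply wp_seq, wp_asg; cbn [eval opf vr hp setv upd Nat.eqb]; [lia|].
  match goal with |- wp _ _ ?st _ => set (s0 := st) end.
  apply wp_seq. apply setM_spec.
  { unfold s0. cbn [vr setv upd Nat.eqb]. lia. }
  { unfold s0. cbn [vr setv upd Nat.eqb]. lia. }
  intros s1 t1 m F1 O1 EM Hm2 HbM HMb Ht1.
  unfold s0 in HbM, HMb. cbn [vr setv upd Nat.eqb] in HbM, HMb.
  set (M := 2 ^ m) in *.
  assert (HMMx : M <= Mx) by lia.
  pose proof (prec_of m Hm2 HMMx) as PE.
  assert (K0 : forall r, wr setM r = false -> r =? rl1 = false -> r =? rl2 = false ->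
     r =? rbd = false -> vr s1 r = vr s r).
  { intros r R1 R2 R3 R4. rewrite F1 by auto. unfold s0. cbn [vr setv]. unfold upd.
    now rewrite R2, R3, R4. }
  assert (GV1 : genv D H Q G S N s1).
  { destruct GV as ((A1 & A2 & A3 & A4) & B1 & B2 & B3 & B4 & B5 & B6 & B7).
    repeat split; rewrite K0 by reflexivity; assumption. }
  assert (Q1 : vr s1 rT1 = T1) by (rewrite K0 by reflexivity; assumption).
  assert (Q2 : vr s1 rT2 = T2) by (rewrite K0 by reflexivity; assumption).
  assert (Q3 : vr s1 rp1 = p1) by (rewrite K0 by reflexivity; assumption).
  assert (Q4 : vr s1 rp2 = p2) by (rewrite K0 by reflexivity; assumption).
  assert (Q5 : vr s1 rnx = nx) by (rewrite K0 by reflexivity; assumption).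
  assert (Q6 : vr s1 rl1 = l1) by (rewrite F1 by reflexivity; reflexivity).
  assert (Q7 : vr s1 rl2 = l2) by (rewrite F1 by reflexivity; reflexivity).
  assert (Q8 : vr s1 rbd = l1 + l2) by (rewrite F1 by reflexivity; reflexivity).
  assert (O1' : forall a, hp s1 a = hp s a) by exact O1.
  assert (HM4 : 4 <= M) by (apply (M_4 _ _ _ _ _ _ _ _ PE)).
  assert (Hdd : 1 <= D) by (pose proof (D_big _ _ _ _ _ (ge_num _ _ _ _ _ _ _ _ _ GE)); lia).
  apply wp_seq. apply (twiddle_spec _ _ _ _ _ _ _ _ PE s1 (2 * S)).
  { apply GV1. }
  { apply GV1. }
  { exact EM. }
  intros s2 t2 F2 Ht2 C2 O2.
  assert (S2 : same s1 s2) by (eapply keeps_same; [|exact F2]; reflexivity).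
  apply wp_seq. apply (lf_spec m M Hm2 eq_refl HMMx rp1 _ (l1 + 1)).
  { reflexivity. }
  { eapply genv_same; eauto. }
  { rewrite S2 by reflexivity; exact EM. }
  { right. rewrite S2 by reflexivity. lia. }
  { rewrite S2 by reflexivity. lia. }
  { intros s' Hs. cbn [eval opf]. rewrite Hs, S2, Q6 by reflexivity. reflexivity. }
  { lia. }
  { costs. lia. }
  { intros i Hi. rewrite S2, Q3, O2, O1' by (reflexivity || lia). apply HW1. lia. }
  { exact C2. }
  intros s3 t3 S3 Ht3 X3 C3 O3.
  assert (S13 : same s1 s3) by (eapply same_trans; eauto).
  set (f := fun i => hp s (p1 + i) * ind (i <? l1 + 1)).
  assert (C3' : carr D (hp s3) (vr s3 rX) M (dftz Qz m (inz Qz f))).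
  { replace (inz Qz f) with (inz Qz (fun i => hp s2 (vr s2 rp1 + i) * ind (i <? l1 + 1))); [exact C3|].
    unfold inz, f. apply FunctionalExtensionality.functional_extensionality. intros i.
    rewrite S2, Q3, O2, O1' by (reflexivity || lia). reflexivity. }
  assert (CT3 : carr D (hp s3) (2 * S) M (twz Qz m)).
  { apply carr_ext with (h := hp s2); [|exact C2]. intros a Ha. apply O3. lia. }
  apply wp_seq. apply (copyc_spec _ _ _ _ _ _ _ _ PE rP rX s3 (5 * S) (vr s3 rX) (dftz Qz m (inz Qz f))).
  1, 2: discriminate.
  { rewrite S13 by reflexivity; exact EM. }
  { rewrite S13 by reflexivity. apply GV1. }
  { reflexivity. }
  { exact C3'. }
  { unfold disj. lia. }
  intros s4 t4 F4 Ht4 C4 O4.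
  assert (S14 : same s1 s4).
  { eapply same_trans; [exact S13|]. eapply keeps_same; [|exact F4]. reflexivity. }
  assert (CT4 : carr D (hp s4) (2 * S) M (twz Qz m)).
  { apply carr_ext with (h := hp s3); [|exact CT3]. intros a Ha. apply O4. lia. }
  assert (O14 : forall a, a < 2 * S \/ 6 * S <= a -> hp s4 a = hp s a).
  { intros a Ha. rewrite O4, O3, O2, O1' by lia. reflexivity. }
  apply wp_seq. apply (lf_spec m M Hm2 eq_refl HMMx rp2 _ (l2 + 1)).
  { reflexivity. }
  { eapply genv_same; eauto. }
  { rewrite S14 by reflexivity; exact EM. }
  { right. rewrite S14 by reflexivity. lia. }
  { rewrite S14 by reflexivity. lia. }
  { intros s' Hs. cbn [eval opf]. rewrite Hs, S14, Q7 by reflexivity. reflexivity. }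
  { lia. }
  { costs. lia. }
  { intros i Hi. rewrite S14, Q4, O14 by (reflexivity || lia). apply HW2. lia. }
  { exact CT4. }
  intros s5 t5 S5 Ht5 X5 C5 O5.
  assert (S15 : same s1 s5) by (eapply same_trans; eauto).
  set (g := fun i => hp s (p2 + i) * ind (i <? l2 + 1)).
  assert (C5' : carr D (hp s5) (vr s5 rX) M (dftz Qz m (inz Qz g))).
  { replace (inz Qz g) with (inz Qz (fun i => hp s4 (vr s4 rp2 + i) * ind (i <? l2 + 1))); [exact C5|].
    unfold inz, g. apply FunctionalExtensionality.functional_extensionality. intros i.
    rewrite S14, Q4, O14 by (reflexivity || lia). reflexivity. }
  assert (CP5 : carr D (hp s5) (5 * S) M (dftz Qz m (inz Qz f))).
  { apply carr_ext with (h := hp s4); [|exact C4]. intros a Ha. apply O5. lia. }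
  assert (CT5 : carr D (hp s5) (2 * S) M (twz Qz m)).
  { apply carr_ext with (h := hp s4); [|exact CT4]. intros a Ha. apply O5. lia. }
  assert (Hf : forall i, f i <= 1).
  { intros i. unfold f, ind. destruct (Nat.ltb_spec i (l1 + 1)); [|lia]. specialize (HW1 i). lia. }
  assert (Hg : forall i, g i <= 1).
  { intros i. unfold g, ind. destruct (Nat.ltb_spec i (l2 + 1)); [|lia]. specialize (HW2 i). lia. }
  destruct (M_facts m M Hm2 eq_refl HMMx) as (M1 & M2 & M3 & M4'). fold Qz in M4'.
  pose proof (Hz_big _ _ _ _ _ _ _ _ PE) as HZ. fold Qz in HZ. fold M in HZ.
  assert (E2p : (Z.of_nat M ^ 2 <= Z.of_nat M ^ 3)%Z) by (apply Z.pow_le_mono_r; lia).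
  assert (E3p : (Z.of_nat M ^ 3 = Z.of_nat M ^ 2 * Z.of_nat M)%Z) by ring.
  assert (E22 : (Z.of_nat M ^ 2 = Z.of_nat M * Z.of_nat M)%Z) by ring.
  assert (EP : (0 < Z.of_nat M ^ 3 * (Qz * Qz))%Z).
  { apply Z.mul_pos_pos; [apply Z.pow_pos_nonneg; lia|apply Z.mul_pos_pos; assumption]. }
  assert (EQQ : (0 < Qz * Qz)%Z) by (apply Z.mul_pos_pos; assumption).
  assert (E35 : (8 * (Z.of_nat M ^ 3 * (Qz * Qz)) <= Z.of_nat M ^ 5 * (Qz * Qz))%Z).
  { rewrite Z.mul_assoc. apply Z.mul_le_mono_nonneg_r; [apply Z.lt_le_incl, EQQ|exact M3]. }
  apply wp_seq. apply (mulc_spec _ _ _ _ _ _ _ _ PE s5 (5 * S) (vr s5 rX) (dftz Qz m (inz Qz f))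
    (dftz Qz m (inz Qz g)) (2 * Z.of_nat M * Qz) (2 * Z.of_nat M * Qz)).
  { eapply genv_same; eauto. }
  { rewrite S15 by reflexivity; exact EM. }
  { rewrite S15 by reflexivity. apply GV1. }
  { reflexivity. }
  { exact CP5. }
  { exact C5'. }
  { unfold disj. lia. }
  { intros i Hi. apply (fwd_small m M Hm2 eq_refl HMMx); auto. }
  { intros i Hi. apply (fwd_small m M Hm2 eq_refl HMMx); auto. }
  { replace (2 * (2 * Z.of_nat M * Qz * (2 * Z.of_nat M * Qz)))%Z
      with (8 * (Z.of_nat M ^ 2 * (Qz * Qz)))%Z by ring.
    assert (Z.of_nat M ^ 2 * (Qz * Qz) <= Z.of_nat M ^ 3 * (Qz * Qz))%Z
      by (apply Z.mul_le_mono_nonneg_r; [apply Z.lt_le_incl, EQQ|exact E2p]). lia. }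
  intros s6 t6 F6 Ht6 C6 O6.
  assert (S16 : same s1 s6).
  { eapply same_trans; [exact S15|]. eapply keeps_same; [|exact F6]. reflexivity. }
  assert (CT6 : carr D (hp s6) (2 * S) M (twz Qz m)).
  { apply carr_ext with (h := hp s5); [|exact CT5]. intros a Ha. apply O6. lia. }
  assert (O16 : forall a, a < 2 * S \/ 6 * S <= a -> hp s6 a = hp s a).
  { intros a Ha. rewrite O6, O5, O14 by lia. reflexivity. }
  assert (EA : vr s6 rA = S) by (rewrite S16 by reflexivity; apply GV1).
  apply wp_seq. apply (lf_spec m M Hm2 eq_refl HMMx rA _ (l1 + l2 + 1)).
  { reflexivity. }
  { eapply genv_same; eauto. }
  { rewrite S16 by reflexivity; exact EM. }
  { left. lia. }
  { lia. }
  { intros s' Hs. cbn [eval opf]. rewrite Hs, S16, Q8 by reflexivity. reflexivity. }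
  { lia. }
  { costs. lia. }
  { intros i Hi. rewrite EA, O16 by lia. apply HA. lia. }
  { exact CT6. }
  intros s7 t7 S7 Ht7 X7 C7 O7.
  assert (S17 : same s1 s7) by (eapply same_trans; eauto).
  set (h := fun i => hp s6 (S + i) * ind (i <? l1 + l2 + 1)).
  assert (C7' : carr D (hp s7) (vr s7 rX) M (dftz Qz m (inz Qz h))).
  { rewrite EA in C7. exact C7. }
  assert (Hh : forall i, h i <= 1).
  { intros i. unfold h, ind. destruct (Nat.ltb_spec i (l1 + l2 + 1)); [|lia].
    rewrite O16 by lia. specialize (HA i). lia. }
  assert (CP7 : carr D (hp s7) (5 * S) M (fun i => cmulz Qz (dftz Qz m (inz Qz f) i) (dftz Qz m (inz Qz g) i))).
  { apply carr_ext with (h := hp s6); [|exact C6]. intros a Ha. apply O7. lia. }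
  assert (CT7 : carr D (hp s7) (2 * S) M (twz Qz m)).
  { apply carr_ext with (h := hp s6); [|exact CT6]. intros a Ha. apply O7. lia. }
  apply wp_seq. apply (mulc_spec _ _ _ _ _ _ _ _ PE s7 (5 * S) (vr s7 rX)
    (fun i => cmulz Qz (dftz Qz m (inz Qz f) i) (dftz Qz m (inz Qz g) i))
    (dftz Qz m (inz Qz h)) (2 * Z.of_nat M ^ 2 * Qz) (2 * Z.of_nat M * Qz)).
  { eapply genv_same; eauto. }
  { rewrite S17 by reflexivity; exact EM. }
  { rewrite S17 by reflexivity. apply GV1. }
  { reflexivity. }
  { exact CP7. }
  { exact C7'. }
  { unfold disj. lia. }
  { intros i Hi. apply (prod2_small m M Hm2 eq_refl HMMx f g Hf Hg i Hi). }
  { intros i Hi. apply (fwd_small m M Hm2 eq_refl HMMx); auto. }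
  { replace (2 * (2 * Z.of_nat M ^ 2 * Qz * (2 * Z.of_nat M * Qz)))%Z
      with (8 * (Z.of_nat M ^ 3 * (Qz * Qz)))%Z by ring. lia. }
  intros s8 t8 F8 Ht8 C8 O8.
  change (fun i => cmulz Qz (cmulz Qz (dftz Qz m (inz Qz f) i) (dftz Qz m (inz Qz g) i))
    (dftz Qz m (inz Qz h) i)) with (prodz Qz m f g h) in C8.
  assert (S18 : same s1 s8).
  { eapply same_trans; [exact S17|]. eapply keeps_same; [|exact F8]. reflexivity. }
  assert (CT8 : carr D (hp s8) (2 * S) M (twz Qz m)).
  { apply carr_ext with (h := hp s7); [|exact CT7]. intros a Ha. apply O8. lia. }
  assert (EX0 : vr s8 rX0 = 3 * S) by (rewrite S18 by reflexivity; apply GV1).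
  assert (EY0 : vr s8 rY0 = 4 * S) by (rewrite S18 by reflexivity; apply GV1).
  apply wp_seq, wp_asg; cbn [eval]; rewrite EX0; [lia|].
  apply wp_seq, wp_asg; cbn [eval vr setv upd Nat.eqb]; rewrite EY0; [lia|].
  match goal with |- wp _ _ ?st _ => set (s9 := st) end.
  assert (S19 : same s1 s9) by (repeat apply same_set; auto).
  apply wp_seq. apply (copyc_spec _ _ _ _ _ _ _ _ PE rX rP s9 (3 * S) (5 * S) (prodz Qz m f g h)).
  1, 2: discriminate.
  { rewrite S19 by reflexivity; exact EM. }
  { reflexivity. }
  { rewrite S19 by reflexivity. apply GV1. }
  { exact C8. }
  { unfold disj. lia. }
  intros s10 t10 F10 Ht10 C10 O10.
  assert (S110 : same s1 s10).
  { eapply same_trans; [exact S19|]. eapply keeps_same; [|exact F10]. reflexivity. }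
  apply wp_seq. apply (fft_spec _ _ _ _ _ _ _ _ PE s10 (2 * S) (3 * S) (4 * S) (prodz Qz m f g h)).
  { eapply genv_same; eauto. }
  { rewrite S110 by reflexivity. apply GV1. }
  { rewrite S110 by reflexivity; exact EM. }
  { rewrite F10 by reflexivity. reflexivity. }
  { rewrite F10 by reflexivity. reflexivity. }
  1, 2: lia.
  1, 2, 3: unfold disj; fold M; lia.
  { apply carr_ext with (h := hp s8); [|exact CT8]. intros a Ha. fold M in Ha. apply O10. lia. }
  { exact C10. }
  { intros l i Hl Hi. apply (inv_small m M Hm2 eq_refl HMMx f g h Hf Hg Hh l i Hl Hi). }
  intros s11 t11 F11 Ht11 X11 C11 O11.
  assert (S111 : same s1 s11).
  { eapply same_trans; [exact S110|]. eapply keeps_same; [|exact F11]. reflexivity. }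
  assert (GV11 : genv D H Q G S N s11) by (eapply genv_same; eauto).
  assert (EN11 : vr s11 rN = N) by apply GV11.
  assert (ET11 : vr s11 rT1 = T1 /\ vr s11 rT2 = T2) by (split; rewrite S111 by reflexivity; assumption).
  destruct ET11 as [ET11 ET12].
  apply (f_equal (fun o => match o with Some x => x | None => 0 end)) in Xoff.
  apply (f_equal (fun o => match o with Some x => x | None => 0 end)) in Xl3.
  cbv beta iota in Xoff, Xl3.
  apply wp_seq, wp_asg; cbn [eval opf]; rewrite EN11, ET11, ET12, Xoff; [clear Xoff Xl3; lia|].
  apply wp_seq, wp_asg; cbn [eval opf vr hp setv upd Nat.eqb]; rewrite EN11, ET11, ET12, Xl3;
    clear Xoff Xl3; [lia|].
  match goal with |- wp _ _ ?st _ => set (s12 := st) end.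
  apply (output_spec m M Hm2 eq_refl HMMx s12 f g h (vr s11 rX) (l3 + 1) nx off); auto.
  { unfold s12. cbn [vr setv upd Nat.eqb]. rewrite S111 by reflexivity. exact EM. }
  { unfold s12. cbn [vr setv upd Nat.eqb]. rewrite S111 by reflexivity. exact Q5. }
  1, 2: lia.
  { lia. }
  intros s13 t13 F13 Ht13 B13 O13.
  split; [|split].
  - exists m. fold M. split; [exact HMb|].
    assert (L1 : l3 + 1 <= M) by lia.
    assert (X1 : m * 4 <= m * M) by (apply Nat.mul_le_mono_l; lia).
    assert (X2 : 2 * M <= m * M) by (apply Nat.mul_le_mono_r; lia).
    rewrite Nat.mul_add_distr_l in Ht2, Ht3, Ht5, Ht7, Ht11.
    revert Ht1 Ht2 Ht3 Ht4 Ht5 Ht6 Ht7 Ht8 Ht10 Ht11 Ht13 L1 X1 X2 Hm2 HM4.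
    fold M. replace (m * (300 * M)) with (300 * (m * M)) by lia.
    replace (m * (100 * b)) with (100 * (m * b)) by lia.
    clear. set (mM := m * M). set (mb := m * b). clearbody mM mb M.
    intros. costs. lia.
  - intros i Hi. destruct (B13 i ltac:(lia)) as [Y1 Y2]. split; [exact Y1|].
    rewrite Y2. split.
    + intros (x & y & z & Hx & Hy & Hz & A1 & A2 & A3 & A4).
      unfold f, ind in A1. destruct (Nat.ltb_spec x (l1 + 1)); [|lia].
      unfold g, ind in A2. destruct (Nat.ltb_spec y (l2 + 1)); [|lia].
      unfold h, ind in A3. destruct (Nat.ltb_spec z (l1 + l2 + 1)); [|lia].
      rewrite O16 in A3 by lia. rewrite Nat.mod_small in A4 by lia.
      exists x, y, z. repeat split; lia.
    + intros (x & y & z & Hx & Hy & Hz & A1 & A2 & A3 & A4).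
      exists x, y, z. unfold f, g, h, ind.
      rewrite O16 by lia. rewrite A1, A2, A3.
      rewrite (proj2 (Nat.ltb_lt x (l1 + 1))), (proj2 (Nat.ltb_lt y (l2 + 1))),
        (proj2 (Nat.ltb_lt z (l1 + l2 + 1))) by lia.
      rewrite Nat.mod_small by lia. repeat split; lia.
  - intros a Ha1 Ha2. rewrite O13 by lia. unfold s12. cbn [hp setv].
    rewrite O11, O10 by (fold M; lia). unfold s9. cbn [hp setv].
    rewrite O8, O7 by lia. apply O16. exact Ha1.
Qed.
End Windows.

(** * Representable numbers *)

Section Weights.
Variables (n : nat) (a : nat -> nat).

Definition wgt (z : nat) : Prop := exists i, i <= n /\ a i = z.

Lemma fold_sum_ext (f g : nat -> nat) l :
  (forall i, In i l -> f i = g i) ->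
  fold_right (fun i s => f i + s) 0 l = fold_right (fun i s => g i + s) 0 l.
Proof. induction l; simpl; intros H; [reflexivity|]. rewrite H, IHl; auto. Qed.

Lemma fold_sum_plus (f g : nat -> nat) l :
  fold_right (fun i s => f i + g i + s) 0 l =
  fold_right (fun i s => f i + s) 0 l + fold_right (fun i s => g i + s) 0 l.
Proof. induction l; simpl; auto. rewrite IHl. lia. Qed.

Lemma fold_sum_0 (f : nat -> nat) l :
  (forall i, In i l -> f i = 0) -> fold_right (fun i s => f i + s) 0 l = 0.
Proof. induction l; simpl; intros H; auto. rewrite H, IHl; auto. Qed.

Lemma fold_sum_single (f : nat -> nat) j l :
  NoDup l -> In j l -> (forall i, i <> j -> f i = 0) ->
  fold_right (fun i s => f i + s) 0 l = f j.
Proof.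
  intros ND Hj H0. induction l as [|x l IH]; [destruct Hj|].
  inversion_clear ND. simpl. destruct Hj as [->|Hj].
  - rewrite fold_sum_0; [lia|]. intros i Hi. apply H0. intros ->. auto.
  - rewrite IH by auto. rewrite H0; [lia|]. intros ->. auto.
Qed.

Lemma rep_0 : representable n a 0.
Proof.
  exists (fun _ => 0). unfold lin_comb. apply fold_sum_0. intros; lia.
Qed.

Lemma rep_add s t : representable n a s -> representable n a t -> representable n a (s + t).
Proof.
  intros [x <-] [y <-]. exists (fun i => x i + y i). unfold lin_comb.
  rewrite <- fold_sum_plus. apply fold_sum_ext. intros; lia.
Qed.

Lemma rep_wgt z : wgt z -> representable n a z.
Proof.
  intros (j & Hj & <-). exists (fun i => if i =? j then 1 else 0). unfold lin_comb.
  rewrite (fold_sum_single (fun i => a i * (if i =? j then 1 else 0)) j).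
  - rewrite Nat.eqb_refl. lia.
  - apply seq_NoDup.
  - apply in_seq. lia.
  - intros i Hi. rewrite (proj2 (Nat.eqb_neq i j) Hi). lia.
Qed.

Lemma rep_mul z k : representable n a z -> representable n a (k * z).
Proof. intros H. induction k; simpl; [apply rep_0|apply rep_add; auto]. Qed.

Lemma rep_list t :
  representable n a t <-> exists l, (forall z, In z l -> wgt z) /\ list_sum l = t.
Proof.
  split.
  - intros [x <-].
    enough (H : forall idx, (forall i, In i idx -> i <= n) ->
      exists l, (forall z, In z l -> wgt z) /\
        list_sum l = fold_right (fun i s => a i * x i + s) 0 idx).
    { apply H. intros i Hi. apply in_seq in Hi. lia. }
    induction idx as [|i idx IH]; intros Hidx.
    + exists []. split; [intros z []|reflexivity].
    + destruct IH as (l & Hl & E); [intros; apply Hidx; simpl; auto|].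
      exists (repeat (a i) (x i) ++ l). split.
      * intros z Hz. apply in_app_or in Hz as [Hz|Hz]; auto.
        apply repeat_spec in Hz. exists i. split; [apply Hidx; simpl; auto|auto].
      * rewrite list_sum_app, E. cbn [fold_right]. f_equal.
        induction (x i) as [|k IHk]; [simpl; lia|].
        change (a i + list_sum (repeat (a i) k) = a i * S k). lia.
  - intros (l & Hl & <-). induction l as [|z l IH]; [apply rep_0|].
    change (representable n a (z + list_sum l)).
    apply rep_add; [apply rep_wgt, Hl; simpl; auto|].
    apply IH. intros; apply Hl; simpl; auto.
Qed.

(* Add the summands of a representation of [t] one after the other until the
   threshold [x] is passed. *)
Lemma rep_split t x :
  representable n a t -> x <= t ->
  exists p z q, representable n a p /\ representable n a q /\ (z = 0 \/ wgt z) /\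
    p + z + q = t /\ p <= x <= p + z.
Proof.
  intros Ht. apply rep_list in Ht as (l & Hl & <-). revert x.
  induction l as [|y l IH]; intros x Hx.
  - simpl in Hx. exists 0, 0, 0. repeat split; auto using rep_0; simpl; lia.
  - change (list_sum (y :: l)) with (y + list_sum l) in *.
    assert (Rl : representable n a (list_sum l)).
    { apply rep_list. exists l. split; auto. intros; apply Hl; simpl; auto. }
    destruct (Nat.lt_ge_cases x y) as [Hxy|Hxy].
    + exists 0, y, (list_sum l). repeat split; auto using rep_0; try lia.
      right. apply Hl; simpl; auto.
    + destruct (IH (fun z Hz => Hl z (or_intror Hz)) (x - y)) as (p & z & q & Hp & Hq & Hz & E & B);
        [lia|].
      exists (y + p), z, q. repeat split; auto; try lia.
      apply rep_add; auto. apply rep_wgt, Hl; simpl; auto.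
Qed.

Variable N : nat.
Hypothesis EN : a n = N.
Hypothesis Hval : valid_weights n a.
Hypothesis Ha0 : 2 <= a 0.

Lemma weight_mono i j : i <= j -> j <= n -> a i <= a j.
Proof.
  intros Hij Hj. induction Hij as [|j Hij IH]; auto.
  destruct Hval as [_ H]. specialize (H j ltac:(lia)). specialize (IH ltac:(lia)). lia.
Qed.

Lemma weight_ge i : i <= n -> a 0 + i <= a i.
Proof.
  induction i as [|i IH]; intros Hi; [lia|].
  destruct Hval as [_ H]. specialize (H i ltac:(lia)). specialize (IH ltac:(lia)). lia.
Qed.

Lemma wgt_bounds z : wgt z -> 2 <= z <= N.
Proof.
  intros (i & Hi & <-). rewrite <- EN. pose proof (weight_mono 0 i). pose proof (weight_mono i n). lia.
Qed.

Lemma N_ge : n + 2 <= N.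
Proof. rewrite <- EN. pose proof (weight_ge n (le_n n)). lia. Qed.

Lemma rep_N : representable n a N.
Proof. apply rep_wgt. exists n. auto. Qed.

Lemma not_rep_1 : ~ representable n a 1.
Proof.
  intros H. apply rep_list in H as (l & Hl & E). destruct l as [|z l]; [discriminate|].
  assert (2 <= z) by (apply wgt_bounds, Hl; simpl; auto).
  change (z + list_sum l = 1) in E. lia.
Qed.

(** The deficit T1 + T2 - t is split into d1 + d2 and the cut is made at T1 - d1. The summand z
    across the cut is at most N, so p falls short of T1 by at most d1 + N and q of T2 by at most d2
    + N; both are at most 3N if d1 and d2 are at most 2N. The condition on the thresholds guarantees
    that such shares exist without exceeding T1 and T2. *)
Lemma window_split T1 T2 t :
  (T1 = T2 \/ (2 * N <= T1 /\ N <= T2)) ->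
  t <= T1 + T2 -> T1 + T2 <= t + 3 * N ->
  (representable n a t <->
   exists p z q, p <= T1 /\ T1 <= p + 3 * N /\ q <= T2 /\ T2 <= q + 3 * N /\
     representable n a p /\ representable n a q /\ (z = 0 \/ wgt z) /\ p + z + q = t).
Proof.
  intros HT H1 H2. split.
  - intros Ht. pose proof N_ge.
    assert (HD : exists d1 d2, d1 + d2 = T1 + T2 - t /\ d1 <= T1 /\ d2 <= T2 /\
      d1 <= 2 * N /\ d2 <= 2 * N).
    (* Equal thresholds share the deficit evenly; otherwise [T2] takes up to N of it and [T1] the
       rest, at most 2N. *)
    { set (d := T1 + T2 - t) in *. destruct HT as [->|[HA HB]].
      - pose proof (Nat.div_mod_eq d 2). pose proof (Nat.mod_upper_bound d 2).
        exists (d / 2), (d - d / 2). lia.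
      - exists (d - Nat.min d N), (Nat.min d N). lia. }
    destruct HD as (d1 & d2 & E & B1 & B2 & B3 & B4).
    destruct (rep_split t (T1 - d1) Ht) as (p & z & q & Hp & Hq & Hz & Es & Bp); [lia|].
    assert (z <= N) by (destruct Hz as [->|Hz]; [lia|apply wgt_bounds in Hz; lia]).
    exists p, z, q. repeat split; auto; lia.
  - intros (p & z & q & _ & _ & _ & _ & Hp & Hq & Hz & <-).
    apply rep_add; auto. apply rep_add; auto.
    destruct Hz as [->|Hz]; [apply rep_0|apply rep_wgt; auto].
Qed.

Variable F : nat.
Hypothesis HF : is_frobenius_number n a F.

Lemma F_pos : 1 <= F.
Proof.
  destruct F; [|lia]. destruct HF as [H _]. destruct H. apply rep_0.
Qed.

(** The N consecutive numbers ending at T meet every residue class modulo N, and adding multiples of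
    N represents everything above them; so F lies below the run. *)
Lemma run_bound T c :
  c = N -> c <= T -> (forall j, j < c -> representable n a (T - j)) -> F + N <= T.
Proof.
  intros -> HT H. pose proof N_ge.
  destruct (Nat.le_gt_cases (F + N) T) as [|Hlt]; auto. exfalso.
  destruct HF as [HnF _]. apply HnF.
  destruct (Nat.le_gt_cases F T) as [Hle|Hgt].
  - replace F with (T - (T - F)) by lia. apply H. lia.
  - set (r := (F - T) mod N). set (k := (F - T) / N).
    pose proof (Nat.div_mod_eq (F - T) N). pose proof (Nat.mod_upper_bound (F - T) N).
    fold r k in H1, H2.
    destruct (Nat.eq_dec r 0) as [Hr|Hr].
    + replace F with (k * N + (T - 0)) by lia.
      apply rep_add; [apply rep_mul, rep_N|apply H; lia].
    (* With a nonzero remainder r, the start N - r below T still belongs to the run. *)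
    + replace F with (S k * N + (T - (N - r))) by lia.
      apply rep_add; [apply rep_mul, rep_N|apply H; lia].
Qed.

Definition iswin (h : nat -> nat) (p T : nat) : Prop :=
  forall i, i <= Nat.min T (3 * N) ->
    h (p + i) <= 1 /\ (h (p + i) = 1 <-> representable n a (T - 3 * N + i)).

Lemma iswin_ext h h' p T :
  (forall x, p <= x <= p + 3 * N -> h' x = h x) -> iswin h p T -> iswin h' p T.
Proof. intros E W i Hi. rewrite E by lia. auto. Qed.

Lemma iswin_top h p T j :
  iswin h p T -> j <= Nat.min T (3 * N) ->
  h (p + (T - (T - 3 * N) - j)) <= 1 /\
  (h (p + (T - (T - 3 * N) - j)) = 1 <-> representable n a (T - j)).
Proof.
  intros W Hj. destruct (W (T - (T - 3 * N) - j)) as [H1 H2]; [lia|].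
  split; auto. rewrite H2. replace (T - 3 * N + (T - (T - 3 * N) - j)) with (T - j) by lia.
  reflexivity.
Qed.

(** All weights are at least 2, so the window of threshold 1 is known in advance; it starts the
    doubling, which a threshold 0 could not. *)
Lemma iswin_1 h p : h p = 1 -> h (p + 1) = 0 -> iswin h p 1.
Proof.
  intros H0 H1 i Hi. pose proof N_ge.
  assert (i = 0 \/ i = 1) as [-> | ->] by lia.
  - rewrite Nat.add_0_r, H0. split; [lia|]. split; auto.
    intros _. replace (1 - 3 * N + 0) with 0 by lia. apply rep_0.
  - rewrite H1. split; [lia|]. split; [discriminate|].
    replace (1 - 3 * N + 1) with 1 by lia. intros H2. destruct (not_rep_1 H2).
Qed.

Lemma iswin_combine h h' p1 p2 p3 pa T1 T2 :
  (T1 = T2 \/ (2 * N <= T1 /\ N <= T2)) ->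
  iswin h p1 T1 -> iswin h p2 T2 ->
  let l1 := Nat.min T1 (3 * N) in
  let l2 := Nat.min T2 (3 * N) in
  let off := (T1 + T2 - 3 * N) - (T1 - 3 * N) - (T2 - 3 * N) in
  (forall i, i <= l1 + l2 -> h (pa + i) = 1 <-> (i = 0 \/ wgt i)) ->
  (forall i, i <= Nat.min (T1 + T2) (3 * N) -> h' (p3 + i) <= 1 /\
     (h' (p3 + i) = 1 <-> exists x y z, x <= l1 /\ y <= l2 /\ z <= l1 + l2 /\
        h (p1 + x) = 1 /\ h (p2 + y) = 1 /\ h (pa + z) = 1 /\ x + y + z = off + i)) ->
  iswin h' p3 (T1 + T2).
Proof.
  intros HT W1 W2 l1 l2 off HA HC i Hi. destruct (HC i Hi) as [C1 C2].
  split; auto. rewrite C2, (window_split T1 T2) by (auto; lia).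
  assert (Eoff : off + (T1 - 3 * N) + (T2 - 3 * N) = T1 + T2 - 3 * N) by (unfold off; clear; lia).
  assert (El1 : T1 = (T1 - 3 * N) + l1) by (unfold l1; clear; lia).
  assert (El2 : T2 = (T2 - 3 * N) + l2) by (unfold l2; clear; lia).
  assert (El3 : off + Nat.min (T1 + T2) (3 * N) = l1 + l2) by (unfold off, l1, l2; clear; lia).
  split.
  - intros (x & y & z & Hx & Hy & Hz & A1 & A2 & A3 & E).
    exists (T1 - 3 * N + x), z, (T2 - 3 * N + y).
    apply W1 in A1; [|exact Hx]. apply W2 in A2; [|exact Hy]. apply HA in A3; [|exact Hz].
    clearbody off. repeat split; auto; lia.
  - intros (p & z & q & B1 & B2 & B3 & B4 & Rp & Rq & Hz & E).
    exists (p - (T1 - 3 * N)), (q - (T2 - 3 * N)), z.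
    assert (X1 : p - (T1 - 3 * N) <= l1) by (unfold l1; clear - B1; lia).
    assert (X2 : q - (T2 - 3 * N) <= l2) by (unfold l2; clear - B3; lia).
    assert (X3 : z <= l1 + l2) by (clearbody off; lia).
    repeat split; auto.
    + apply W1; auto. replace (T1 - 3 * N + (p - (T1 - 3 * N))) with p by (clear - B2; lia). auto.
    + apply W2; auto. replace (T2 - 3 * N + (q - (T2 - 3 * N))) with q by (clear - B4; lia). auto.
    + apply HA; auto.
    + clearbody off. lia.
Qed.

End Weights.

(** * Doubling and bisection *)

Notation rn := 40 (only parsing).
Notation rMx := 41 (only parsing).
Notation rcT := 42 (only parsing).
Notation rcur := 43 (only parsing).
Notation rnext := 44 (only parsing).
Notation rcnt := 45 (only parsing).
Notation rlen := 46 (only parsing).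
Notation rB := 47 (only parsing).
Notation rg := 48 (only parsing).
Notation rpB := 49 (only parsing).
Notation rpG := 50 (only parsing).
Notation rpH := 51 (only parsing).
Notation rhi := 52 (only parsing).
Notation rTn := 53 (only parsing).

(* Weight [i] of the input is found in heap cell [i - 127] when [i >= 127], and in the
   block of cells saved by the prelude when [i < 127]. *)
Definition eaddr (e : expr) : expr :=
  (Num 1 [-] (Num 1 [-] (Num 127 [-] e))) [*] (Num 128 [*] (Var rn [-] Num 1) [+] e) [+]
  (Num 1 [-] (Num 127 [-] e)) [*] (e [-] Num 127).

Definition epow5 : expr := Var rMx [*] Var rMx [*] Var rMx [*] Var rMx [*] Var rMx.
Definition epow11 : expr := epow5 [*] epow5 [*] Var rMx.

(** Register 0 contains 128 n + 126 at this point, from which n is recovered. The block size 128 *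
    Mx is large enough for block 0 to contain the input together with its saved part. Cell 0 of the
    weight block is set to 1 for the empty summand z = 0. *)
Definition setup : cmd :=
  rn ::= (Var 0 [-] Num 126) [/] Num 128 ;;
  rN ::= Ld (eaddr (Var rn)) ;;
  rMx ::= Num 1 ;;
  While (Num 24 [*] Var rN [-] Var rMx) (rMx ::= Num 2 [*] Var rMx) ;;
  rQ ::= epow11 ;;
  rH ::= Num 16 [*] epow5 [*] (Var rQ [*] Var rQ) ;;
  rD ::= Num 2 [*] Var rH ;;
  rG ::= Var rD [-] Var rH [/] Var rQ ;;
  rS ::= Num 128 [*] Var rMx ;;
  rA ::= Var rS ;;
  rT ::= Num 2 [*] Var rS ;;
  rX0 ::= Num 3 [*] Var rS ;;
  rY0 ::= Num 4 [*] Var rS ;;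
  rP ::= Num 5 [*] Var rS ;;
  Sto (Var rS) (Num 1) ;;
  For rk (Var rn [+] Num 1) (Sto (Var rS [+] Ld (eaddr (Var rk))) (Num 1)) ;;
  Sto (Num 6 [*] Var rS) (Num 1) ;;
  rcT ::= Num 1 ;;
  rcur ::= Num 6 [*] Var rS ;;
  rnext ::= Num 7 [*] Var rS.

(* Leaves in [rcnt] the number of consecutive representable numbers, up to [N], found
   when going down from the top of the window of [t] stored at [p]. *)
Definition check (t p : nat) : cmd :=
  rlen ::= elen t ;;
  rcnt ::= Num 0 ;;
  While ((Var rN [-] Var rcnt) [*] Ld (Var p [+] (Var rlen [-] Var rcnt)))
    (rcnt ::= Var rcnt [+] Num 1).

Definition phase1_body : cmd :=
  rT1 ::= Var rcT ;; rT2 ::= Var rcT ;; rp1 ::= Var rcur ;; rp2 ::= Var rcur ;;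
  rnx ::= Var rnext ;;
  add_windows ;;
  rcT ::= Var rcT [+] Var rcT ;;
  rcur ::= Var rnext ;;
  rnext ::= Var rnext [+] Var rS ;;
  check rcT rcur.

(* Bisection between [rB], where the test of [check] fails, and [rhi], where it succeeds;
   [rpG] runs back through the windows of the powers of two computed by the doubling. *)
Definition phase2_body : cmd :=
  rg ::= Var rg [/] Num 2 ;;
  rpG ::= Var rpG [-] Var rS ;;
  rT1 ::= Var rB ;; rT2 ::= Var rg ;; rp1 ::= Var rpB ;; rp2 ::= Var rpG ;;
  rnx ::= Var rnext ;;
  add_windows ;;
  rTn ::= Var rB [+] Var rg ;;
  check rTn rnext ;;
  If (Var rN [-] Var rcnt)
    (rB ::= Var rTn ;; rpB ::= Var rnext)
    (rhi ::= Var rTn ;; rpH ::= Var rnext) ;;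
  rnext ::= Var rnext [+] Var rS.

(** After the bisection the gap is at most 2N and [rB] is below F + N, so F lies less than 3N below
    [rhi], inside its window, and the scan from the top finds it. While the gap exceeds 2N, its half
    is at least N, and [rB], at least half the final power of two, is at least 2N, as unequal
    thresholds require. *)
Definition main_loop : cmd :=
  check rcT rcur ;;
  While (Var rN [-] Var rcnt) phase1_body ;;
  rhi ::= Var rcT ;; rpH ::= Var rcur ;;
  rg ::= Var rcT [/] Num 2 ;; rB ::= Var rcT [/] Num 2 ;;
  rpB ::= Var rcur [-] Var rS ;; rpG ::= Var rcur [-] Var rS ;;
  While (Var rg [-] Num 2 [*] Var rN) phase2_body ;;
  rlen ::= elen rhi ;;
  rcnt ::= Num 0 ;;
  While (Ld (Var rpH [+] (Var rlen [-] Var rcnt))) (rcnt ::= Var rcnt [+] Num 1) ;;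
  0 ::= Var rhi [-] Var rcnt.

(** Here [lam] is log N, [rho] is log (F / N), [J] counts the doublings and [w] is the total length
    of their windows: the first [lam] of them sum to at most 2N, and each of the other J - lam <= 2
    * rho contributes at most 3N. *)
Lemma main_cost N lam rho J w t1 t2 t4 t6 :
  1 <= N -> 1 <= lam -> 1 <= rho -> J - lam <= 2 * rho -> w <= 2 * N + 3 * N * (J - lam) ->
  t1 <= 120 ->
  t2 <= 500 * 1000 * (lam * w) + 20 * J + 20 ->
  t4 <= (J - 1 - lam) * (2000 * 1000 * (lam * N)) + 20 * (J - 1 - lam) + 20 ->
  t6 <= 40 * (3 * N) + 40 ->
  t1 + t2 + t4 + t6 + 200 <= 10 * 1000 * 1000 * (N * lam * rho).
Proof.
  intros HN Hl Hr HJ Hw H1 H2 H4 H6.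
  assert (HJ2 : J <= lam + 2 * rho) by lia.
  assert (HJ3 : J - 1 - lam <= 2 * rho) by lia.
  set (Y := N * lam * rho).
  assert (B2 : w <= 8 * (N * rho)).
  { assert (3 * N * (J - lam) <= 3 * N * (2 * rho)) by (apply Nat.mul_le_mono_l; auto).
    assert (N * 1 <= N * rho) by (apply Nat.mul_le_mono_l; auto). lia. }
  assert (B3 : lam * w <= 8 * Y).
  { unfold Y. replace (8 * (N * lam * rho)) with (lam * (8 * (N * rho))) by lia.
    apply Nat.mul_le_mono_l; auto. }
  assert (B4 : J <= 3 * Y).
  { assert (lam * rho <= Y).
    { unfold Y. rewrite <- Nat.mul_assoc. rewrite <- (Nat.mul_1_l (lam * rho)) at 1.
      apply Nat.mul_le_mono_r. lia. }
    assert (lam * 1 <= lam * rho) by (apply Nat.mul_le_mono_l; auto).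
    assert (1 * rho <= lam * rho) by (apply Nat.mul_le_mono_r; auto). lia. }
  assert (B5 : (J - 1 - lam) * (lam * N) <= 2 * Y).
  { unfold Y. replace (2 * (N * lam * rho)) with ((2 * rho) * (lam * N)) by lia.
    apply Nat.mul_le_mono_r. lia. }
  assert (B6 : N <= Y).
  { unfold Y. rewrite <- Nat.mul_assoc. rewrite <- (Nat.mul_1_r N) at 1.
    apply Nat.mul_le_mono_l. rewrite <- (Nat.mul_1_r 1). apply Nat.mul_le_mono; auto. }
  assert (B10 : J - 1 - lam <= J) by lia.
  set (j2 := J - 1 - lam) in *. clearbody j2 Y.
  replace (j2 * (2000 * 1000 * (lam * N))) with (2000 * 1000 * (j2 * (lam * N))) in H4 by lia.
  set (y := j2 * (lam * N)) in *. set (z := lam * w) in *. clearbody y z.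
  clear - HN H1 H2 H4 H6 B3 B4 B5 B6 B10. lia.
Qed.

(** * Invariants and cost of doubling and bisection *)

Section Main.
Variables (V D H Q G b S Mx N n F : nat) (a : nat -> nat).
Hypothesis GE : glob_env V D H Q G b S Mx N.
Hypothesis EN : a n = N.
Hypothesis Hval : valid_weights n a.
Hypothesis Ha0 : 2 <= a 0.
Hypothesis HF : is_frobenius_number n a F.

Let lam := Nat.log2 N + 1.
Hypothesis Hb : b <= 66 * lam.

Let Rep := representable n a.
Let win := iswin n a N.

Definition aok (h : nat -> nat) : Prop :=
  forall i, i < S -> h (S + i) <= 1 /\ (h (S + i) = 1 <-> (i = 0 \/ wgt n a i)).

Lemma S_facts : 24 * N <= Mx /\ 2 * Mx <= S /\ 6 * S <= V /\ n + 2 <= N /\ 1 <= lam /\ N < 2 ^ lam /\ Mx <= V.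
Proof.
  pose proof (N_ge n a N EN Hval Ha0).
  assert (N < 2 ^ lam) by (unfold lam; rewrite Nat.add_1_r; apply Nat.log2_spec; lia).
  destruct GE. repeat split; auto; unfold lam; lia.
Qed.

Lemma comb_win s T1 T2 p1 p2 nx (P : state -> nat -> Prop) :
  genv D H Q G S N s -> vr s rT1 = T1 -> vr s rT2 = T2 ->
  vr s rp1 = p1 -> vr s rp2 = p2 -> vr s rnx = nx ->
  (T1 = T2 \/ (2 * N <= T1 /\ N <= T2)) ->
  1 <= T1 -> 1 <= T2 -> T1 + T2 <= V ->
  6 * S <= p1 <= V -> 6 * S <= p2 <= V -> 6 * S <= nx ->
  win (hp s) p1 T1 -> win (hp s) p2 T2 -> aok (hp s) ->
  (forall s' t, (forall r, wr add_windows r = false -> vr s' r = vr s r) ->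
     t <= 200 * 1000 * (lam * (Nat.min T1 (3 * N) + Nat.min T2 (3 * N))) ->
     win (hp s') nx (T1 + T2) -> aok (hp s') ->
     (forall p T, 6 * S <= p -> p + S <= nx -> win (hp s) p T -> win (hp s') p T) ->
     P s' t) ->
  wp V add_windows s P.
Proof.
  intros GV E1 E2 E3 E4 E5 HT HT1 HT2 HTV Hp1 Hp2 Hnx W1 W2 HA HP.
  pose proof S_facts as (F1 & F2 & F3 & F4 & F5 & F6 & F7).
  apply (add_windows_spec V D H Q G b S Mx N GE s T1 T2 p1 p2 nx); auto.
  { intros i Hi. apply W1; auto. }
  { intros i Hi. apply W2; auto. }
  { intros i Hi. apply HA. lia. }
  intros s' t Fr (m & Hm & Ht) HC HO.
  apply HP; auto.
  - set (l := Nat.min T1 (3 * N) + Nat.min T2 (3 * N)) in *.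
    assert (Hl : l <= 6 * N) by (unfold l; clear; lia). clearbody l.
    (* From 2^m <= 4 l <= 24 N and N < 2^lam, with 24 rounded up to 32. *)
    assert (Hml : m < lam + 5).
    { apply (Nat.pow_lt_mono_r_iff 2); [lia|]. rewrite Nat.pow_add_r.
      change (2 ^ 5) with 32. lia. }
    assert (Hm2 : m <= 2 ^ m) by (apply Nat.lt_le_incl, Nat.pow_gt_lin_r; lia).
    assert (Hm5 : m <= 5 * lam) by lia.
    assert (X1 : m * 2 ^ m <= (5 * lam) * (4 * l)) by (apply Nat.mul_le_mono; auto).
    (* The square roots cost m * b, which is quadratic in log N. Bounding m by 2^m <= 4 l charges
       one factor to the window length, so short windows stay cheap enough for the geometric
       series. *)
    assert (X2 : m * b <= (4 * l) * (66 * lam)) by (apply Nat.mul_le_mono; auto; lia).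
    clear - Ht X1 X2. nia.
  - apply (iswin_combine n a N EN Hval Ha0 (hp s) (hp s') p1 p2 nx S T1 T2); auto.
    intros i Hi. apply HA. lia.
  - intros i Hi. rewrite HO; [apply HA; auto|left; lia|left; lia].
  - intros p T Hp1' Hp2' W. apply iswin_ext with (h := hp s); auto.
    intros x Hx. apply HO; [right; lia|left; lia].
Qed.

(** The witness is the count at which [check] stops. It stays below T because 1 is not
    representable, so the scan never leaves the window at its lower end. *)
Lemma first_gap T :
  1 <= T -> exists c, c <= N /\ c < T /\ (forall j, j < c -> Rep (T - j)) /\ (c = N \/ ~ Rep (T - c)).
Proof.
  intros HT.
  assert (H0 : forall k, exists c, c <= k /\ (forall j, j < c -> Rep (T - j)) /\ (c = k \/ ~ Rep (T - c))).
  { induction k as [|k (c & C1 & C2 & C3)].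
    - exists 0. repeat split; auto; intros; lia.
    - destruct (classic (Rep (T - c))) as [HR|HR].
      + destruct C3 as [->|C3]; [|contradiction].
        exists (Datatypes.S k). split; [lia|]. split; [|auto]. intros j Hj.
        destruct (Nat.eq_dec j k) as [->|]; auto. apply C2. lia.
      + exists c. split; [lia|]. auto. }
  destruct (H0 N) as (c & C1 & C2 & C3). exists c. repeat split; auto.
  destruct (Nat.lt_ge_cases c T) as [|Hc]; auto. exfalso.
  apply (not_rep_1 n a N EN Hval Ha0).
  replace 1 with (T - (T - 1)) by lia. apply C2. lia.
Qed.

Lemma check_spec tr pr s T p (P : state -> nat -> Prop) :
  tr <> rlen -> tr <> rcnt -> pr <> rlen -> pr <> rcnt ->
  vr s rN = N -> vr s tr = T -> vr s pr = p -> 1 <= T -> win (hp s) p T ->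
  (forall s' t, (forall r, wr (check tr pr) r = false -> vr s' r = vr s r) ->
     (forall x, hp s' x = hp s x) ->
     t <= 60 * Nat.min T (3 * N) + 60 ->
     (vr s' rcnt = N -> F + N <= T) -> (F + N <= T -> vr s' rcnt = N) -> vr s' rcnt <= N -> P s' t) ->
  wp V (check tr pr) s P.
Proof.
  intros T1 T2 P1 P2 ENr ET Ep HT W HP.
  pose proof S_facts as (F1 & F2 & F3 & F4 & F5 & F6 & F7).
  destruct (first_gap T HT) as (c & C1 & C2 & C3 & C4).
  eapply wp_conseq with (Q' := fun s' t => (forall x, hp s' x = hp s x) /\
     t <= 60 * Nat.min T (3 * N) + 60 /\ vr s' rcnt = c).
  2:{ intros s' t Fr (A1 & A2 & A3). apply HP; auto; rewrite A3; auto.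
      - intros E. apply (run_bound n a N EN Hval Ha0 F HF T c E); auto. lia.
      - intros Hd. destruct (Nat.eq_dec c N) as [|Hne]; auto.
        destruct C4 as [|C4]; auto. exfalso. apply C4. apply HF. lia. }
  assert (Hc3 : c <= Nat.min T (3 * N)) by lia.
  unfold check. apply wp_seq, wp_asg; cbn [elen eval opf]; rewrite ET, ENr; [lia|].
  apply wp_seq, wp_asg; cbn [eval]; [lia|].
  set (len := T - (T - 3 * N)).
  match goal with |- wp _ _ ?st _ => set (s0 := st) end.
  assert (B0 : vr s0 rN = N /\ vr s0 rlen = len /\ vr s0 pr = p).
  { unfold s0. cbn [vr setv]. unfold upd at 1 2. repeat split; auto.
    unfold upd. rewrite (proj2 (Nat.eqb_neq pr 45)), (proj2 (Nat.eqb_neq pr 46)); auto. }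
  destruct B0 as (B1 & B2 & B3).
  apply wp_loop with (n := c) (t := fun _ => 10)
    (I := fun i s1 => vr s1 rcnt = i /\ (forall x, hp s1 x = hp s x)).
  - split; reflexivity.
  - intros i s1 Hi [I1 I2] Fr.
    assert (Y1 : vr s1 rN = N) by (rewrite Fr by reflexivity; auto).
    assert (Y2 : vr s1 rlen = len) by (rewrite Fr by reflexivity; auto).
    assert (Y3 : vr s1 pr = p) by (rewrite Fr; auto; cbn [wr]; apply Nat.eqb_neq; auto).
    split.
    + cbn [eval opf]. rewrite Y1, Y2, Y3, I1, I2.
      destruct (iswin_top n a N EN Ha0 (hp s) p T i W) as [_ X]; [lia|]. fold len in X.
      rewrite (proj2 X) by (apply C3; auto). lia.
    + apply wp_asg; cbn [eval opf]; rewrite I1; [lia|].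
      split; [split; [cbn [vr setv upd Nat.eqb]; lia|auto]|]. clear. costs. lia.
  - intros s1 [I1 I2] Fr.
    assert (Y1 : vr s1 rN = N) by (rewrite Fr by reflexivity; auto).
    assert (Y2 : vr s1 rlen = len) by (rewrite Fr by reflexivity; auto).
    assert (Y3 : vr s1 pr = p) by (rewrite Fr; auto; cbn [wr]; apply Nat.eqb_neq; auto).
    cbn [eval opf]. rewrite Y1, Y2, Y3, I1, I2.
    destruct C4 as [->|C4]; [lia|].
    destruct (iswin_top n a N EN Ha0 (hp s) p T c W) as [X1 X]; [lia|]. fold len in X1, X.
    destruct (hp s (p + (len - c))) as [|[|]] eqn:E; [lia| |lia].
    destruct (C4 (proj1 X eq_refl)).
  - intros s1 t [I1 I2] Fr Ht. rewrite nsum_const in Ht.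
    split; [exact I2|]. split; [|exact I1].
    revert Ht Hc3. clear. unfold elen. costs. set (m := Nat.min _ _). clearbody m. lia.
Qed.

Definition Jn := Nat.log2_up (F + N).

Hypothesis HV1 : 2 * (F + N) <= V.
Hypothesis HV2 : (10 + 2 * Jn) * S <= V.

Lemma Jn_spec : 1 <= Jn /\ 2 ^ (Jn - 1) < F + N <= 2 ^ Jn.
Proof.
  pose proof S_facts as (F1 & F2 & F3 & F4 & F5 & F6 & F7).
  pose proof (Nat.log2_up_spec (F + N) ltac:(lia)) as HJ.
  pose proof (Nat.log2_up_pos (F + N) ltac:(lia)).
  unfold Jn. rewrite Nat.sub_1_r. lia.
Qed.

Lemma slot_le k : k <= 10 + 2 * Jn -> k * S <= V.
Proof. intros Hk. etransitivity; [|exact HV2]. apply Nat.mul_le_mono_r. auto. Qed.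

(** The windows of all powers of two are retained, because the bisection adds them again; with the
    windows of the bisection itself this makes about 2 * Jn blocks. *)
Definition ph1 (i : nat) (s : state) : Prop :=
  genv D H Q G S N s /\ aok (hp s) /\
  vr s rcT = 2 ^ i /\ vr s rcur = (6 + i) * S /\ vr s rnext = (7 + i) * S /\
  (forall j, j <= i -> win (hp s) ((6 + j) * S) (2 ^ j)) /\
  (vr s rcnt = N -> F + N <= 2 ^ i) /\ (F + N <= 2 ^ i -> vr s rcnt = N) /\ vr s rcnt <= N.

Lemma phase1_body_spec i s :
  i < Jn -> ph1 i s ->
  wp V phase1_body s (fun s' t => ph1 (Datatypes.S i) s' /\
    t <= 500 * 1000 * (lam * Nat.min (2 ^ i) (3 * N))).
Proof.
  intros Hi (GV & HA & E1 & E2 & E3 & HW & _).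
  pose proof S_facts as (F1 & F2 & F3 & F4 & F5 & F6 & F7).
  pose proof Jn_spec as (J1 & J2 & J3).
  assert (Hp : 1 <= 2 ^ i) by (pose proof (Nat.pow_nonzero 2 i); lia).
  assert (Hle : 2 * 2 ^ i <= V).
  { etransitivity; [|exact HV1]. apply Nat.mul_le_mono_l.
    apply Nat.le_trans with (2 ^ (Jn - 1)); [apply Nat.pow_le_mono_r|]; lia. }
  pose proof (slot_le (6 + i) ltac:(lia)) as V1.
  pose proof (slot_le (7 + i) ltac:(lia)) as V2.
  pose proof (slot_le (8 + i) ltac:(lia)) as V3.
  assert (S6 : 6 * S <= (6 + i) * S) by (apply Nat.mul_le_mono_r; lia).
  assert (S7 : (6 + i) * S + S = (7 + i) * S) by (simpl; lia).
  assert (S8 : (7 + i) * S + S = (8 + i) * S) by (simpl; lia).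
  set (T := 2 ^ i) in *. set (c0 := (6 + i) * S) in *. set (c1 := (7 + i) * S) in *.
  assert (ES : vr s rS = S) by apply GV.
  unfold phase1_body.
  apply wp_seq, wp_asg; cbn [eval]; rewrite E1; [lia|].
  apply wp_seq, wp_asg; cbn [eval vr setv upd Nat.eqb]; rewrite E1; [lia|].
  apply wp_seq, wp_asg; cbn [eval vr setv upd Nat.eqb]; rewrite E2; [lia|].
  apply wp_seq, wp_asg; cbn [eval vr setv upd Nat.eqb]; rewrite E2; [lia|].
  apply wp_seq, wp_asg; cbn [eval vr setv upd Nat.eqb]; rewrite E3; [lia|].
  match goal with |- wp _ _ ?st _ => set (s0 := st) end.
  apply wp_seq. apply (comb_win s0 T T c0 c0 c1); auto.
  all: try exact (HW i (le_n i)).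
  all: try (clearbody c0 c1 T; lia).
  intros s1 t1 Fr Ht1 W1 A1 K1.
  assert (G1 : genv D H Q G S N s1).
  { destruct GV as ((Q1 & Q2 & Q3 & Q4) & B1 & B2 & B3 & B4 & B5 & B6 & B7).
    repeat split; rewrite Fr by reflexivity; assumption. }
  assert (X1 : vr s1 rcT = T) by (rewrite Fr by reflexivity; exact E1).
  assert (X2 : vr s1 rnext = c1) by (rewrite Fr by reflexivity; exact E3).
  assert (X3 : vr s1 rS = S) by (rewrite Fr by reflexivity; exact ES).
  apply wp_seq, wp_asg; cbn [eval opf]; rewrite X1; [lia|].
  apply wp_seq, wp_asg; cbn [eval opf vr setv upd Nat.eqb]; rewrite X2; [lia|].
  apply wp_seq, wp_asg; cbn [eval opf vr setv upd Nat.eqb]; rewrite X2, X3; [lia|].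
  match goal with |- wp _ _ ?st _ => set (s2 := st) end.
  assert (EN2 : vr s2 rN = N) by apply G1.
  apply (check_spec rcT rcur s2 (T + T) c1); try discriminate; auto; [lia|].
  intros s3 t3 Fr3 H3 Ht3 C1 C2 C3.
  assert (E2T : T + T = 2 ^ Datatypes.S i) by (rewrite Nat.pow_succ_r'; unfold T; lia).
  split.
  - assert (G3 : genv D H Q G S N s3).
    { destruct G1 as ((Q1 & Q2 & Q3 & Q4) & B1 & B2 & B3 & B4 & B5 & B6 & B7).
      repeat split; rewrite Fr3 by reflexivity; assumption. }
    split; [exact G3|]. split.
    { intros j Hj. rewrite H3. apply A1; auto. }
    split; [rewrite Fr3 by reflexivity; exact E2T|].
    split; [rewrite Fr3 by reflexivity; reflexivity|].
    split; [rewrite Fr3 by reflexivity; cbn [vr setv s2 upd Nat.eqb]; exact S8|].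
    split; [|rewrite <- E2T; auto].
    intros j Hj. apply (iswin_ext n a N EN Ha0 (hp s1)); [intros; apply H3|].
    destruct (Nat.eq_dec j (Datatypes.S i)) as [->|Hji].
    + rewrite <- E2T. exact W1.
    + apply K1; [| |apply HW; lia].
      * apply Nat.mul_le_mono_r; lia.
      * unfold c1. rewrite <- (Nat.mul_1_l S) at 2. rewrite <- Nat.mul_add_distr_r.
        apply Nat.mul_le_mono_r; lia.
  - set (l := Nat.min T (3 * N)) in *.
    assert (Hl2 : Nat.min (T + T) (3 * N) <= 2 * l) by (unfold l; clear; lia).
    assert (Hl1 : 1 <= l) by (unfold l; lia).
    assert (Hll : l <= lam * l) by (rewrite <- (Nat.mul_1_l l) at 1; apply Nat.mul_le_mono_r; lia).
    rewrite Nat.mul_add_distr_l in Ht1. revert Ht1 Ht3 Hl2 Hl1 Hll. clear.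
    set (u := lam * l). set (l3 := Nat.min _ _). clearbody u l3 l. costs. lia.
Qed.

(** The gap between [rB] and [rhi] is always a power of two, so the window to be added to that of
    [rB] is one kept from the doubling, found one block lower at each pass. *)
Definition ph2 (i : nat) (s : state) : Prop :=
  genv D H Q G S N s /\ aok (hp s) /\
  vr s rg = 2 ^ (Jn - 1 - i) /\ vr s rpG = (5 + Jn - i) * S /\ vr s rnext = (7 + Jn + i) * S /\
  (forall j, j <= Jn -> win (hp s) ((6 + j) * S) (2 ^ j)) /\
  vr s rhi = vr s rB + 2 ^ (Jn - 1 - i) /\ 2 ^ (Jn - 1) <= vr s rB /\
  vr s rB < F + N <= vr s rhi /\ vr s rhi <= 2 ^ Jn /\
  6 * S <= vr s rpB /\ vr s rpB + S <= (7 + Jn + i) * S /\ win (hp s) (vr s rpB) (vr s rB) /\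
  6 * S <= vr s rpH /\ vr s rpH + S <= (7 + Jn + i) * S /\ win (hp s) (vr s rpH) (vr s rhi).

Lemma phase2_body_spec i s :
  i < Jn - 1 -> 2 * N < 2 ^ (Jn - 1 - i) -> ph2 i s ->
  wp V phase2_body s (fun s' t => ph2 (Datatypes.S i) s' /\ t <= 2000 * 1000 * (lam * N)).
Proof.
  intros Hi HgN (GV & HA & Eg & EpG & En & HW & Ehi & HBJ & [HBF HFh] & HhJ & HB1 & HB2 & HB3 & HH1 & HH2 & HH3).
  pose proof S_facts as (F1 & F2 & F3 & F4 & F5 & F6 & F7).
  pose proof Jn_spec as (J1 & J2 & J3).
  set (B := vr s rB) in *. set (hi := vr s rhi) in *. set (pB := vr s rpB) in *. set (pH := vr s rpH) in *.
  assert (Eg2 : 2 ^ (Jn - 1 - i) = 2 * 2 ^ (Jn - 1 - Datatypes.S i))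
    by (rewrite <- Nat.pow_succ_r'; f_equal; lia).
  assert (HgB : 2 ^ (Jn - 1 - i) <= 2 ^ (Jn - 1)) by (apply Nat.pow_le_mono_r; lia).
  assert (HVB : 2 * B <= V) by (clear - HV1 HBF; lia).
  set (g := 2 ^ (Jn - 1 - Datatypes.S i)) in *.
  rewrite Eg2 in *.
  assert (SG : (5 + Jn - i) * S - S = (5 + Jn - Datatypes.S i) * S).
  { replace (5 + Jn - i) with (Datatypes.S (5 + Jn - Datatypes.S i)) by lia. simpl; lia. }
  assert (Sn : (7 + Jn + i) * S + S = (7 + Jn + Datatypes.S i) * S).
  { replace (7 + Jn + Datatypes.S i) with (Datatypes.S (7 + Jn + i)) by lia. simpl; lia. }
  pose proof (slot_le (5 + Jn - i) ltac:(lia)) as V0.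
  pose proof (slot_le (5 + Jn - Datatypes.S i) ltac:(lia)) as V1.
  pose proof (slot_le (7 + Jn + i) ltac:(lia)) as V2.
  pose proof (slot_le (7 + Jn + Datatypes.S i) ltac:(lia)) as V3.
  assert (V4 : 6 * S <= (5 + Jn - Datatypes.S i) * S) by (apply Nat.mul_le_mono_r; lia).
  assert (V5 : forall j, j <= Jn -> 6 * S <= (6 + j) * S /\ (6 + j) * S + S <= (7 + Jn + i) * S).
  { intros j Hj. split; [apply Nat.mul_le_mono_r; lia|].
    rewrite <- (Nat.mul_1_l S) at 2. rewrite <- Nat.mul_add_distr_r. apply Nat.mul_le_mono_r; lia. }
  pose proof (HW (Jn - 1 - Datatypes.S i) ltac:(lia)) as WG.
  replace (6 + (Jn - 1 - Datatypes.S i)) with (5 + Jn - Datatypes.S i) in WG by lia. fold g in WG.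
  set (pG := (5 + Jn - Datatypes.S i) * S) in *. set (nx := (7 + Jn + i) * S) in *.
  set (nx' := (7 + Jn + Datatypes.S i) * S) in *. set (pG0 := (5 + Jn - i) * S) in *.
  assert (V6 : 6 * S <= nx) by (destruct (V5 0 ltac:(lia)); lia).
  assert (ES : vr s rS = S) by apply GV.
  assert (Xg : Some (2 ^ (Jn - 1 - Datatypes.S i)) = Some g) by reflexivity.
  assert (XG : Some ((5 + Jn - Datatypes.S i) * S) = Some pG) by reflexivity.
  assert (Xn : Some ((7 + Jn + Datatypes.S i) * S) = Some nx') by reflexivity.
  clearbody pG nx nx' pG0 g.
  unfold phase2_body.
  apply wp_seq, wp_asg; cbn [eval opf]; rewrite Eg, (Nat.mul_comm 2 g), Nat.div_mul by lia; [lia|].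
  apply wp_seq, wp_asg; cbn [eval opf vr setv upd Nat.eqb]; rewrite EpG, ES, SG; [lia|].
  apply wp_seq, wp_asg; cbn [eval vr setv upd Nat.eqb]; fold B; [lia|].
  apply wp_seq, wp_asg; cbn [eval vr setv upd Nat.eqb]; [lia|].
  apply wp_seq, wp_asg; cbn [eval vr setv upd Nat.eqb]; fold pB; [lia|].
  apply wp_seq, wp_asg; cbn [eval vr setv upd Nat.eqb]; [lia|].
  apply wp_seq, wp_asg; cbn [eval vr setv upd Nat.eqb]; rewrite En; [lia|].
  match goal with |- wp _ _ ?st _ => set (s0 := st) end.
  apply wp_seq. apply (comb_win s0 B g pB pG nx); auto; try (clear - HgN HgB HBJ HB1 HB2 V4 V1 V2 V6 HVB F4; lia).
  intros s1 t1 Fr Ht1 W1 A1 K1.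
  assert (G1 : genv D H Q G S N s1).
  { destruct GV as ((Q1 & Q2 & Q3 & Q4) & B1 & B2 & B3 & B4 & B5 & B6 & B7).
    repeat split; rewrite Fr by reflexivity; assumption. }
  assert (X1 : vr s1 rB = B) by (rewrite Fr by reflexivity; reflexivity).
  assert (X2 : vr s1 rnext = nx) by (rewrite Fr by reflexivity; exact En).
  assert (X3 : vr s1 rS = S) by (rewrite Fr by reflexivity; exact ES).
  assert (X4 : vr s1 rg = g) by (rewrite Fr by reflexivity; reflexivity).
  assert (X5 : vr s1 rpG = pG) by (rewrite Fr by reflexivity; reflexivity).
  assert (X6 : vr s1 rpB = pB) by (rewrite Fr by reflexivity; reflexivity).
  assert (X7 : vr s1 rpH = pH) by (rewrite Fr by reflexivity; reflexivity).
  assert (X8 : vr s1 rhi = hi) by (rewrite Fr by reflexivity; reflexivity).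
  apply wp_seq, wp_asg; cbn [eval opf]; rewrite X1, X4; [lia|].
  match goal with |- wp _ _ ?st _ => set (s2 := st) end.
  assert (EN2 : vr s2 rN = N) by apply G1.
  apply wp_seq.
  apply (check_spec rTn rnext s2 (B + g) nx); try discriminate; auto; [lia|].
  intros s3 t3 Fr3 H3 Ht3 C1 C2 C3.
  assert (G3 : genv D H Q G S N s3).
  { destruct G1 as ((Q1 & Q2 & Q3 & Q4) & B1 & B2 & B3 & B4 & B5 & B6 & B7).
    repeat split; rewrite Fr3 by reflexivity; assumption. }
  assert (Y1 : vr s3 rB = B) by (rewrite Fr3 by reflexivity; exact X1).
  assert (Y2 : vr s3 rnext = nx) by (rewrite Fr3 by reflexivity; exact X2).
  assert (Y3 : vr s3 rS = S) by (rewrite Fr3 by reflexivity; exact X3).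
  assert (Y4 : vr s3 rg = g) by (rewrite Fr3 by reflexivity; exact X4).
  assert (Y5 : vr s3 rpG = pG) by (rewrite Fr3 by reflexivity; exact X5).
  assert (Y6 : vr s3 rpB = pB) by (rewrite Fr3 by reflexivity; exact X6).
  assert (Y7 : vr s3 rpH = pH) by (rewrite Fr3 by reflexivity; exact X7).
  assert (Y8 : vr s3 rhi = hi) by (rewrite Fr3 by reflexivity; exact X8).
  assert (Y9 : vr s3 rTn = B + g) by (rewrite Fr3 by reflexivity; reflexivity).
  assert (YN : vr s3 rN = N) by apply G3.
  assert (A3 : aok (hp s3)) by (intros j Hj; rewrite H3; apply A1; auto).
  assert (E23 : forall p T, win (hp s1) p T -> win (hp s3) p T).
  { intros p T. apply (iswin_ext n a N EN Ha0). intros x _. apply H3. }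
  assert (W3 : win (hp s3) nx (B + g)) by (apply E23; exact W1).
  assert (K3 : forall p T, 6 * S <= p -> p + S <= nx -> win (hp s) p T -> win (hp s3) p T).
  { intros p T P1 P2 P3. apply E23, K1; auto. }
  assert (HWj : forall j, j <= Jn -> win (hp s3) ((6 + j) * S) (2 ^ j)).
  { intros j Hj. destruct (V5 j Hj). apply K3; auto. }
  assert (Tm : forall x, x <= 60 -> 7 + t1 + t3 + x + 60 <= 2000 * 1000 * (lam * N)).
  { intros x Hx. assert (Hll : N <= lam * N) by (rewrite <- (Nat.mul_1_l N) at 1; apply Nat.mul_le_mono_r; lia).
    set (l1 := Nat.min B (3 * N)) in *. set (l2 := Nat.min g (3 * N)) in *.
    set (l3 := Nat.min (B + g) (3 * N)) in *.
    assert (L1 : l1 + l2 <= 6 * N /\ l3 <= 3 * N) by (unfold l1, l2, l3; clear; lia).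
    assert (L2 : lam * (l1 + l2) <= lam * (6 * N)) by (apply Nat.mul_le_mono_l; lia).
    assert (N2 : 1 <= N) by lia.
    revert Ht1 Ht3 L1 L2 N2 Hll Hx. clear. clearbody l1 l2 l3.
    replace (lam * (6 * N)) with (6 * (lam * N)) by lia.
    set (u := lam * N). set (v := lam * (l1 + l2)). clearbody u v. lia. }
  apply wp_seq, wp_if; cbn [eval opf]; rewrite YN; intros Hc.
  - assert (ND : B + g < F + N).
    { destruct (Nat.lt_ge_cases (B + g) (F + N)); auto. rewrite C2 in Hc by auto. lia. }
    apply wp_seq, wp_asg; cbn [eval]; rewrite Y9; [lia|].
    apply wp_asg; cbn [eval vr setv upd Nat.eqb]; rewrite Y2; [lia|].
    apply wp_asg; cbn [eval opf vr setv upd Nat.eqb]; rewrite Y2, Y3; [lia|].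
    split.
    + apply (f_equal (fun o => match o with Some x => x | None => 0 end)) in Xg, XG, Xn.
      cbv beta iota in Xg, XG, Xn. unfold ph2. rewrite Xg, XG, Xn. clear Xg XG Xn. cbn [hp setv].
      split; [exact G3|]. split; [exact A3|].
      cbn [vr setv upd Nat.eqb].
      rewrite ?Y4, ?Y5, ?Y6, ?Y7, ?Y8.
      repeat match goal with |- _ /\ _ => split end; auto; try (clear - Ehi HBJ ND HFh HhJ Sn V6 HB1 HB2 HH1 HH2; lia); try apply HWj; auto.
      all: try (apply K3; auto).
    + costs. specialize (Tm 60 (le_n 60)). clear - Tm. lia.
  - assert (HD : F + N <= B + g) by (apply C1; lia).
    apply wp_seq, wp_asg; cbn [eval]; rewrite Y9; [lia|].
    apply wp_asg; cbn [eval vr setv upd Nat.eqb]; rewrite Y2; [lia|].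
    apply wp_asg; cbn [eval opf vr setv upd Nat.eqb]; rewrite Y2, Y3; [lia|].
    split.
    + apply (f_equal (fun o => match o with Some x => x | None => 0 end)) in Xg, XG, Xn.
      cbv beta iota in Xg, XG, Xn. unfold ph2. rewrite Xg, XG, Xn. clear Xg XG Xn. cbn [hp setv].
      split; [exact G3|]. split; [exact A3|].
      cbn [vr setv upd Nat.eqb].
      rewrite ?Y1, ?Y4, ?Y5, ?Y6, ?Y7, ?Y8.
      repeat match goal with |- _ /\ _ => split end; auto; try (clear - Ehi HBJ HD HBF HhJ Sn V6 HB1 HB2 HH1 HH2; lia); try apply HWj; auto.
      all: try (apply K3; auto).
    + costs. specialize (Tm 60 (le_n 60)). clear - Tm. lia.
Qed.

Lemma nsum_scal J c f : nsum J (fun i => c * f i) = c * nsum J f.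
Proof. induction J; simpl; [lia|]. rewrite IHJ. lia. Qed.

(** A geometric series for the first [lam] windows and the full width 3N afterwards; the induction
    needs the exponent min J lam, since 2^lam is available only once [lam] windows have been
    counted. *)
Lemma nsum_windows J : nsum J (fun i => Nat.min (2 ^ i) (3 * N)) <= 2 ^ lam + 3 * N * (J - lam).
Proof.
  enough (H0 : nsum J (fun i => Nat.min (2 ^ i) (3 * N)) <= 2 ^ Nat.min J lam + 3 * N * (J - lam)).
  { etransitivity; [exact H0|]. apply Nat.add_le_mono_r, Nat.pow_le_mono_r; lia. }
  induction J as [|J IH]; [simpl; lia|].
  cbn [nsum]. destruct (Nat.lt_ge_cases J lam) as [Hl|Hl].
  - rewrite (Nat.min_l J lam) in IH by lia. rewrite (Nat.min_l (Datatypes.S J) lam) by lia.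
    pose proof (Nat.le_min_l (2 ^ J) (3 * N)).
    replace (J - lam) with 0 in IH by lia. replace (Datatypes.S J - lam) with 0 by lia.
    rewrite Nat.pow_succ_r'. lia.
  - rewrite (Nat.min_r J lam) in IH by lia. rewrite (Nat.min_r (Datatypes.S J) lam) by lia.
    pose proof (Nat.le_min_r (2 ^ J) (3 * N)).
    replace (Datatypes.S J - lam) with (Datatypes.S (J - lam)) by lia. lia.
Qed.

Let rho := Nat.log2 (F / N) + 1.

(** From 2^(Jn - 1) < F + N < (F / N + 2) N and N < 2^lam follows Jn <= lam + rho + 1; a second
    [rho] absorbs the 1. *)
Lemma Jn_lam : Jn - lam <= 2 * rho /\ 1 <= rho /\ 2 ^ lam <= 2 * N.
Proof.
  pose proof S_facts as (F1 & F2 & F3 & F4 & F5 & F6 & F7).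
  pose proof Jn_spec as (J1 & J2 & J3).
  assert (Hr : 1 <= rho) by (unfold rho; lia).
  assert (Hq : F / N + 1 <= 2 ^ rho).
  { unfold rho. rewrite Nat.add_1_r. destruct (F / N) as [|q]; [simpl; lia|].
    rewrite (Nat.add_1_r (Nat.log2 _)). apply Nat.log2_spec. lia. }
  assert (HFq : F < (F / N + 1) * N).
  { rewrite Nat.mul_comm, Nat.add_1_r. apply Nat.mul_succ_div_gt. lia. }
  assert (HJ : Jn - 1 < rho + 1 + lam).
  { apply (Nat.pow_lt_mono_r_iff 2); [lia|]. rewrite !Nat.pow_add_r, Nat.pow_1_r.
    eapply Nat.lt_le_trans; [exact J2|].
    apply Nat.le_trans with ((2 ^ rho * 2) * N); [|apply Nat.mul_le_mono_l; lia].
    apply Nat.le_trans with ((F / N + 2) * N); [lia|].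
    apply Nat.mul_le_mono_r. lia. }
  split; [lia|]. split; [exact Hr|].
  unfold lam. rewrite Nat.add_1_r, Nat.pow_succ_r'. apply Nat.mul_le_mono_l.
  apply Nat.log2_spec. lia.
Qed.

Lemma main_loop_spec s (P : state -> nat -> Prop) :
  genv D H Q G S N s -> aok (hp s) ->
  vr s rcT = 1 -> vr s rcur = 6 * S -> vr s rnext = 7 * S -> win (hp s) (6 * S) 1 ->
  (forall s' t, vr s' 0 = F -> t <= 10 * 1000 * 1000 * (N * lam * rho) -> P s' t) ->
  wp V main_loop s P.
Proof.
  intros GV HA E1 E2 E3 W0 HP.
  pose proof S_facts as (F1 & F2 & F3 & F4 & F5 & F6 & F7).
  pose proof Jn_spec as (J1 & J2 & J3).
  pose proof Jn_lam as (L1 & L2 & L3).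
  assert (ENs : vr s rN = N) by apply GV.
  unfold main_loop.
  apply wp_seq. apply (check_spec rcT rcur s 1 (6 * S)); try discriminate; auto.
  intros s1 t1 Fr1 H1 Ht1 C1 C2 C3.
  assert (P1 : ph1 0 s1).
  { unfold ph1. split.
    { destruct GV as ((Q1 & Q2 & Q3 & Q4) & B1 & B2 & B3 & B4 & B5 & B6 & B7).
      repeat split; rewrite Fr1 by reflexivity; assumption. }
    split; [intros j Hj; rewrite H1; apply HA; auto|].
    rewrite !Nat.add_0_r, Nat.pow_0_r.
    split; [rewrite Fr1 by reflexivity; auto|]. split; [rewrite Fr1 by reflexivity; auto|].
    split; [rewrite Fr1 by reflexivity; auto|]. split; [|auto].
    intros j Hj. replace j with 0 by lia. rewrite Nat.add_0_r, Nat.pow_0_r.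
    apply (iswin_ext n a N EN Ha0 (hp s)); auto. }
  apply wp_seq.
  apply wp_loop with (n := Jn) (I := ph1)
    (t := fun i => 500 * 1000 * (lam * Nat.min (2 ^ i) (3 * N))).
  { exact P1. }
  { intros i s2 Hi HI _. split; [|apply phase1_body_spec; auto].
    destruct HI as (G2 & _ & _ & _ & _ & _ & D1 & D2 & D3).
    assert (EN2 : vr s2 rN = N) by apply G2.
    cbn [eval opf]. rewrite EN2. intros E. specialize (D1 ltac:(lia)).
    assert (2 ^ i <= 2 ^ (Jn - 1)) by (apply Nat.pow_le_mono_r; lia). lia. }
  { intros s2 HI _. destruct HI as (G2 & _ & _ & _ & _ & _ & D1 & D2 & D3).
    assert (EN2 : vr s2 rN = N) by apply G2.
    cbn [eval opf]. rewrite EN2, D2 by lia. lia. }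
  intros s2 t2 HI _ Ht2.
  destruct HI as (G2 & A2 & X1 & X2 & X3 & W2 & D1 & D2 & D3).
  assert (ES : vr s2 rS = S) by apply G2.
  assert (EJ : 2 ^ Jn = 2 * 2 ^ (Jn - 1)) by (rewrite <- Nat.pow_succ_r'; f_equal; lia).
  assert (EJ2 : 2 ^ Jn / 2 = 2 ^ (Jn - 1)) by (rewrite EJ, Nat.mul_comm; apply Nat.div_mul; lia).
  pose proof (slot_le (6 + Jn) ltac:(lia)) as V1.
  assert (VJ : 2 ^ Jn <= V) by lia.
  assert (S6 : (6 + Jn) * S - S = (5 + Jn) * S) by (simpl; lia).
  assert (S5 : 6 * S <= (5 + Jn) * S) by (apply Nat.mul_le_mono_r; lia).
  assert (S5' : (5 + Jn) * S + S = (6 + Jn) * S) by (simpl; lia).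
  assert (S7 : (6 + Jn) * S + S = (7 + Jn) * S) by (simpl; lia).
  apply wp_seq, wp_asg; cbn [eval]; rewrite X1; [lia|].
  apply wp_seq, wp_asg; cbn [eval vr setv upd Nat.eqb]; rewrite X2; [lia|].
  apply wp_seq, wp_asg; cbn [eval opf vr setv upd Nat.eqb]; rewrite X1, EJ2; [lia|].
  apply wp_seq, wp_asg; cbn [eval opf vr setv upd Nat.eqb]; rewrite X1, EJ2; [lia|].
  apply wp_seq, wp_asg; cbn [eval opf vr setv upd Nat.eqb]; rewrite X2, ES, S6; [lia|].
  apply wp_seq, wp_asg; cbn [eval opf vr setv upd Nat.eqb]; rewrite X2, ES, S6; [lia|].
  match goal with |- wp _ _ ?st _ => set (s3 := st) end.
  assert (P3 : ph2 0 s3).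
  { unfold ph2, s3. cbn [vr hp setv upd Nat.eqb]. rewrite X3, !Nat.sub_0_r, !Nat.add_0_r.
    split; [exact G2|]. split; [exact A2|].
    repeat match goal with |- _ /\ _ => split end; auto; try lia.
    pose proof (W2 (Jn - 1) ltac:(lia)) as W. replace (6 + (Jn - 1)) with (5 + Jn) in W by lia. exact W. }
  clearbody s3.
  (* Thus 2^lam is the largest power of two not above 2N, and the gap 2^(Jn - 1) needs Jn - 1 - lam
     halvings to reach it. *)
  assert (He : Nat.log2 (2 * N) = lam) by (unfold lam; rewrite Nat.log2_double by lia; lia).
  pose proof (Nat.log2_spec (2 * N) ltac:(lia)) as [He1 He2]. rewrite He in He1, He2.
  apply wp_seq.
  apply wp_loop with (n := Jn - 1 - lam) (I := ph2) (t := fun _ => 2000 * 1000 * (lam * N)).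
  { exact P3. }
  { intros i s4 Hi HI _.
    assert (Hg : 2 * N < 2 ^ (Jn - 1 - i)).
    { eapply Nat.lt_le_trans; [exact He2|]. apply Nat.pow_le_mono_r; lia. }
    split; [|apply phase2_body_spec; auto; lia].
    destruct HI as (G4 & _ & Eg & _). assert (EN4 : vr s4 rN = N) by apply G4.
    cbn [eval opf]. rewrite EN4, Eg. lia. }
  { intros s4 HI _.
    destruct HI as (G4 & _ & Eg & _). assert (EN4 : vr s4 rN = N) by apply G4.
    cbn [eval opf]. rewrite EN4, Eg.
    assert (2 ^ (Jn - 1 - (Jn - 1 - lam)) <= 2 ^ lam) by (apply Nat.pow_le_mono_r; lia). lia. }
  intros s4 t4 HI _ Ht4.
  destruct HI as (G4 & A4 & _ & _ & _ & _ & Ehi & _ & [HB1 HB2] & Hhi & _ & _ & _ & _ & _ & W4).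
  assert (EN4 : vr s4 rN = N) by apply G4.
  set (hi := vr s4 rhi) in *. set (pH := vr s4 rpH) in *.
  assert (Hg : 2 ^ (Jn - 1 - (Jn - 1 - lam)) <= 2 * N).
  { etransitivity; [|exact He1]. apply Nat.pow_le_mono_r; lia. }
  assert (Hc : hi - F <= 3 * N /\ F <= hi) by (clear - Hg HB1 HB2 Ehi; lia).
  assert (HlV : hi - (hi - 3 * N) <= V) by (clear - F1 F7; lia).
  apply wp_seq, wp_asg; cbn [eval elen opf]; rewrite EN4; fold hi; [exact HlV|].
  apply wp_seq, wp_asg; cbn [eval]; [lia|].
  set (len := hi - (hi - 3 * N)).
  match goal with |- wp _ _ ?st _ => set (s5 := st) end.
  set (c := hi - F) in *.
  assert (Hcm : c <= Nat.min hi (3 * N)) by (unfold c in *; clear - Hc; lia).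
  assert (HcV : c <= V) by (clear - Hcm F1 F7; lia).
  assert (HhF : hi - c = F) by (unfold c; clear - Hc; lia).
  assert (HFV : F <= V) by (clear - HV1; lia).
  assert (Hc3 : c <= 3 * N) by apply Hc.
  apply wp_seq.
  apply wp_loop with (n := c) (t := fun _ => 10)
    (I := fun i s6 => vr s6 rcnt = i /\ (forall x, hp s6 x = hp s4 x)).
  { split; reflexivity. }
  { intros i s6 Hi [I1 I2] Fr.
    assert (Y2 : vr s6 rlen = len) by (rewrite Fr by reflexivity; reflexivity).
    assert (Y3 : vr s6 rpH = pH) by (rewrite Fr by reflexivity; reflexivity).
    split.
    - cbn [eval opf]. rewrite Y2, Y3, I1, I2.
      destruct (iswin_top n a N EN Ha0 (hp s4) pH hi i W4) as [_ X];
        [clear - Hi Hcm; lia|]. fold len in X.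
      rewrite (proj2 X); [discriminate|]. apply HF. unfold c in Hi. clear - Hi. lia.
    - apply wp_asg; cbn [eval opf]; rewrite I1; [clear - Hi HcV; lia|].
      split; [split; [cbn [vr setv upd Nat.eqb]; apply Nat.add_1_r|auto]|]. clear. costs. lia. }
  { intros s6 [I1 I2] Fr.
    assert (Y2 : vr s6 rlen = len) by (rewrite Fr by reflexivity; reflexivity).
    assert (Y3 : vr s6 rpH = pH) by (rewrite Fr by reflexivity; reflexivity).
    cbn [eval opf]. rewrite Y2, Y3, I1, I2.
    destruct (iswin_top n a N EN Ha0 (hp s4) pH hi c W4) as [X1' X]; [exact Hcm|].
    fold len in X1', X.
    destruct (hp s4 (pH + (len - c))) as [|[|]] eqn:E; [reflexivity| |clear - X1'; lia].
    exfalso. apply (proj1 HF). rewrite <- HhF. apply X. reflexivity. }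
  intros s6 t6 [I1 I2] Fr Ht6.
  assert (Y1 : vr s6 rhi = hi) by (rewrite Fr by reflexivity; reflexivity).
  apply wp_asg; cbn [eval opf]; rewrite Y1, I1, HhF; [exact HFV|].
  apply HP.
  - reflexivity.
  - rewrite nsum_const in Ht4, Ht6. rewrite nsum_scal, nsum_scal in Ht2.
    pose proof (nsum_windows Jn) as B1.
    set (w := nsum Jn _) in *. clearbody w.
    assert (Z2 : t2 <= 500 * 1000 * (lam * w) + 20 * Jn + 20) by (revert Ht2; clear; costs; lia).
    assert (Z4 : t4 <= (Jn - 1 - lam) * (2000 * 1000 * (lam * N)) + 20 * (Jn - 1 - lam) + 20)
      by (revert Ht4; clear; set (j2 := Jn - 1 - lam); costs; lia).
    assert (Z6 : t6 <= 40 * (3 * N) + 40) by (revert Ht6 Hc3; clear; costs; lia).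
    assert (Z1 : t1 <= 120) by (revert Ht1; clear; lia).
    assert (Z : t1 + t2 + t4 + t6 + 200 <= 10 * 1000 * 1000 * (N * lam * rho)).
    { apply (main_cost N lam rho Jn w); auto; [clear - F4; lia|clear - B1 L3; lia]. }
    revert Z. clear. unfold elen. costs. lia.
Qed.

End Main.

(** * Initialisation and correctness of the program *)

Definition addr (n i : nat) : nat := if i <? 127 then 128 * (n - 1) + i else i - 127.

Lemma eval_eaddr s e n i :
  vr s rn = n -> eval s e = i -> eval s (eaddr e) = addr n i.
Proof.
  intros E1 E2. unfold eaddr, addr. cbn [eval opf]. rewrite E1, E2.
  destruct (Nat.ltb_spec i 127).
  - replace (1 - (1 - (127 - i))) with 1 by lia. replace (1 - (127 - i)) with 0 by lia. lia.
  - replace (1 - (1 - (127 - i))) with 0 by lia. replace (1 - (127 - i)) with 1 by lia. lia.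
Qed.

Section Setup.
Variables (n : nat) (a : nat -> nat) (N F : nat).
Hypothesis EN : a n = N.
Hypothesis Hval : valid_weights n a.
Hypothesis Ha0 : 2 <= a 0.
Hypothesis Hn1 : 1 <= n.
Hypothesis HF : is_frobenius_number n a F.
Hypothesis HFN : F <= 4 * N ^ 3.

Definition mu := Nat.log2_up (24 * N).
Definition gMx := 2 ^ mu.
Definition gQ := gMx ^ 11.
Definition gG := 16 * gMx ^ 5 * gQ.
Definition gH := gQ * gG.
Definition gD := 2 * gH.
Definition gS := 128 * gMx.
Definition gV := gMx ^ 29.

Lemma mu_facts : n + 2 <= N /\ 1 <= mu /\ 24 * N <= gMx /\ gMx < 48 * N /\ 2 ^ (mu - 1) < 24 * N.
Proof.
  pose proof (N_ge n a N EN Hval Ha0).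
  pose proof (Nat.log2_up_spec (24 * N) ltac:(lia)) as [H1 H2]. fold mu in H1, H2.
  pose proof (Nat.log2_up_pos (24 * N) ltac:(lia)) as H3. fold mu in H3.
  rewrite <- Nat.sub_1_r in H1.
  assert (E : gMx = 2 * 2 ^ (mu - 1)) by (unfold gMx; rewrite <- Nat.pow_succ_r'; f_equal; lia).
  fold gMx in H2. repeat split; lia.
Qed.

Lemma pow_Mx_le i j : i <= j -> gMx ^ i <= gMx ^ j.
Proof. intros. apply Nat.pow_le_mono_r; [|auto]. pose proof mu_facts. lia. Qed.

Lemma Mx_mul_pow c i : c <= gMx -> c * gMx ^ i <= gMx ^ S i.
Proof. intros. rewrite Nat.pow_succ_r'. apply Nat.mul_le_mono_r. auto. Qed.

(** [gD] is 32 * gMx^27, with 27 = 11 + 5 + 11 from the two factors [gQ] and from gMx^5; as gMx >=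
    72, two further powers absorb 4 * 32, whence the exponent 29 of [gV]. *)
Lemma gD_eq : 4 * gD <= gV.
Proof.
  pose proof mu_facts as (F1 & F2 & F3 & F4 & F5).
  assert (E : 4 * gD = 128 * gMx ^ 27).
  { unfold gD, gH, gG, gQ. replace 27 with (11 + 5 + 11) by reflexivity.
    rewrite !Nat.pow_add_r. lia. }
  rewrite E. unfold gV.
  apply Nat.le_trans with (72 * (72 * gMx ^ 27)); [lia|].
  apply Nat.le_trans with (72 * gMx ^ 28).
  - apply Nat.mul_le_mono_l, Mx_mul_pow. lia.
  - apply Mx_mul_pow. lia.
Qed.

Lemma gS_le : gMx ^ 10 <= gV /\ (10 + 2 * gMx ^ 3) * gS <= gMx ^ 10 /\ 7 * gS <= gV /\ gMx ^ 3 <= gV /\ gMx <= gV.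
Proof.
  pose proof mu_facts as (F1 & F2 & F3 & F4 & F5).
  assert (A1 : gMx ^ 1 <= gMx ^ 3) by (apply pow_Mx_le; lia).
  rewrite Nat.pow_1_r in A1.
  assert (A2 : (10 + 2 * gMx ^ 3) * gS <= gMx ^ 10).
  { apply Nat.le_trans with ((3 * gMx ^ 3) * gS); [apply Nat.mul_le_mono_r; lia|].
    unfold gS. replace (3 * gMx ^ 3 * (128 * gMx)) with (384 * gMx ^ 4)
      by (change 4 with (3 + 1); rewrite Nat.pow_add_r, Nat.pow_1_r; lia).
    apply Nat.le_trans with (72 * (72 * gMx ^ 4)); [lia|].
    apply Nat.le_trans with (72 * gMx ^ 5); [apply Nat.mul_le_mono_l, Mx_mul_pow; lia|].
    apply Nat.le_trans with (gMx ^ 6); [apply Mx_mul_pow; lia|apply pow_Mx_le; lia]. }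
  assert (A3 : gMx ^ 10 <= gV) by (apply pow_Mx_le; lia).
  assert (A4 : gMx ^ 3 <= gV) by (apply pow_Mx_le; lia).
  assert (A5 : 7 * gS <= (10 + 2 * gMx ^ 3) * gS) by (apply Nat.mul_le_mono_r; lia).
  repeat split; lia.
Qed.

Lemma setup_glob : glob_env gV gD gH gQ gG (11 * mu) gS gMx N.
Proof.
  pose proof mu_facts as (F1 & F2 & F3 & F4 & F5).
  pose proof gS_le as (A1 & A2 & A3 & A4 & A5).
  constructor; try lia; try reflexivity.
  - constructor; try reflexivity; [|lia|].
    + unfold gQ, gMx. rewrite Nat.mul_comm. symmetry. apply Nat.pow_mul_r.
    + unfold gG. rewrite <- (Nat.mul_1_l gQ) at 1. apply Nat.mul_le_mono_r.
      pose proof (Nat.pow_nonzero gMx 5 ltac:(lia)). lia.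
  - unfold gH, gG. lia.
  - apply gD_eq.
  - unfold gS. lia.
Qed.

(** With lam = log2 N + 1 one has mu <= lam + 5 <= 6 * lam, and 66 = 11 * 6. *)
Lemma setup_b : 11 * mu <= 66 * (Nat.log2 N + 1).
Proof.
  pose proof mu_facts as (F1 & F2 & F3 & F4 & F5).
  pose proof (Nat.log2_spec N ltac:(lia)) as [_ HL]. rewrite <- (Nat.add_1_r (Nat.log2 N)) in HL.
  set (lam := Nat.log2 N + 1) in *. assert (1 <= lam) by (unfold lam; lia).
  assert (mu - 1 < 5 + lam).
  { apply (Nat.pow_lt_mono_r_iff 2); [lia|]. rewrite Nat.pow_add_r.
    change (2 ^ 5) with 32. lia. }
  lia.
Qed.

Lemma cube_le : 5 * N ^ 3 <= gMx ^ 3.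
Proof.
  pose proof mu_facts as (F1 & F2 & F3 & F4 & F5).
  apply Nat.le_trans with ((24 * N) ^ 3); [|apply Nat.pow_le_mono_l; auto].
  rewrite Nat.pow_mul_l. apply Nat.mul_le_mono_r. simpl. lia.
Qed.

(** The a priori bound on F enters here: it makes the thresholds, and with them the number of stored
    windows, polynomial in [gMx]. *)
Lemma FN_le : F + N <= gMx ^ 3.
Proof.
  pose proof mu_facts as (F1 & F2 & F3 & F4 & F5). pose proof cube_le.
  assert (N ^ 1 <= N ^ 3) by (apply Nat.pow_le_mono_r; lia). rewrite Nat.pow_1_r in *. lia.
Qed.

Lemma setup_V1 : 2 * (F + N) <= gV.
Proof.
  pose proof FN_le. pose proof mu_facts as (F1 & F2 & F3 & F4 & F5).
  assert (2 * gMx ^ 3 <= gMx ^ 4) by (apply Mx_mul_pow; lia).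
  assert (gMx ^ 4 <= gV) by (apply pow_Mx_le; lia). lia.
Qed.

Lemma setup_V2 : (10 + 2 * Jn N F) * gS <= gV.
Proof.
  pose proof FN_le. pose proof gS_le as (A1 & A2 & _).
  assert (HJ : Jn N F <= F + N).
  { unfold Jn. pose proof (F_pos n a N EN Ha0 F HF). apply Nat.log2_up_le_lin. lia. }
  etransitivity; [|exact A1]. etransitivity; [|exact A2]. apply Nat.mul_le_mono_r. lia.
Qed.

Lemma setup_spec s (P : state -> nat -> Prop) :
  vr s 0 = 128 * n + 126 ->
  (forall i, i <= n -> hp s (addr n i) = a i) ->
  (forall x, 128 * n <= x -> hp s x = 0) ->
  (forall s' t, genv gD gH gQ gG gS N s' -> aok gS n a (hp s') ->
     vr s' rcT = 1 -> vr s' rcur = 6 * gS -> vr s' rnext = 7 * gS ->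
     iswin n a N (hp s') (6 * gS) 1 ->
     t <= 200 * N + 100 * mu + 1000 -> P s' t) ->
  wp gV setup s P.
Proof.
  intros E0 Hin Hz HP.
  pose proof mu_facts as (F1 & F2 & F3 & F4 & F5).
  pose proof gS_le as (A1 & A2 & A3 & A4 & A5).
  pose proof gD_eq as HD. pose proof (D_big _ _ _ _ _ (ge_num _ _ _ _ _ _ _ _ _ setup_glob)) as (D8 & DG & DQ & DQ2).
  assert (HDD : gD = 2 * gH) by reflexivity.
  unfold setup.
  assert (En : (128 * n + 126 - 126) / 128 = n).
  { rewrite Nat.add_sub, Nat.mul_comm. apply Nat.div_mul. lia. }
  apply wp_seq, wp_asg; cbn [eval opf]; rewrite E0, En; [lia|].
  match goal with |- wp _ _ ?st _ => set (s1 := st) end.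
  assert (Ev : eval s1 (Ld (eaddr (Var rn))) = N).
  { cbn [eval]. rewrite (eval_eaddr s1 (Var rn) n n) by reflexivity. unfold s1. cbn [hp setv].
    rewrite Hin by lia. exact EN. }
  apply wp_seq, wp_asg; rewrite Ev; [lia|].
  apply wp_seq, wp_asg; cbn [eval]; [lia|].
  match goal with |- wp _ _ ?st _ => set (s2 := st) end.
  apply wp_seq.
  apply wp_loop with (n := mu) (t := fun _ => 10)
    (I := fun i s' => vr s' rMx = 2 ^ i /\ (forall x, hp s' x = hp s x)).
  { split; reflexivity. }
  { intros i s3 Hi [I1 I2] Fr.
    assert (Y1 : vr s3 rN = N) by (rewrite Fr by reflexivity; reflexivity).
    assert (Hpi : 2 ^ i <= 2 ^ (mu - 1)) by (apply Nat.pow_le_mono_r; lia).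
    assert (EM : gMx = 2 * 2 ^ (mu - 1)) by (unfold gMx; rewrite <- Nat.pow_succ_r'; f_equal; lia).
    cbn [eval opf]. rewrite Y1, I1. split; [lia|].
    apply wp_asg; cbn [eval opf]; rewrite I1; [lia|].
    split; [split; [cbn [vr setv upd Nat.eqb]; now rewrite Nat.pow_succ_r'|exact I2]|].
    clear. costs. lia. }
  { intros s3 [I1 I2] Fr.
    assert (Y1 : vr s3 rN = N) by (rewrite Fr by reflexivity; reflexivity).
    cbn [eval opf]. rewrite Y1, I1. fold gMx. lia. }
  intros s3 t3 [I1 I2] Fr Ht3.
  assert (Y1 : vr s3 rN = N) by (rewrite Fr by reflexivity; reflexivity).
  assert (Y2 : vr s3 rn = n) by (rewrite Fr by reflexivity; reflexivity).
  fold gMx in I1.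
  assert (Ep5 : forall st, vr st rMx = gMx -> eval st epow5 = gMx ^ 5).
  { intros st E. unfold epow5. cbn [eval opf]. rewrite E. simpl. lia. }
  assert (Ep11 : forall st, vr st rMx = gMx -> eval st epow11 = gQ).
  { intros st E. unfold epow11. cbn [eval opf]. rewrite (Ep5 st E), E. unfold gQ.
    change 11 with (5 + 5 + 1). rewrite !Nat.pow_add_r, Nat.pow_1_r. reflexivity. }
  apply wp_seq, wp_asg; rewrite Ep11 by exact I1; [lia|].
  match goal with |- wp _ _ ?st _ => set (s4 := st) end.
  assert (EH : eval s4 (Num 16 [*] epow5 [*] (Var rQ [*] Var rQ)) = gH).
  { change (16 * eval s4 epow5 * (vr s4 rQ * vr s4 rQ) = gH). rewrite Ep5 by exact I1.
    unfold s4. cbn [vr setv upd Nat.eqb]. unfold gH, gG. lia. }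
  apply wp_seq, wp_asg; rewrite EH; [lia|]. clear EH. subst s4.
  apply wp_seq, wp_asg; cbn [eval opf vr setv upd Nat.eqb]; fold gD; [lia|].
  assert (EHQ : gH / gQ = gG) by (unfold gH; rewrite Nat.mul_comm; apply Nat.div_mul; apply Nat.pow_nonzero; lia).
  apply wp_seq, wp_asg; cbn [eval opf vr setv upd Nat.eqb]; rewrite EHQ; [lia|].
  apply wp_seq, wp_asg; cbn [eval opf vr setv upd Nat.eqb]; rewrite I1; fold gS; [lia|].
  apply wp_seq, wp_asg; cbn [eval opf vr setv upd Nat.eqb]; [lia|].
  apply wp_seq, wp_asg; cbn [eval opf vr setv upd Nat.eqb]; [lia|].
  apply wp_seq, wp_asg; cbn [eval opf vr setv upd Nat.eqb]; [lia|].
  apply wp_seq, wp_asg; cbn [eval opf vr setv upd Nat.eqb]; [lia|].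
  apply wp_seq, wp_asg; cbn [eval opf vr setv upd Nat.eqb]; [lia|].
  apply wp_seq, wp_sto; cbn [eval opf vr setv upd Nat.eqb]; [lia|].
  match goal with |- wp _ _ ?st _ => set (s5 := st) end.
  assert (HnS : 128 * n + 128 <= gS) by (unfold gS; lia).
  assert (HNS : N < gS) by (unfold gS; lia).
  assert (G5 : genv gD gH gQ gG gS N s5).
  { unfold genv, num_regs, s5. cbn [vr setv seth upd Nat.eqb]. repeat split; auto. }
  assert (E5n : vr s5 rn = n) by exact Y2.
  assert (H5 : forall x, hp s5 x = hupd (hp s) gS 1 x).
  { intros x. unfold s5. cbn [hp setv seth]. unfold hupd, upd. destruct (x =? gS); auto. }
  clearbody s5.
  apply wp_seq.
  apply wp_for with (n := n + 1) (t := fun _ => 60)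
    (I := fun k h => (forall x, x < gS \/ 2 * gS <= x -> h x = hp s x) /\
       (forall i, i < gS -> h (gS + i) <= 1 /\ (h (gS + i) = 1 <-> (i = 0 \/ exists j, j < k /\ a j = i)))).
  { reflexivity. }
  { lia. }
  { intros s6 i _ Fr6 _ _. cbn [eval opf]. rewrite Fr6 by reflexivity. rewrite E5n. reflexivity. }
  { split.
    - intros x Hx. rewrite H5, hupd_neq by lia. reflexivity.
    - intros i Hi. rewrite H5. destruct (Nat.eq_dec i 0) as [->|Hi0].
      + rewrite Nat.add_0_r, hupd_eq. split; [lia|]. split; auto.
      + rewrite hupd_neq, Hz by lia. split; [lia|]. split; [discriminate|].
        intros [|(j & Hj & _)]; lia. }
  { intros k s6 Hk Ek Fr6 [B1 B2].
    assert (Yn : vr s6 rn = n) by (rewrite Fr6 by reflexivity; exact E5n).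
    assert (YS : vr s6 rS = gS) by (rewrite Fr6 by reflexivity; apply G5).
    assert (Hak : a k <= N) by (rewrite <- EN; apply (weight_mono n a N EN Hval Ha0); lia).
    assert (Had : addr n k < gS).
    { unfold addr. destruct (Nat.ltb_spec k 127); lia. }
    assert (Ek2 : eval s6 (Var rS [+] Ld (eaddr (Var rk))) = gS + a k).
    { change (vr s6 rS + hp s6 (eval s6 (eaddr (Var rk))) = gS + a k).
      rewrite (eval_eaddr s6 (Var rk) n k) by auto. rewrite YS, B1 by lia.
      rewrite Hin by lia. reflexivity. }
    apply wp_sto; [cbn [eval]; lia|]. rewrite Ek2. cbn [eval hp seth].
    split; [split|clear; unfold eaddr; costs; lia].
    - intros x Hx. rewrite hupd_neq by lia. auto.
    - intros i Hi. destruct (B2 i Hi) as [B3 B4].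
      destruct (Nat.eq_dec i (a k)) as [->|Hik].
      + rewrite hupd_eq. split; [lia|]. split; auto. intros _. right. exists k. split; [lia|auto].
      + rewrite hupd_neq by lia. split; [exact B3|]. rewrite B4. split; intros [|(j & Hj & Ej)]; auto.
        * right. exists j. split; [lia|auto].
        * right. exists j. split; [|auto]. destruct (Nat.eq_dec j k) as [->|]; [congruence|lia]. }
  intros s6 t6 [B1 B2] Fr6 _ Ht6.
  assert (G6 : genv gD gH gQ gG gS N s6).
  { destruct G5 as ((Q1 & Q2 & Q3 & Q4) & R1 & R2 & R3 & R4 & R5 & R6 & R7).
    repeat split; rewrite Fr6 by reflexivity; assumption. }
  assert (YS : vr s6 rS = gS) by apply G6.
  apply wp_seq, wp_sto; cbn [eval opf]; [lia|rewrite YS].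
  apply wp_seq, wp_asg; cbn [eval]; [lia|].
  apply wp_seq, wp_asg; cbn [eval opf vr setv seth upd Nat.eqb]; rewrite YS; [lia|].
  apply wp_asg; cbn [eval opf vr setv seth upd Nat.eqb]; rewrite YS; [lia|].
  apply HP; cbn [vr hp setv seth upd Nat.eqb]; auto.
  - intros i Hi. rewrite hupd_neq by lia. destruct (B2 i Hi) as [B3 B4]. split; [exact B3|].
    rewrite B4. unfold wgt. split; (intros [|(j & Hj & Ej)]; [auto|right; exists j; split; [lia|auto]]).
  - apply (iswin_1 n a N EN Hval Ha0).
    + apply hupd_eq.
    + rewrite hupd_neq, B1, Hz by lia. reflexivity.
  - rewrite nsum_const in Ht3, Ht6. revert Ht3 Ht6 F1. clear.
    unfold eaddr, epow11, epow5. costs. lia.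
Qed.

(** * The complete program *)

Definition body : cmd := setup ;; main_loop.

(* The literal registers of the program hold part of the input, so the cells below 128
   are first moved to the block starting at [128 * n]. *)
Definition save_regs (r k : nat) : list instr :=
  flat_map (fun r => [IAdd 0 0 1; IStore 0 r]) (seq r k).

(** At the start only cell 0, which holds n, may be overwritten without losing input: seven
    doublings multiply it by 128 in place. Cell 1 is saved first, since it must then hold the
    increment 1. For n >= 1 the target block lies beyond the input, and the final content 128 n +
    126 of cell 0 still determines n. *)
Definition prelude : program :=
  repeat (IAdd 0 0 0) 7 ++ [IStore 0 1; IConst 1 1] ++ save_regs 2 126.

Definition frob_program : program := prelude ++ comp body (length prelude).

Lemma save_regs_spec W B k r m :
  m 0 = B + r - 2 -> m 1 = 1 -> 2 <= r -> 128 <= B -> B + r + k <= W -> bnd W m ->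
  r + k <= 128 ->
  exists m', srun W (save_regs r k) m m' /\ m' 0 = B + r + k - 2 /\
    (forall x, r <= x < r + k -> m' (B + x - 1) = m x) /\
    (forall x, x <> 0 -> x < B + r - 1 \/ B + r + k - 1 <= x -> m' x = m x).
Proof.
  revert r m. induction k as [|k IH]; intros r m E0 E1 Hr HB HW Hb Hk.
  - exists m. split; [constructor; auto|]. split; [lia|]. split; [intros; lia|auto].
  - set (m1 := upd m 0 (B + S r - 2)). set (m2 := upd m1 (B + r - 1) (m r)).
    assert (B1 : bnd W m1) by (apply bnd_upd; auto; lia).
    assert (B2 : bnd W m2) by (apply bnd_upd; auto).
    destruct (IH (S r) m2) as (m' & R & A1 & A2 & A3); auto; try lia.
    { unfold m2, m1. rewrite upd_neq, upd_eq by lia. reflexivity. }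
    { unfold m2, m1. rewrite !upd_neq by lia. exact E1. }
    exists m'. split; [|split; [|split]].
    + unfold save_regs. cbn [seq flat_map app].
      apply srun_cons with m1; auto.
      { cbn [istep]. unfold m1. rewrite E0, E1. do 2 f_equal. lia. }
      apply srun_cons with m2; auto.
      { cbn [istep]. unfold m2. f_equal.
        replace (m1 0) with (B + r - 1) by (unfold m1; rewrite upd_eq; lia).
        replace (m1 r) with (m r) by (unfold m1; rewrite upd_neq by lia; reflexivity). reflexivity. }
    + rewrite A1. lia.
    + intros x Hx. destruct (Nat.eq_dec x r) as [->|Hxr].
      * rewrite A3 by lia. unfold m2. apply upd_eq.
      * rewrite A2 by lia. unfold m2, m1. rewrite !upd_neq by lia. reflexivity.
    + intros x Hx0 Hx. rewrite A3 by lia. unfold m2, m1. rewrite !upd_neq by lia. reflexivity.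
Qed.

Lemma doubling_spec W k m :
  bnd W m -> 2 ^ k * m 0 <= W ->
  exists m', srun W (repeat (IAdd 0 0 0) k) m m' /\ m' 0 = 2 ^ k * m 0 /\
    (forall x, x <> 0 -> m' x = m x).
Proof.
  revert m; induction k as [|k IH]; intros m Hb HW.
  - exists m. split; [constructor; auto|]. split; [simpl; lia|auto].
  - rewrite Nat.pow_succ_r' in HW.
    assert (Hp : 1 <= 2 ^ k) by (pose proof (Nat.pow_nonzero 2 k); lia).
    set (m1 := upd m 0 (m 0 + m 0)).
    assert (E1 : m1 0 = 2 * m 0) by (unfold m1; rewrite upd_eq; lia).
    assert (B1 : bnd W m1).
    { apply bnd_upd; auto. assert (1 * (2 * m 0) <= 2 ^ k * (2 * m 0)) by (apply Nat.mul_le_mono_r; auto). lia. }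
    destruct (IH m1 B1) as (m' & R & A1 & A2); [rewrite E1; lia|].
    exists m'. split; [|split].
    + cbn [repeat]. apply srun_cons with m1; auto.
    + rewrite A1, E1, Nat.pow_succ_r'. lia.
    + intros x Hx. rewrite A2 by auto. unfold m1. apply upd_neq. auto.
Qed.

Lemma prelude_spec :
  let m0 := mem (init_config n a) in
  exists m', srun gV prelude m0 m' /\ m' 0 = 128 * n + 126 /\
    (forall i, i <= n -> m' (128 + addr n i) = a i) /\
    (forall x, 128 * n <= x -> m' (128 + x) = 0).
Proof.
  intros m0.
  pose proof mu_facts as (F1 & F2 & F3 & F4 & F5).
  pose proof gS_le as (A1 & A2 & A3 & A4 & A5). unfold gS in A3.
  assert (E0 : m0 0 = n) by reflexivity.
  assert (EI : forall i, i <= n -> m0 (S i) = a i).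
  { intros i Hi. unfold m0. cbn [init_config mem]. now rewrite (proj2 (Nat.leb_le i n) Hi). }
  assert (EZ : forall i, n < i -> m0 (S i) = 0).
  { intros i Hi. unfold m0. cbn [init_config mem]. now rewrite (proj2 (Nat.leb_gt i n) Hi). }
  assert (B0 : bnd gV m0).
  { intros [|i]; [rewrite E0; lia|].
    destruct (Nat.le_gt_cases i n) as [Hi|Hi]; [rewrite EI by auto|rewrite EZ by auto; lia].
    assert (a i <= a n) by (apply (weight_mono n a N EN Hval Ha0); auto). lia. }
  destruct (doubling_spec gV 7 m0 B0) as (m1 & R1 & C1 & C2).
  { rewrite E0. change (2 ^ 7) with 128. lia. }
  rewrite E0 in C1. change (2 ^ 7) with 128 in C1.
  pose proof (srun_bnd _ _ _ _ R1) as B1.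
  set (m2 := upd m1 (128 * n) (m1 1)). set (m3 := upd m2 1 1).
  assert (B2 : bnd gV m2) by (apply bnd_upd; auto).
  assert (B3 : bnd gV m3) by (apply bnd_upd; auto; lia).
  destruct (save_regs_spec gV (128 * n) 126 2 m3) as (m4 & R4 & G1 & G2 & G3); auto; try lia.
  { unfold m3, m2. rewrite !upd_neq by lia. lia. }
  exists m4. split; [|split; [|split]].
  - unfold prelude. eapply srun_app; [exact R1|].
    eapply srun_app; [|exact R4].
    apply srun_cons with m2; auto.
    { cbn [istep]. rewrite C1. reflexivity. }
    apply srun_cons with m3; auto.
    constructor. auto.
  - rewrite G1. lia.
  - intros i Hi. unfold addr. destruct (Nat.ltb_spec i 127) as [H1|H1].
    + destruct (Nat.eq_dec i 0) as [->|Hi0].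
      * replace (128 + (128 * (n - 1) + 0)) with (128 * n) by lia.
        rewrite G3 by lia. unfold m3, m2. rewrite upd_neq, upd_eq by lia.
        rewrite C2 by lia. apply EI. lia.
      * replace (128 + (128 * (n - 1) + i)) with (128 * n + S i - 1) by lia.
        rewrite G2 by lia. unfold m3, m2. rewrite !upd_neq by lia.
        rewrite C2 by lia. apply EI. lia.
    + replace (128 + (i - 127)) with (S i) by lia.
      rewrite G3 by lia. unfold m3, m2. rewrite !upd_neq by lia.
      rewrite C2 by lia. apply EI. lia.
  - intros x Hx. rewrite G3 by lia. unfold m3, m2. rewrite !upd_neq by lia.
    rewrite C2 by lia. replace (128 + x) with (S (127 + x)) by lia. apply EZ. lia.
Qed.

Lemma steps_mono P V W k c c' : V <= W -> steps P V k c c' -> steps P W k c c'.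
Proof.
  intros HVW H. assert (Hm : forall m, bnd V m -> bnd W m) by (intros m Hb x; specialize (Hb x); lia).
  induction H; econstructor; eauto.
Qed.

Lemma body_ok : okc body = true.
Proof. vm_compute. reflexivity. Qed.

(** [gMx] is below 48 N and hence at most (N + 2)^4, so [gV] is at most (N + 2)^116; the factor 40
    is [max_size], the price of the values inside expressions. *)
Lemma word_size : gV ^ max_size <= (N + 2) ^ (116 * 40).
Proof.
  pose proof mu_facts as (F1 & F2 & F3 & F4 & F5).
  assert (H1 : gMx <= (N + 2) ^ 4).
  { apply Nat.le_trans with (48 * (N + 2)); [lia|].
    rewrite Nat.pow_succ_r', Nat.mul_comm. apply Nat.mul_le_mono_l.
    apply Nat.le_trans with (5 ^ 3); [simpl; lia|apply Nat.pow_le_mono_l; lia]. }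
  unfold gV, max_size. rewrite <- Nat.pow_mul_r.
  apply Nat.le_trans with (((N + 2) ^ 4) ^ (29 * 40)); [apply Nat.pow_le_mono_l; auto|].
  rewrite <- Nat.pow_mul_r. apply Nat.pow_le_mono_r; lia.
Qed.

Theorem frob_program_correct :
  exists k,
    k <= 20 * 1000 * 1000 * (N * (Nat.log2 N + 1) * (Nat.log2 (F / N) + 1)) /\
    halts_with frob_program n a k F ((N + 2) ^ (116 * 40)).
Proof.
  pose proof mu_facts as (F1 & F2 & F3 & F4 & F5).
  pose proof gS_le as (A1 & A2 & A3 & A4 & A5). unfold gS in A3.
  destruct prelude_spec as (m1 & R1 & C1 & C2 & C3).
  pose proof (srun_bnd _ _ _ _ R1) as B1.
  set (s1 := St m1 (fun x => m1 (128 + x))).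
  assert (Hrun : wp gV body s1 (fun s' t => vr s' 0 = F /\
     t <= 200 * N + 100 * mu + 1000 +
          10 * 1000 * 1000 * (N * (Nat.log2 N + 1) * (Nat.log2 (F / N) + 1)))).
  { unfold body. apply wp_seq. apply setup_spec; auto.
    intros s2 t2 G2 K2 E1 E2 E3 W2 Ht2.
    apply (main_loop_spec gV gD gH gQ gG (11 * mu) gS gMx N n F a setup_glob EN Hval Ha0 HF
      setup_b setup_V1 setup_V2); auto.
    intros s3 t3 EF Ht3. split; [exact EF|]. clear - Ht2 Ht3. lia. }
  destruct Hrun as (s2 & t & X & EF & Ht).
  assert (HV128 : 128 <= gV) by lia.
  destruct (comp_correct gV (gV ^ max_size) frob_program HV128 (le_n _) body s1 s2 t X
    (length prelude) m1) as (m2 & S2 & Rel2 & B2 & _).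
  { exact body_ok. }
  { exists prelude, []. rewrite app_nil_r. split; reflexivity. }
  { split; intros; apply B1. }
  { split; intros; reflexivity. }
  { intros x. specialize (B1 x).
    assert (gV ^ 1 <= gV ^ max_size) by (apply Nat.pow_le_mono_r; unfold max_size; lia).
    rewrite Nat.pow_1_r in *. lia. }
  assert (HVW : gV <= gV ^ max_size).
  { rewrite <- (Nat.pow_1_r gV) at 1. apply Nat.pow_le_mono_r; unfold max_size; lia. }
  assert (S1 : steps frob_program gV (length prelude) (init_config n a)
                 (Config (length prelude) m1)).
  { apply (srun_steps frob_program gV prelude (mem (init_config n a)) m1 R1 0).
    exists [], (comp body (length prelude)). split; reflexivity. }
  pose proof (steps_trans _ _ _ _ _ _ _ (steps_mono _ _ _ _ _ _ HVW S1) S2) as St.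
  apply (steps_mono _ _ _ _ _ _ word_size) in St.
  destruct (steps_run _ _ _ _ _ St) as [Hr Hb].
  exists (length prelude + t). split.
  - pose proof setup_b as Hmu.
    assert (Hlen : length prelude = 261) by reflexivity.
    set (lam := Nat.log2 N + 1) in *. set (rho := Nat.log2 (F / N) + 1) in *.
    assert (1 <= lam) by (unfold lam; lia). assert (1 <= rho) by (unfold rho; lia).
    assert (Y1 : N * 1 <= N * lam) by (apply Nat.mul_le_mono_l; auto).
    assert (Y2 : 1 * lam <= N * lam) by (apply Nat.mul_le_mono_r; lia).
    assert (Y3 : N * lam * 1 <= N * lam * rho) by (apply Nat.mul_le_mono_l; auto).
    rewrite Hlen. clear - Ht Hmu Y1 Y2 Y3 F1 H.
    set (Y := N * lam * rho) in *. clearbody Y. set (y := N * lam) in *. clearbody y. lia.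
  - split; [|exact Hb].
    exists (Config (length prelude + clen body) m2). split; [exact Hr|]. split.
    + unfold step. cbn [pc].
      rewrite (proj2 (nth_error_None frob_program (length prelude + clen body))); [reflexivity|].
      unfold frob_program. rewrite length_app, comp_length. lia.
    + cbn [mem]. rewrite (proj1 Rel2) by lia. exact EF.
Qed.

End Setup.

(** * Sumsets in cyclic groups *)

From mathcomp Require ssreflect ssrfun ssrbool eqtype ssrnat seq choice fintype bigop finset ssralg finalg zmodp div zify.

Module Sumset.
Import mathcomp.boot.ssreflect mathcomp.boot.ssrfun mathcomp.boot.ssrbool.
Import mathcomp.boot.eqtype mathcomp.boot.ssrnat mathcomp.boot.seq mathcomp.boot.choice.
Import mathcomp.boot.fintype mathcomp.boot.bigop mathcomp.boot.finset mathcomp.boot.div.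
Import mathcomp.algebra.ssralg mathcomp.algebra.finalg mathcomp.algebra.zmodp mathcomp.zify.zify.
Import GRing.Theory.
Local Open Scope ring_scope.

Section Growth.
Variable G : finZmodType.
Implicit Types A : {set G}.

Definition sumset A := [set x + y | x in A, y in A].

Definition shift_cap A (x : G) := [set a in A | a - x \in A].

(** The translates a + A and b + A lie in A + A, and their intersection embeds into A cut with its
    own shift by b - a; counting union and intersection gives the inequality. *)
Lemma sub_shift_cap A a b :
  a \in A -> b \in A -> (2 * #|A| <= #|sumset A| + #|shift_cap A (b - a)%R|)%N.
Proof.
move=> aA bA.
pose Aa := [set a + x | x in A]; pose Ab := [set b + x | x in A].
have cA : #|Aa| = #|A| by apply: card_imset; apply: addrI.
have cB : #|Ab| = #|A| by apply: card_imset; apply: addrI.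
have sU : Aa :|: Ab \subset sumset A.
  apply/subsetP => z; rewrite inE => /orP[] /imsetP[x xA ->]; exact: imset2_f.
have sI : (#|Aa :&: Ab| <= #|shift_cap A (b - a)%R|)%N.
  rewrite -(card_imset (mem (shift_cap A (b - a))) (addrI a)).
  apply/subset_leq_card/subsetP => z; rewrite inE => /andP[/imsetP[x xA ->] /imsetP[y yA e]].
  apply: imset_f; rewrite inE xA /=.
  suff -> : x - (b - a) = y by [].
  by rewrite opprB addrA [x + a]addrC e addrAC subrr add0r.
have := cardsUI Aa Ab; rewrite cA cB mul2n -addnn => <-.
by rewrite leq_add // subset_leq_card.
Qed.

(* Freiman: a set of doubling less than 3/2 has a subgroup as difference set. *)
Lemma small_doubling A :
  0 \in A -> (2 * #|sumset A| < 3 * #|A|)%N ->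
  (forall H : {set G}, (forall x y, x \in H -> y \in H -> x - y \in H) ->
     A \subset H -> H = [set: G]) ->
  sumset A = [set: G].
Proof.
move=> A0 small gen.
pose D := [set x - y | x in A, y in A].
have big x : x \in D -> (#|A| < 2 * #|shift_cap A x|)%N.
  case/imset2P => b a bA aA ->.
  have := sub_shift_cap A a b aA bA.
  move: small; set s := #|sumset A|; set c := #|A|; set r := #|_|.
  lia.
have Dsub x y : x \in D -> y \in D -> x - y \in D.
  move=> xD yD.
  (* Two subsets of [A] with more than half of its elements meet; a common z shows x - y to be the
     difference of z - y and z - x, both in [A]. *)
  have /set0Pn[z] : shift_cap A x :&: shift_cap A y != set0.
    apply/negP => /eqP e0.
    have := cardsUI (shift_cap A x) (shift_cap A y); rewrite e0 cards0 addn0 => eU.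
    have : (#|shift_cap A x :|: shift_cap A y| <= #|A|)%N.
      apply/subset_leq_card/subsetP => z; rewrite !inE => /orP[] /andP[] //.
    by have := big x xD; have := big y yD; rewrite eU; lia.
  rewrite !inE => /andP[/andP[zA zx] /andP[_ zy]].
  have -> : x - y = (z - y) - (z - x) by rewrite opprB [RHS]addrC addrA subrK.
  exact: imset2_f.
have DT : D = [set: G].
  apply: gen => //; apply/subsetP => x xA; rewrite -[x]subr0; exact: imset2_f.
(* Double counting: every ordered pair of elements of [A] has exactly one difference x. *)
have tot : (\sum_(x : G) #|shift_cap A x| = #|A| * #|A|)%N.
  under eq_bigr => x _ do rewrite -sum1dep_card.
  rewrite (exchange_big_dep (mem A)) /=; last by move=> x a _ /andP[].
  rewrite (eq_bigr (fun=> #|A|)) ?sum_nat_const // => a aA.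
  rewrite sum1dep_card -(card_imset A (can_inj (@subKr G a))).
  apply: eq_card => x; rewrite inE aA /=; apply/idP/imsetP.
    by move=> h; exists (a - x); rewrite ?subKr.
  by case=> y yA ->; rewrite subKr.
(* As every x is a difference, each of the #|G| shifts contributes more than #|A| / 2 to the total
   #|A|^2. So [A] fills more than half of the group and meets g - A for every g, which writes g as a
   sum. *)
have half : (#|G| < 2 * #|A|)%N.
  have cA0 : (0 < #|A|)%N by apply/card_gt0P; exists 0.
  have : (#|G| * #|A|.+1 <= 2 * (#|A| * #|A|))%N.
    rewrite -tot big_distrr /= -sum_nat_const; apply: leq_sum => x _.
    by apply: big; rewrite DT inE.
  have cG : (0 < #|G|)%N by apply/card_gt0P; exists 0.
  move=> h; rewrite -(ltn_pmul2r cA0); move: h cG.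
  rewrite mulnS mulnA; set u := (#|G| * _)%N; set v := (_ * #|A|)%N; set g := #|_|.
  move: u v g => u v g; lia.
apply/eqP; rewrite -subTset; apply/subsetP => g _.
pose B := [set g - x | x in A].
have cB : #|B| = #|A| by apply: card_imset; apply: (can_inj (subKr g)).
have /set0Pn[z] : A :&: B != set0.
  apply/negP => /eqP e0; have := cardsUI A B; rewrite e0 cards0 addn0 cB => eU.
  have := max_card (mem (A :|: B)); rewrite eU addnn -mul2n => h.
  by have := leq_trans half h; rewrite ltnn.
rewrite inE => /andP[zA /imsetP[y yA e]].
by rewrite -[g](subrK y) -e; apply: imset2_f.
Qed.

Lemma sumset_sub (A : {set G}) : 0 \in A -> A \subset sumset A.
Proof. by move=> A0; apply/subsetP => x xA; rewrite -[x]addr0; apply: imset2_f. Qed.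

Definition dbl (S : {set G}) (k : nat) := iter k sumset S.

Lemma dbl0 (S : {set G}) k : 0 \in S -> 0 \in dbl S k /\ S \subset dbl S k.
Proof.
move=> S0; elim: k => [|k [IH1 IH2]]; first by [].
have sub := sumset_sub _ IH1.
by split; [apply: (subsetP sub) | apply: subset_trans IH2 sub].
Qed.

Lemma dbl_growth (S : {set G}) k :
  0 \in S ->
  (forall H : {set G}, (forall x y, x \in H -> y \in H -> x - y \in H) ->
     S \subset H -> H = [set: G]) ->
  dbl S k = [set: G] \/ (3 ^ k * #|S| <= 2 ^ k * #|dbl S k|)%N.
Proof.
move=> S0 gen; elim: k => [|k IH]; first by right.
have [D0 SD] := dbl0 S k S0.
case: (ltnP (2 * #|dbl S k.+1|) (3 * #|dbl S k|))%N => [small|big].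
  left; apply: small_doubling => // H Hsub DH.
  by apply: gen => //; apply: subset_trans SD DH.
case: IH => [full|IH].
  left; apply/eqP; rewrite -subTset -full; exact: sumset_sub.
right; have X : (2 ^ k * (3 * #|dbl S k|) <= 2 ^ k * (2 * #|dbl S k.+1|))%N.
  by rewrite leq_mul2l big orbT.
rewrite !expnS; move: IH X; move: (3 ^ k)%N (2 ^ k)%N #|S| #|dbl S k| #|dbl S k.+1|.
by move=> u v w x y; nia.
Qed.

(** Two growing doublings gain a factor (3/2)^2 = 9/4, which is at least 2. Unless the set became
    everything before, 2k of them would produce at least 2^k * #|S| elements, more than the group
    has. *)
Lemma dbl_full (S : {set G}) k :
  0 \in S ->
  (forall H : {set G}, (forall x y, x \in H -> y \in H -> x - y \in H) ->
     S \subset H -> H = [set: G]) ->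
  (#|G| < 2 ^ k * #|S|)%N -> dbl S (2 * k) = [set: G].
Proof.
move=> S0 gen lt; case: (dbl_growth S (2 * k) S0 gen) => // big; exfalso.
have c1 : (#|dbl S (2 * k)| <= #|G|)%N by exact: max_card.
move: big; rewrite !expnM => big.
have h1 : (4 ^ k * #|dbl S (2 * k)| <= 4 ^ k * #|G|)%N by rewrite leq_mul2l c1 orbT.
have p4 : (0 < 4 ^ k)%N by rewrite expn_gt0.
have h2 : (4 ^ k * #|G| < 4 ^ k * (2 ^ k * #|S|))%N by rewrite ltn_pmul2l.
have h3 : (4 ^ k * (2 ^ k * #|S|) <= 9 ^ k * #|S|)%N.
  by rewrite mulnA leq_mul2r -expnMn; apply/orP; right; case: (k) => // k'; rewrite leq_exp2r.
have := leq_trans h2 h3; have := leq_trans big h1.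
by move=> a b; have := leq_ltn_trans a b; rewrite ltnn.
Qed.

End Growth.

(** * Residues reached by representable numbers *)

Lemma natpow_expn k : Nat.pow 2 k = (2 ^ k)%N.
Proof. by elim: k => // k IH; rewrite expnS -IH /= mul2n -addnn; lia. Qed.

(** Representatives start at most N and a doubling at most doubles them, whence the factor 2^(2k).
    The generation hypothesis ranges over predicates [K] on nat closed under sums and differences,
    such as preimages of subgroups of Z/N, and congruence is written with multiples of N on both
    sides; the statement is thus free of quotients. *)
Lemma residues_cover (N n : nat) (a : nat -> nat) (Rep : nat -> Prop) (k : nat) :
  (2 <= N)%coq_nat -> Rep 0%N ->
  (forall x y, Rep x -> Rep y -> Rep (x + y)%N) ->
  (forall i, (i < n)%coq_nat -> Rep (a i) /\ (1 <= a i)%coq_nat /\ (a i < N)%coq_nat) ->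
  (forall i j, (i < j)%coq_nat -> (j < n)%coq_nat -> (a i < a j)%coq_nat) ->
  (forall K : nat -> Prop, (forall x y, K x -> K y -> K (x + y)%N) ->
     (forall x y, K (x + y)%N -> K y -> K x) ->
     (forall i, (i < n)%coq_nat -> K (a i)) -> K N -> K 1%N) ->
  (N < Nat.mul (Nat.pow 2 k) (S n))%coq_nat ->
  forall r, exists t u v, Rep t /\ (t <= Nat.mul N (Nat.pow 2 (Nat.mul 2 k)))%coq_nat /\
    (t + u * N = r + v * N)%N.
Proof.
move=> N2 R0 RD Ra amono gen lt r.
have N1 : (1 < N)%N by lia.
have natN : (N%:R : 'Z_N) = 0 by rewrite pchar_Zp.
pose f (i : 'I_n) : 'Z_N := (a i)%:R.
pose S := 0 |: [set f i | i : 'I_n].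
have valf (i : 'I_n) : f i = a i :> nat.
  have [_ [_ h]] := Ra i ltac:(have := ltn_ord i; lia).
  by rewrite /f val_Zp_nat // modn_small //; lia.
have cardS : #|S| = n.+1.
  rewrite cardsU1 card_imset ?card_ord.
    have -> : 0 \notin [set f i | i : 'I_n] by
      apply/negP => /imsetP[i _ /(congr1 (@nat_of_ord _))]; rewrite valf /=;
      have [_ [h _]] := Ra i ltac:(have := ltn_ord i; lia); lia.
    by [].
  move=> i j /(congr1 (@nat_of_ord _)); rewrite !valf => e; apply: val_inj => /=.
  case: (ltngtP i j) => // ij.
    have := amono i j ltac:(lia) ltac:(have := ltn_ord j; lia); lia.
  have := amono j i ltac:(lia) ltac:(have := ltn_ord i; lia); lia.
have S0 : 0 \in S by rewrite !inE eqxx.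
have genS (H : {set 'Z_N}) : (forall x y, x \in H -> y \in H -> x - y \in H) ->
     S \subset H -> H = [set: 'Z_N].
  move=> Hsub SH; have H0 : 0 \in H by apply: (subsetP SH).
  have HD x y : x \in H -> y \in H -> x + y \in H.
    by move=> xH yH; rewrite -[y]opprK (Hsub x) // -sub0r (Hsub 0).
  have K1 : (1%:R : 'Z_N) \in H.
    apply: (gen (fun z => is_true ((z%:R : 'Z_N) \in H))) => [x y|x y h1 h2|i hi|];
      last by rewrite natN.
        by rewrite natrD; apply: HD.
      by have := Hsub _ _ h1 h2; rewrite natrD addrK.
    have hi' : (i < n)%N by lia.
    apply: (subsetP SH); rewrite inE; apply/orP; right.
    by apply/imsetP; exists (Ordinal hi').
  have KK z : (z%:R : 'Z_N) \in H.
    by elim: z => [//|z IH]; rewrite mulrS; apply: HD.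
  by apply/eqP; rewrite -subTset; apply/subsetP => g _; rewrite -(natr_Zp g).
have repk j : forall x, x \in dbl _ S j -> exists t,
    [/\ Rep t, (t <= N * 2 ^ j)%N & x = t%:R].
  elim: j => [|j IH] x.
    rewrite /dbl /= !inE => /orP[/eqP-> | /imsetP[i _ ->]].
      by exists 0%N.
    have [h1 [_ h2]] := Ra i ltac:(have := ltn_ord i; lia).
    by exists (a i); split=> //; lia.
  rewrite /dbl iterS => /imset2P[y z /IH[t [t1 t2 ->]] /IH[u [u1 u2 ->]] ->].
  exists (t + u)%N; split; [exact: RD | | by rewrite natrD].
  by rewrite expnS mulnCA mul2n -addnn leq_add.
have cG : #|'Z_N| = N by rewrite card_ord Zp_cast.
have full : dbl _ S (2 * k) = [set: 'Z_N].
  by apply: dbl_full => //; rewrite cG cardS -natpow_expn; lia.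
have /repk[t [t1 t2 e]] : (r%:R : 'Z_N) \in dbl _ S (2 * k) by rewrite full inE.
exists t, (r %/ N)%N, (t %/ N)%N; split=> //; split.
  by rewrite natpow_expn; lia.
move/(congr1 (@nat_of_ord _)): e; rewrite !val_Zp_nat // => e.
by rewrite {1}(divn_eq t N) {2}(divn_eq r N) e; lia.
Qed.

End Sumset.

(** * The bound on the Frobenius number *)

Lemma gcd_all_n_pos n a : 2 <= a 0 -> gcd_all n a = 1 -> 1 <= n.
Proof.
  intros Ha0 Hgcd. destruct n as [|n]; [|lia].
  unfold gcd_all in Hgcd. simpl in Hgcd. rewrite Nat.gcd_0_r in Hgcd. lia.
Qed.

Section Bounds.
Variables (n : nat) (a : nat -> nat) (N F : nat).
Hypothesis EN : a n = N.
Hypothesis Hval : valid_weights n a.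
Hypothesis Ha0 : 2 <= a 0.
Hypothesis Hgcd : gcd_all n a = 1.
Hypothesis HF : is_frobenius_number n a F.

(** Bezout's identity in the form p * x = gcd + q * y with natural coefficients, so that closure
    under differences inside nat suffices to carry [K] along the iterated gcd. *)
Lemma gcd_all_generates (K : nat -> Prop) :
  (forall x y, K x -> K y -> K (x + y)) ->
  (forall x y, K (x + y) -> K y -> K x) ->
  (forall i, i < n -> K (a i)) -> K N -> K 1.
Proof.
  intros Kadd Ksub Ka KN.
  assert (K0 : K 0) by (apply (Ksub 0 N); auto).
  assert (Kmul : forall c x, K x -> K (c * x)).
  { intros c x Kx. induction c; [exact K0|]. apply Kadd; auto. }
  assert (Kgcd : forall x y, K x -> K y -> K (Nat.gcd x y)).
  { intros x y Kx Ky. destruct (Nat.eq_dec x 0) as [->|Hx]; [exact Ky|].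
    destruct (Nat.gcd_bezout_pos x y ltac:(lia)) as (p & q & E).
    apply (Ksub _ (q * y)); [rewrite <- E|]; auto. }
  rewrite <- Hgcd. unfold gcd_all.
  assert (Hs : forall i, In i (seq 0 (S n)) -> K (a i)).
  { intros i Hi. apply in_seq in Hi. destruct (Nat.eq_dec i n) as [->|Hin].
    - now rewrite EN.
    - apply Ka. lia. }
  induction (seq 0 (S n)) as [|i l IH]; [exact K0|].
  apply Kgcd; [apply Hs; now left|].
  apply IH. intros j Hj. apply Hs. now right.
Qed.

(** Some representable t of bounded size is congruent to F modulo N. If t were at most F, adding
    multiples of N would represent F; hence F < t. *)
Lemma frobenius_bound : F < N * 2 ^ (2 * (Nat.log2 (N / n) + 1)).
Proof.
  pose proof (gcd_all_n_pos n a Ha0 Hgcd) as Hn. pose proof (N_ge n a N EN Hval Ha0) as HnN.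
  set (k := Nat.log2 (N / n) + 1).
  (* By the choice of k, 2^k exceeds the rounded quotient N / n, so already n * 2^k exceeds N. *)
  assert (Hk : N < 2 ^ k * S n).
  { pose proof (Nat.div_mod N n ltac:(lia)) as E.
    pose proof (Nat.mod_upper_bound N n ltac:(lia)) as Hr.
    assert (Hq : 1 <= N / n) by (apply Nat.div_le_lower_bound; lia).
    pose proof (Nat.log2_spec (N / n) ltac:(lia)) as [_ Hl].
    rewrite <- (Nat.add_1_r (Nat.log2 (N / n))) in Hl. fold k in Hl.
    assert (n * (N / n + 1) <= n * 2 ^ k) by (apply Nat.mul_le_mono_l; lia). lia. }
  destruct (Sumset.residues_cover N n a (representable n a) k) with (r := F)
    as (t & u & v & Rt & Ht & E).
  - lia.
  - apply rep_0.
  - apply rep_add.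
  - intros i Hi. pose proof (weight_ge n a N EN Hval Ha0 i ltac:(lia)).
    pose proof (weight_mono n a N EN Hval Ha0 (S i) n ltac:(lia) ltac:(lia)).
    destruct Hval as [_ Hinc]. specialize (Hinc i Hi).
    split; [apply rep_wgt; exists i; split; [lia|auto]|lia].
  - intros i j Hij Hj. pose proof (weight_mono n a N EN Hval Ha0 (S i) j ltac:(lia) ltac:(lia)).
    destruct Hval as [_ Hinc]. specialize (Hinc i ltac:(lia)). lia.
  - apply gcd_all_generates.
  - exact Hk.
  - change (t + u * N = F + v * N) in E.
    apply Nat.lt_le_trans with t; [|exact Ht].
    apply Nat.nle_gt. intros HtF. destruct HF as [Hn' _]. apply Hn'.
    assert (Huv : v <= u).
    { apply Nat.nlt_ge. intros H.
      assert (S u * N <= v * N) by (apply Nat.mul_le_mono_r; lia). lia. }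
    replace F with (t + (u - v) * N) by (rewrite Nat.mul_sub_distr_r; lia).
    apply rep_add; [exact Rt|]. apply rep_mul, (rep_N n a N EN).
Qed.

Lemma frobenius_quotient_log : Nat.log2 (F / N) + 1 <= 2 * (Nat.log2 (N / n) + 1).
Proof.
  pose proof frobenius_bound as HB. set (k := Nat.log2 (N / n) + 1) in *.
  assert (Hd : F / N < 2 ^ (2 * k)) by (apply Nat.Div0.div_lt_upper_bound; exact HB).
  enough (Nat.log2 (F / N) < 2 * k) by lia.
  destruct (Nat.eq_dec (F / N) 0) as [->|H0].
  - rewrite Nat.log2_nonpos; lia.
  - apply Nat.log2_lt_pow2; lia.
Qed.

(** A crude consequence of the bound through 2^l <= N / n <= N; the choice of the word size relies
    on it. *)
Lemma frobenius_cubic : F <= 4 * N ^ 3.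
Proof.
  pose proof (gcd_all_n_pos n a Ha0 Hgcd) as Hn. pose proof (N_ge n a N EN Hval Ha0) as HnN.
  pose proof frobenius_bound as HB.
  assert (Hq : 1 <= N / n) by (apply Nat.div_le_lower_bound; lia).
  pose proof (Nat.log2_spec (N / n) ltac:(lia)) as [Hl _].
  assert (HqN : N / n <= N) by (apply Nat.Div0.div_le_upper_bound; nia).
  set (l := Nat.log2 (N / n)) in *.
  assert (E : 2 ^ (2 * (l + 1)) = 4 * (2 ^ l * 2 ^ l)).
  { replace (2 * (l + 1)) with (l + l + 2) by lia. rewrite !Nat.pow_add_r. simpl. lia. }
  rewrite E in HB.
  assert (2 ^ l * 2 ^ l <= N * N) by (apply Nat.mul_le_mono; lia).
  assert (N * (4 * (2 ^ l * 2 ^ l)) <= N * (4 * (N * N))) by (apply Nat.mul_le_mono_l; lia).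
  simpl. lia.
Qed.

End Bounds.

(* There is a word-RAM program P (words of O(log a_n) bits, i.e. all values
   bounded by (a_n + 2)^c) and a constant K such that on every instance with
   Frobenius number F, P outputs F within
   K * a_n log a_n * log(F/a_n) steps (logs taken as floor(log2) + 1, i.e.
   bounded below by 1); moreover log(F/a_n) = O(log(a_n/n)). *)
Theorem theorem6 :
  exists (P : program) (K c : nat),
    forall (n : nat) (a : nat -> nat),
      valid_weights n a -> gcd_all n a = 1 -> 2 <= a 0 ->
      forall F : nat, is_frobenius_number n a F ->
        (exists k : nat,
            k <= K * (a n * (Nat.log2 (a n) + 1) * (Nat.log2 (F / a n) + 1))
            /\ halts_with P n a k F ((a n + 2) ^ c))
        /\ Nat.log2 (F / a n) + 1 <= K * (Nat.log2 (a n / n) + 1).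
Proof.
  exists frob_program, (20 * 1000 * 1000), (116 * 40).
  intros n a Hval Hgcd Ha0 F HF. split.
  - apply frob_program_correct; auto.
    + exact (gcd_all_n_pos n a Ha0 Hgcd).
    + exact (frobenius_cubic n a (a n) F eq_refl Hval Ha0 Hgcd HF).
  - etransitivity; [exact (frobenius_quotient_log n a (a n) F eq_refl Hval Ha0 Hgcd HF)|].
    apply Nat.mul_le_mono_r. lia.
Qed.
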